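(* Let $d\ge1$, and let $(\Lambda,\phi,\alpha)$ be the cosmological 1-soliton obtained from a nonsingular generalized Kasner metric of parameter $d$ (defined in the context). Consider the system $$\begin{cases}\partial_t(\alpha\,\partial_t\Lambda)-\partial_x(\alpha\,\partial_x\Lambda)=2\alpha\sinh(2\Lambda)\big((\partial_t\phi)^2-(\partial_x\phi)^2\big),\\ \partial_t(\alpha\sinh^2\Lambda\,\partial_t\phi)-\partial_x(\alpha\sinh^2\Lambda\,\partial_x\phi)=0,\\ \partial_t^2\alpha-\partial_x^2\alpha=0.\end{cases}$$ (i) Suppose $\alpha$ solves the wave equation with data $(\alpha,\partial_t\alpha)|_{t=0}=(1+\tilde\alpha_0,\alpha_1)$, $\tilde\alpha_0\in C_c^\infty(\mathbb{R})$, $\alpha_1\in\mathcal{S}(\mathbb{R})$, $\alpha_1>0$, and $\max_{n=0,1,2}(\|\partial_x^n\tilde\alpha_0\|_{L^\infty}+\|\partial_x^n\alpha_1\|_{L^\infty})<\frac12\gamma$, with $\gamma>0$ a fixed sufficiently small constant. Then the 1-soliton is globally defined under suitable small perturbations: for all $\Lambda_0',\phi_0',\Lambda_1',\phi_1'\in C_c^\infty(\mathbb{R})$ there is $\varepsilon_0>0$ such that, for $0\le\varepsilon<\varepsilon_0$, the solution of the system with this $\alpha$ and with initial data at $t=0$ for $(\Lambda,\phi,\partial_t\Lambda,\partial_t\phi)$ equal to those of the 1-soliton plus $\varepsilon(\Lambda_0',\phi_0',\Lambda_1',\phi_1')$ is smooth and defined for all time. (ii) Suppose $\alpha$ is a smooth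 solution of the wave equation on $[0,\infty)\times\mathbb{R}$ of cosmological type, i.e. $\alpha>0$, $\partial_t\alpha>0$ and $(\partial_x\alpha)^2-(\partial_t\alpha)^2<0$ everywhere on $[0,\infty)\times\mathbb{R}$, and that for some $c_0>0$ one has $\alpha>c_0$, and $\partial_t\alpha$ is in the Schwartz class uniformly in time, in the sense that $\partial_t\alpha(t,x)=F(t+x)+H(t-x)$ with $F,H\in\mathcal{S}(\mathbb{R})$. Then for every $v\in\mathbb{R}$ with $|v|<1$ and $\omega(t)=t(\log t)^{-2}$, the 1-soliton satisfies $$\lim_{t\to+\infty}\int_{|x-vt|\le\omega(t)}\Big[(\partial_t\Lambda)^2+(\partial_x\Lambda)^2+\sinh^2(\Lambda)\big((\partial_t\phi)^2+(\partial_x\phi)^2\big)\Big](t,x)\,dx=0.$$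
   Context: Generalized Kasner seed metric: $ds^2=f_0(t,x)(dx^2-dt^2)+\alpha e^{u_0}dy^2+\alpha e^{-u_0}dz^2$ with $u_0=d\ln\alpha$, where $\alpha>0$ is a bounded solution of $\partial_t^2\alpha-\partial_x^2\alpha=0$ and $d\ge1$ is the Kasner parameter. 1-soliton: let $\beta(t,x)$ be a conjugate function of $\alpha$, i.e. $\partial_t\beta=\partial_x\alpha$, $\partial_x\beta=\partial_t\alpha$ (unique up to an additive real constant; bounded in the situations considered). Fix $w>0$ sufficiently large, in particular with $w>\sup(\alpha+\beta)$, so that $$\mu=w-\beta-\sqrt{(w-\beta)^2-\alpha^2}$$ is real-valued and positive, and set $m=\mu/\alpha\in(0,1)$. The 1-soliton with Kasner background is $$g^{(1)}=\frac{\alpha}{m^d+m^{-d}}\begin{pmatrix}\alpha^d(m^{d+1}+m^{-d-1})&m^{-1}-m\\ m^{-1}-m&\alpha^{-d}(m^{d-1}+m^{-d+1})\end{pmatrix},\qquad\det g^{(1)}=\alpha^2.$$ Its coordinates $(\Lambda,\phi)$, with $\Lambda>0$ and $\phi$ smooth (unique modulo $\pi\mathbb{Z}$), are defined by $$g^{(1)}=\alpha\begin{pmatrix}\cosh\Lambda+\cos2\phi\sinh\Lambda&\sin2\phi\sinh\Lambda\\ \sin2\phi\sinh\Lambda&\cosh\Lambda-\cos2\phi\sinh\Lambda\end{pmatrix},$$ equivalently $$\cosh\Lambda=\frac{\alpha^d(m^{d+1}+m^{-d-1})+\alpha^{-d}(m^{d-1}+m^{-d+1})}{2(m^d+m^{-d})},\quad\tan2\phi=\frac{2(m^{-1}-m)}{\alpha^d(m^{d+1}+m^{-d-1})-\alpha^{-d}(m^{d-1}+m^{-d+1})}$$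 together with the off-diagonal identity $\sin2\phi\,\sinh\Lambda=(m^{-1}-m)/(m^d+m^{-d})$. $\mathcal{S}(\mathbb{R})$ is the Schwartz class. *)

(* Defs.v *)
From Stdlib Require Import Reals Lra.
From Coquelicot Require Import Coquelicot.
Open Scope R_scope.

(* Fields are functions of (t, x), only meaningful for t >= 0; their values at
   t < 0 are junk.  Time derivatives are therefore taken within [0, +oo): they
   are one-sided at t = 0 and the usual ones for t > 0. *)
Definition is_Dt (f : R -> R -> R) (t x l : R) : Prop :=
  filterlim (fun s => (f s x - f t x) / (s - t))
            (within (fun s => 0 <= s) (locally' t)) (locally l).

Definition Dt (f : R -> R -> R) (t x : R) : R := iota (fun l : R => is_Dt f t x l).

Definition is_Dx (f : R -> R -> R) (t x l : R) : Prop := is_derive (f t) x l.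

Definition Dx (f : R -> R -> R) (t x : R) : R := Derive (f t) x.

Lemma proper_within_nonneg (t : R) :
  0 <= t -> ProperFilter' (within (fun s => 0 <= s) (locally' t)).
Proof.
intros Ht; split.
- intros [e He]; refine (He (t + e / 2) _ _ _); destruct e as [e e0]; simpl in *.
  + unfold ball; simpl; unfold AbsRing_ball, abs, minus, plus, opp; simpl.
    rewrite Rabs_pos_eq; lra.
  + lra.
  + lra.
- apply within_filter, within_filter, locally_filter.
Qed.

Lemma is_Dt_unique (f : R -> R -> R) (t x l : R) :
  0 <= t -> is_Dt f t x l -> Dt f t x = l.
Proof.
intros Ht H; unfold Dt, is_Dt.
exact (iota_filterlim_locally (FF := proper_within_nonneg t Ht) _ l H).
Qed.

(* The time interval [0, T), with T = p_infty allowed. *)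
Definition before (T : Rbar) (t : R) : Prop := 0 <= t /\ Rbar_lt (Finite t) T.

(* C^oo on [0, T) x R, up to the boundary t = 0: J i j is the family of mixed
   derivatives of order i in t and j in x. *)
Definition smooth_before (T : Rbar) (f : R -> R -> R) : Prop :=
  exists J : nat -> nat -> R -> R -> R,
    J 0%nat 0%nat = f /\
    forall i j : nat,
      (forall t x, before T t -> is_Dt (J i j) t x (J (S i) j t x)) /\
      (forall t x, before T t -> is_Dx (J i j) t x (J i (S j) t x)) /\
      continuous_on (fun p : R * R => before T (fst p))
                    (fun p : R * R => J i j (fst p) (snd p)).

Definition smooth (f : R -> R -> R) : Prop := smooth_before p_infty f.

Definition smooth_fun (f : R -> R) : Prop :=
  forall (n : nat) (x : R), ex_derive_n f n x.

Definition Cc_infty (f : R -> R) : Prop :=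
  smooth_fun f /\ exists r : R, forall x, r < Rabs x -> f x = 0.

Definition Schwartz (f : R -> R) : Prop :=
  smooth_fun f /\
  forall k n : nat, exists C : R, forall x, Rabs x ^ k * Rabs (Derive_n f n x) <= C.

(* The essential supremum is replaced by the supremum; the two agree on
   continuous functions. *)
Definition Linf_norm (f : R -> R) : Rbar :=
  Lub_Rbar (fun y => exists x, y = Rabs (f x)).

Definition wave_at (alpha : R -> R -> R) (t x : R) : Prop :=
  Dt (Dt alpha) t x - Dx (Dx alpha) t x = 0.

Definition Lambda_eq_at (Lambda phi alpha : R -> R -> R) (t x : R) : Prop :=
  Dt (fun s y => alpha s y * Dt Lambda s y) t x
  - Dx (fun s y => alpha s y * Dx Lambda s y) t x
  = 2 * alpha t x * sinh (2 * Lambda t x) * (Dt phi t x ^ 2 - Dx phi t x ^ 2).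

Definition phi_eq_at (Lambda phi alpha : R -> R -> R) (t x : R) : Prop :=
  Dt (fun s y => alpha s y * sinh (Lambda s y) ^ 2 * Dt phi s y) t x
  - Dx (fun s y => alpha s y * sinh (Lambda s y) ^ 2 * Dx phi s y) t x
  = 0.

Definition solution_before (T : Rbar) (Lambda phi alpha : R -> R -> R) : Prop :=
  smooth_before T Lambda /\ smooth_before T phi /\ smooth_before T alpha /\
  forall t x, before T t ->
    Lambda_eq_at Lambda phi alpha t x /\
    phi_eq_at Lambda phi alpha t x /\
    wave_at alpha t x.

Definition has_data (Lambda phi : R -> R -> R) (L0 p0 L1 p1 : R -> R) : Prop :=
  forall x, Lambda 0 x = L0 x /\ phi 0 x = p0 x /\
            Dt Lambda 0 x = L1 x /\ Dt phi 0 x = p1 x.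

(* The smooth solution of the initial value problem, with alpha given, is
   defined for all t >= 0: there is a global smooth solution, and every smooth
   solution on some [0, T) x R with the same data is a restriction of it. *)
Definition solution_is_global (alpha : R -> R -> R) (L0 p0 L1 p1 : R -> R) : Prop :=
  exists Lambda phi : R -> R -> R,
    solution_before p_infty Lambda phi alpha /\
    has_data Lambda phi L0 p0 L1 p1 /\
    forall (T : Rbar) (Lambda' phi' : R -> R -> R),
      solution_before T Lambda' phi' alpha ->
      has_data Lambda' phi' L0 p0 L1 p1 ->
      forall t x, before T t -> Lambda' t x = Lambda t x /\ phi' t x = phi t x.

(* A nonsingular generalized Kasner metric
     f0 (dx^2 - dt^2) + alpha^(1+d) dy^2 + alpha^(1-d) dz^2
   enters the soliton construction only through d and alpha. *)
Definition kasner_seed (alpha : R -> R -> R) : Prop :=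
  smooth alpha /\
  (forall t x, 0 <= t -> wave_at alpha t x) /\
  (forall t x, 0 <= t -> 0 < alpha t x) /\
  (exists M : R, forall t x, 0 <= t -> alpha t x <= M).

Definition conjugate_function (alpha beta : R -> R -> R) : Prop :=
  forall t x, 0 <= t ->
    is_Dt beta t x (Dx alpha t x) /\ is_Dx beta t x (Dt alpha t x).

Definition mu (w : R) (alpha beta : R -> R -> R) (t x : R) : R :=
  w - beta t x - sqrt ((w - beta t x) ^ 2 - alpha t x ^ 2).

(* g^(1) at a point where alpha = a and m = mu / alpha. *)
Definition g1 (d a m : R) : matrix 2 2 :=
  let c := a / (Rpower m d + Rpower m (- d)) in
  [[c * (Rpower a d * (Rpower m (d + 1) + Rpower m (- d - 1))), c * (/ m - m)],
   [c * (/ m - m), c * (Rpower a (- d) * (Rpower m (d - 1) + Rpower m (- d + 1)))]].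

Definition g_coord (L p a : R) : matrix 2 2 :=
  [[a * (cosh L + cos (2 * p) * sinh L), a * (sin (2 * p) * sinh L)],
   [a * (sin (2 * p) * sinh L), a * (cosh L - cos (2 * p) * sinh L)]].

(* (Lambda, phi, alpha) is a 1-soliton with Kasner background of parameter d.
   The condition w > sup (alpha + beta) is what makes mu real and positive. *)
Definition one_soliton (d : R) (Lambda phi alpha : R -> R -> R) : Prop :=
  kasner_seed alpha /\
  exists (beta : R -> R -> R) (w : R),
    conjugate_function alpha beta /\
    0 < w /\
    Rbar_lt (Lub_Rbar (fun y => exists t x, 0 <= t /\ y = alpha t x + beta t x))
            (Finite w) /\
    smooth phi /\
    forall t x, 0 <= t ->
      0 < Lambda t x /\
      g_coord (Lambda t x) (phi t x) (alpha t x)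
      = g1 d (alpha t x) (mu w alpha beta t x / alpha t x).

Definition cosmological_type (alpha : R -> R -> R) : Prop :=
  forall t x, 0 <= t ->
    0 < alpha t x /\ 0 < Dt alpha t x /\ Dx alpha t x ^ 2 - Dt alpha t x ^ 2 < 0.

Definition energy_density (Lambda phi : R -> R -> R) (t x : R) : R :=
  Dt Lambda t x ^ 2 + Dx Lambda t x ^ 2
  + sinh (Lambda t x) ^ 2 * (Dt phi t x ^ 2 + Dx phi t x ^ 2).

Definition omega (t : R) : R := t / ln t ^ 2.

(* Main.v *)
Require Import Defs.
From Stdlib Require Import Reals Lra Lia List.
From Coquelicot Require Import Coquelicot.
Import Defs.
Open Scope R_scope.

(** Let [d_+ = d_t + d_x] and [d_- = d_t - d_x].  In terms of the null derivatives
    the system reads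
      [d_- d_+ Lambda = - (r d_- Lambda + s d_+ Lambda) / 2 + 2 sinh (2 Lambda) d_+ phi d_- phi],
      [d_- d_+ phi = - (r d_- phi + s d_+ phi) / 2
         - coth Lambda (d_+ Lambda d_- phi + d_- Lambda d_+ phi)],
    where [r = d_+ ln alpha] and [s = d_- ln alpha]: it is the equation of a wave
    map to the hyperbolic plane, in polar coordinates, with damping by [alpha].
    Every term on the right is a product of a quantity transported along
    [x + t = const] and one transported along [x - t = const].

    The soliton.  Along the two null directions [ln m] moves proportionally to
    [ln alpha], with coefficients [(1 + m) / (1 - m)] and its inverse
    ([soliton_frame]).  Differentiating the entries of [g^(1) / alpha], rational in
    [alpha^d], [m^d] and [m], shows that the soliton solves the system
    ([soliton_wave_map]) and that its null derivatives are bounded by [r] and [s]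
    times [d + kappa] ([soliton_speed]).  Since [d_+ alpha] is a function of
    [x + t] and [d_- alpha] one of [x - t], decaying with the data, so do the null
    derivatives of [Lambda] and, weighted by [sinh Lambda], of [phi].

    Part (ii) follows: in the region of integration both [|t + x|] and [|t - x|]
    are at least a multiple of [t], and the energy density is [O(t^-4)]
    ([energy_decay]).

    Part (i).  Relative to the weights [1 / (1 + (x + t)^2)] and
    [1 / (1 + (x - t)^2)], compactly supported perturbations and the derivatives of
    the soliton are bounded, and each interaction term carries the product of both
    weights, which is integrable along every characteristic.  With the additional
    weight [exp (lambda (atan (t + x) + atan (t - x)))], [lambda] large, the map
    defined by the integrated equations contracts on all times at once ([picard]).
    For small [epsilon] the solution stays close to the soliton, for which [Lambda]
    is bounded below ([soliton_bounds]), so that the singularity of [coth] at 0 is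
    never met.  The solution so obtained is only continuous; difference quotients
    and Gronwall's inequality on backward cones give [x]-derivatives of all orders
    ([space_derivative_exists], [polynomial_system_smooth]), and the equations give
    those in [t].  Uniqueness among smooth solutions is local in cones
    ([difference_vanishes], [solution_unique]). *)

(** * Functions on the closed half-plane of nonnegative times *)

(** Values at negative times are junk: continuity up to [t = 0] is that of the
    extension which is constant in time for [t <= 0]. *)
Definition cont (f : R -> R -> R) : Prop :=
  forall t x, continuity_2d_pt (fun s y => f (Rmax 0 s) y) t x.

Lemma Rmax0_id t : 0 <= t -> Rmax 0 t = t.
Proof. intros; apply Rmax_right; lra. Qed.

Lemma Rmax0_ge t : 0 <= Rmax 0 t.
Proof. apply Rmax_l. Qed.

Lemma Rmax0_lip s t : Rabs (Rmax 0 s - Rmax 0 t) <= Rabs (s - t).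
Proof.
unfold Rmax; destruct (Rle_dec 0 s), (Rle_dec 0 t); unfold Rabs;
  repeat destruct Rcase_abs; lra.
Qed.

Lemma cont_ext f g : (forall t x, 0 <= t -> f t x = g t x) -> cont f -> cont g.
Proof.
intros H Hf t x; apply continuity_2d_pt_ext with (fun s y => f (Rmax 0 s) y).
- intros; apply H, Rmax0_ge.
- apply Hf.
Qed.

Lemma cont_const c : cont (fun _ _ => c).
Proof. intros t x; apply continuity_2d_pt_const. Qed.

Lemma cont_plus f g : cont f -> cont g -> cont (fun t x => f t x + g t x).
Proof. intros Hf Hg t x; apply (continuity_2d_pt_plus _ _ _ _ (Hf t x) (Hg t x)). Qed.

Lemma cont_minus f g : cont f -> cont g -> cont (fun t x => f t x - g t x).
Proof. intros Hf Hg t x; apply (continuity_2d_pt_minus _ _ _ _ (Hf t x) (Hg t x)). Qed.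

Lemma cont_mult f g : cont f -> cont g -> cont (fun t x => f t x * g t x).
Proof. intros Hf Hg t x; apply (continuity_2d_pt_mult _ _ _ _ (Hf t x) (Hg t x)). Qed.

Lemma cont_comp1 (h : R -> R) f :
  (forall t x, 0 <= t -> continuity_pt h (f t x)) -> cont f ->
  cont (fun t x => h (f t x)).
Proof.
intros Hh Hf t x.
apply (continuity_1d_2d_pt_comp h (fun s y => f (Rmax 0 s) y)); [|apply Hf].
apply Hh, Rmax0_ge.
Qed.

Lemma continuity_pt_Rmax0 t : continuity_pt (Rmax 0) t.
Proof.
apply continuity_pt_filterlim, filterlim_locally; intros eps; exists eps; intros s Hs.
apply Rle_lt_trans with (2 := Hs), Rmax0_lip.
Qed.

Lemma cont_time : cont (fun t _ => t).
Proof.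
intros t x; apply (continuity_1d_2d_pt_comp (Rmax 0) (fun s _ => s)).
- apply continuity_pt_Rmax0.
- apply continuity_2d_pt_id1.
Qed.

Lemma cont_space : cont (fun _ x => x).
Proof. intros t x; apply continuity_2d_pt_id2. Qed.

Lemma cont_char (g : R -> R) c :
  (forall y, continuity_pt g y) -> cont (fun t x => g (x - c * t)).
Proof.
intros Hg; apply (cont_comp1 g (fun t x => x - c * t)); [intros; apply Hg|].
apply cont_minus; [apply cont_space|].
apply cont_mult; [apply cont_const|apply cont_time].
Qed.

Lemma cont_curve f (a b : R -> R) s :
  cont f -> continuous a s -> continuous b s ->
  continuous (fun s => f (Rmax 0 (a s)) (b s)) s.
Proof.
intros Hf Ha Hb.
apply (continuous_comp_2 a b (fun u v => f (Rmax 0 u) v)); auto.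
apply (proj1 (continuity_2d_pt_filterlim (fun u v => f (Rmax 0 u) v) _ _)), Hf.
Qed.

Lemma cont_on_char f c t x s :
  cont f -> continuous (fun s => f (Rmax 0 s) (x - c * (t - s))) s.
Proof.
intros Hf; apply (cont_curve f (fun s => s) (fun s => x - c * (t - s))); auto.
- apply continuous_id.
- apply (ex_derive_continuous (fun s => x - c * (t - s))); auto_derive; auto.
Qed.

Lemma cont_ucont f T X eps :
  cont f -> 0 < eps ->
  exists d, 0 < d /\ forall t x s y,
    0 <= t <= T -> Rabs x <= X -> 0 <= s <= T -> Rabs y <= X ->
    Rabs (s - t) < d -> Rabs (y - x) < d -> Rabs (f s y - f t x) < eps.
Proof.
intros Hf He.
destruct (uniform_continuity_2d (fun s y => f (Rmax 0 s) y) 0 T (-X) X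
  (fun x y _ _ => Hf x y) (mkposreal _ He)) as [d Hd].
exists d; split; [apply cond_pos|].
intros t x s y Ht Hx Hs Hy Hst Hxy; simpl in Hd.
specialize (Hd t x s y); rewrite !Rmax0_id in Hd by lra.
apply Rabs_le_between in Hx; apply Rabs_le_between in Hy.
apply Hd; auto; lra.
Qed.

Lemma cont_bounded f T X :
  cont f -> exists M, 0 < M /\
    forall t x, 0 <= t <= T -> Rabs x <= X -> Rabs (f t x) <= M.
Proof.
intros Hf.
destruct (cont_ucont f T X 1 Hf Rlt_0_1) as [d [Hd H]].
destruct (INR_unbounded ((Rabs T + Rabs X) / d)) as [n Hn].
exists (Rabs (f 0 0) + INR n + 1); split.
{ generalize (Rabs_pos (f 0 0)) (pos_INR n); lra. }
intros t x Ht Hx.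
assert (HX := Rabs_pos x).
assert (Hnd : Rabs T + Rabs X < INR n * d).
{ apply Rmult_lt_reg_r with (/ d); [apply Rinv_0_lt_compat; lra|].
  replace (INR n * d * / d) with (INR n) by (field; lra). exact Hn. }
rewrite (Rabs_right T) in Hnd by lra; rewrite (Rabs_right X) in Hnd by lra.
assert (Hn0 : 0 < INR n).
{ apply Rmult_lt_reg_r with d; lra. }
(* chain of n + 1 points from the origin to (t, x), with steps below d *)
assert (Hk : forall k, (k <= n)%nat ->
  Rabs (f (INR k / INR n * t) (INR k / INR n * x)) <= Rabs (f 0 0) + INR k).
{ induction k as [|k IH]; intros Hkn.
  - simpl; unfold Rdiv; rewrite !Rmult_0_l; lra.
  - assert (Hk1 : 0 <= INR k / INR n).
    { apply Rmult_le_pos; [apply pos_INR|left; apply Rinv_0_lt_compat; lra]. }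
    assert (Hk2 : INR (S k) / INR n <= 1).
    { apply Rmult_le_reg_r with (INR n); [lra|].
      unfold Rdiv; rewrite Rmult_assoc, Rinv_l, Rmult_1_l by lra.
      rewrite Rmult_1_r; apply le_INR; lia. }
    assert (Hst : INR (S k) / INR n = INR k / INR n + / INR n).
    { rewrite S_INR; field; lra. }
    assert (Hi : 0 < / INR n) by (apply Rinv_0_lt_compat; lra).
    assert (Hdn : / INR n * t < d /\ / INR n * Rabs x < d).
    { split; apply Rmult_lt_reg_l with (INR n); try lra;
      rewrite <- Rmult_assoc, Rinv_r, Rmult_1_l; lra. }
    specialize (IH ltac:(lia)).
    rewrite (S_INR k) in *.
    assert (Hstep : Rabs (f ((INR k + 1) / INR n * t) ((INR k + 1) / INR n * x)
       - f (INR k / INR n * t) (INR k / INR n * x)) < 1).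
    { rewrite Hst in *; apply H.
      - nra.
      - rewrite Rabs_mult, Rabs_right by lra. nra.
      - nra.
      - rewrite Rabs_mult, Rabs_right by lra. nra.
      - replace (_ - _) with (/ INR n * t) by ring.
        rewrite Rabs_right; [lra|]. nra.
      - replace (_ - _) with (/ INR n * x) by ring.
        rewrite Rabs_mult, (Rabs_right (/ _)); lra. }
    set (u := f ((INR k + 1) / INR n * t) _) in *.
    set (v := f (INR k / INR n * t) _) in *.
    generalize (Rabs_triang (u - v) v); replace (u - v + v) with u by ring; lra. }
specialize (Hk n (le_n n)); unfold Rdiv in Hk; rewrite Rinv_r, !Rmult_1_l in Hk; lra.
Qed.

(** One-sided differentiability at [t = 0] is ordinary differentiability of an
    extension to negative times, which gives access to the rules of calculus. *)
Lemma is_Dt_iff f t x l :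
  0 <= t ->
  is_Dt f t x l <->
  exists F : R -> R, (forall s, 0 <= s -> F s = f s x) /\ is_derive F t l.
Proof.
intros Ht; split.
- intros H.
  exists (fun s => if Rle_dec 0 s then f s x else f 0 x + l * s); split.
  { intros s Hs; destruct (Rle_dec 0 s); tauto. }
  apply is_derive_Reals; intros eps Heps.
  destruct (proj1 (filterlim_locally _ _) H (mkposreal _ Heps)) as [d Hd].
  assert (Hd' : exists d' : posreal, d' <= d /\ (0 < t -> d' < t)).
  { destruct (Rlt_dec 0 t) as [H0|H0].
    - assert (Hm : 0 < Rmin d (t / 2)) by (apply Rmin_glb_lt; [apply cond_pos|lra]).
      exists (mkposreal _ Hm); simpl; split; [apply Rmin_l|].
      intros _; generalize (Rmin_r d (t / 2)); lra.
    - exists d; split; [lra|tauto]. }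
  destruct Hd' as [d' [Hd1 Hd2]].
  exists d'; intros h Hh Hhd.
  destruct (Rle_dec 0 t) as [_|n]; [|lra].
  destruct (Rle_dec 0 (t + h)) as [H0|H0].
  + specialize (Hd (t + h)); simpl in Hd.
    replace (t + h - t) with h in Hd by ring.
    apply Hd; auto; [|lra].
    change (Rabs ((t + h) - t) < d); replace (t + h - t) with h by ring; lra.
  + destruct (Rlt_dec 0 t) as [H1|H1].
    * exfalso; specialize (Hd2 H1); apply Rabs_def2 in Hhd; lra.
    * replace t with 0 in * by lra.
      replace (_ - l) with 0 by (field; auto); rewrite Rabs_R0; exact Heps.
- intros [F [HF HD]].
  apply is_derive_Reals in HD.
  apply filterlim_locally; intros eps.
  destruct (HD eps (cond_pos eps)) as [d Hd].
  exists d; intros s; simpl in s; intros Hs Hst Hs0.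
  specialize (Hd (s - t)); replace (t + (s - t)) with s in Hd by ring.
  rewrite <- (HF s), <- (HF t) by lra.
  apply Hd; [lra|exact Hs].
Qed.

Lemma is_Dt_ext_loc f g t x l d :
  0 <= t -> 0 < d ->
  (forall s, 0 <= s -> Rabs (s - t) < d -> f s x = g s x) ->
  is_Dt f t x l -> is_Dt g t x l.
Proof.
intros Ht Hd Hfg H.
apply filterlim_locally; intros eps.
destruct (proj1 (filterlim_locally _ _) H eps) as [d' Hd'].
assert (Hm : 0 < Rmin d d') by (apply Rmin_glb_lt; [lra|apply cond_pos]).
exists (mkposreal _ Hm); intros s; simpl in s; intros Hs Hst Hs0.
change (Rabs (s - t) < Rmin d d') in Hs.
rewrite <- (Hfg s), <- (Hfg t); auto.
- apply Hd'; auto. apply Rlt_le_trans with (1 := Hs), Rmin_r.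
- rewrite Rminus_diag, Rabs_R0; lra.
- apply Rlt_le_trans with (1 := Hs), Rmin_l.
Qed.

Lemma is_Dt_ext f g t x l :
  0 <= t -> (forall s, 0 <= s -> f s x = g s x) -> is_Dt f t x l -> is_Dt g t x l.
Proof. intros Ht H; apply is_Dt_ext_loc with 1; auto; lra. Qed.

Lemma is_Dx_ext f g t x l :
  (forall y, f t y = g t y) -> is_Dx f t x l -> is_Dx g t x l.
Proof. intros H; apply is_derive_ext; auto. Qed.

Lemma is_Dt_const c t x : 0 <= t -> is_Dt (fun _ _ => c) t x 0.
Proof.
intros Ht; apply is_Dt_iff; auto.
exists (fun _ => c); split; auto; auto_derive; auto.
Qed.

Lemma is_Dt_plus f g t x a b :
  0 <= t -> is_Dt f t x a -> is_Dt g t x b ->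
  is_Dt (fun t x => f t x + g t x) t x (a + b).
Proof.
intros Ht Hf Hg; apply is_Dt_iff in Hf; auto; apply is_Dt_iff in Hg; auto.
destruct Hf as [F [HF HF']], Hg as [G [HG HG']].
apply is_Dt_iff; auto; exists (fun s => F s + G s); split.
- intros s Hs; rewrite HF, HG; auto.
- apply (is_derive_plus F G); auto.
Qed.

Lemma is_derive_mult_R (f g : R -> R) x a b :
  is_derive f x a -> is_derive g x b ->
  is_derive (fun x => f x * g x) x (a * g x + f x * b).
Proof.
intros Hf Hg; apply (is_derive_mult f g); auto.
intros; apply Rmult_comm.
Qed.

Lemma is_Dt_mult f g t x a b :
  0 <= t -> is_Dt f t x a -> is_Dt g t x b ->
  is_Dt (fun t x => f t x * g t x) t x (a * g t x + f t x * b).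
Proof.
intros Ht Hf Hg; apply is_Dt_iff in Hf; auto; apply is_Dt_iff in Hg; auto.
destruct Hf as [F [HF HF']], Hg as [G [HG HG']].
apply is_Dt_iff; auto; exists (fun s => F s * G s); split.
- intros s Hs; rewrite HF, HG; auto.
- rewrite <- HF, <- HG by lra; apply is_derive_mult_R; auto.
Qed.

Lemma is_derive_comp_R (h f : R -> R) x dh a :
  is_derive h (f x) dh -> is_derive f x a -> is_derive (fun x => h (f x)) x (a * dh).
Proof. intros Hh Hf; apply (is_derive_comp h f); auto. Qed.

Lemma is_Dt_comp (h : R -> R) f t x dh a :
  0 <= t -> is_derive h (f t x) dh -> is_Dt f t x a ->
  is_Dt (fun t x => h (f t x)) t x (a * dh).
Proof.
intros Ht Hh Hf; apply is_Dt_iff in Hf; auto.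
destruct Hf as [F [HF HF']].
apply is_Dt_iff; auto; exists (fun s => h (F s)); split.
- intros s Hs; rewrite HF; auto.
- apply is_derive_comp_R; auto; rewrite HF; auto.
Qed.

(** * Integration along characteristics *)

(** Solution of [(d_t + c d_x) u = g] with zero data.  The [Rmax] makes the
    integrand continuous on the whole line. *)
Definition Ich (c : R) (g : R -> R -> R) (t x : R) : R :=
  RInt (fun s => g (Rmax 0 s) (x - c * (t - s))) 0 t.

Lemma ex_Ich c g t x a b :
  cont g -> ex_RInt (fun s => g (Rmax 0 s) (x - c * (t - s))) a b.
Proof. intros Hg; apply (ex_RInt_continuous (V := R_CompleteNormedModule)); intros; apply cont_on_char; auto. Qed.

Lemma RInt_minus_R (f g : R -> R) a b :
  ex_RInt f a b -> ex_RInt g a b ->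
  RInt (fun x => f x - g x) a b = RInt f a b - RInt g a b.
Proof. exact (RInt_minus (V := R_CompleteNormedModule) f g a b). Qed.

Lemma Ich_ext c f g t x :
  0 <= t -> (forall s, 0 <= s <= t -> f s (x - c * (t - s)) = g s (x - c * (t - s))) ->
  Ich c f t x = Ich c g t x.
Proof.
intros Ht H; apply RInt_ext; intros s Hs.
rewrite Rmin_left, Rmax_right in Hs by lra.
rewrite Rmax0_id by lra; apply H; lra.
Qed.

Lemma Ich_minus c f g t x :
  cont f -> cont g ->
  Ich c (fun t x => f t x - g t x) t x = Ich c f t x - Ich c g t x.
Proof. intros Hf Hg; apply RInt_minus_R; apply ex_Ich; auto. Qed.

Lemma Ich_scal c k f t x :
  cont f -> Ich c (fun t x => k * f t x) t x = k * Ich c f t x.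
Proof. intros Hf; apply (RInt_scal (V := R_CompleteNormedModule) _ _ _ k); apply ex_Ich; auto. Qed.

Lemma Ich_0 c g x : Ich c g 0 x = 0.
Proof. exact (RInt_point (V := R_CompleteNormedModule) 0 _). Qed.

(** Bounding by the increment of a primitive, and not by the length of the time
    interval, is what later gives estimates uniform in time. *)
Lemma Ich_le c g t x (B dB : R -> R) :
  cont g -> 0 <= t ->
  (forall s, is_derive B s (dB s)) -> (forall s, continuous dB s) ->
  (forall s, 0 <= s <= t -> Rabs (g s (x - c * (t - s))) <= dB s) ->
  Rabs (Ich c g t x) <= B t - B 0.
Proof.
intros Hg Ht HB HdB H.
assert (HI : is_RInt dB 0 t (B t - B 0)) by (apply (is_RInt_derive B dB); auto).
rewrite <- (is_RInt_unique _ _ _ _ HI).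
eapply Rle_trans; [apply abs_RInt_le; auto; apply ex_Ich; auto|].
apply RInt_le; auto.
- apply (ex_RInt_continuous (V := R_CompleteNormedModule)); intros; apply continuous_comp.
  + apply cont_on_char; auto.
  + apply continuous_Rabs.
- eexists; apply HI.
- intros s Hs; rewrite Rmax0_id by lra; apply H; lra.
Qed.

Lemma Ich_le_const c g t x M :
  cont g -> 0 <= t ->
  (forall s, 0 <= s <= t -> Rabs (g s (x - c * (t - s))) <= M) ->
  Rabs (Ich c g t x) <= t * M.
Proof.
intros Hg Ht H.
replace (t * M) with (t * M - 0 * M) by ring.
apply (Ich_le c g t x (fun s => s * M) (fun _ => M)); auto.
- intros; auto_derive; auto; ring.
- intros; apply continuous_const.
Qed.

Lemma Rabs_sub_bound y x d X : Rabs x <= X -> Rabs (y - x) <= d -> Rabs y <= X + d.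
Proof.
intros H1 H2; generalize (Rabs_triang (y - x) x).
replace (y - x + x) with y by ring; lra.
Qed.

Lemma cont_Ich c g : cont g -> cont (Ich c g).
Proof.
intros Hg t0 x0 eps.
set (t := Rmax 0 t0).
assert (Ht : 0 <= t) by apply Rmax0_ge.
set (X := Rabs x0 + 1 + Rabs c * (t + 1)).
destruct (cont_bounded g (t + 1) X Hg) as [M [HM HMb]].
assert (He' : 0 < eps / (2 * (t + 1))).
{ apply Rdiv_lt_0_compat; [apply cond_pos|lra]. }
destruct (cont_ucont g (t + 1) X _ Hg He') as [d [Hd Hu]].
set (C := 1 + Rabs c).
assert (HC : 1 <= C) by (unfold C; generalize (Rabs_pos c); lra).
assert (Hdel : 0 < Rmin 1 (Rmin (d / C) (eps / (2 * M)))).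
{ repeat apply Rmin_glb_lt; try lra; apply Rdiv_lt_0_compat; try lra; apply cond_pos. }
exists (mkposreal _ Hdel); simpl; intros s0 y0 Hs0 Hy0.
set (s := Rmax 0 s0).
assert (Hs : 0 <= s) by apply Rmax0_ge.
assert (Hst : Rabs (s - t) < Rmin 1 (Rmin (d / C) (eps / (2 * M)))).
{ apply Rle_lt_trans with (2 := Hs0), Rmax0_lip. }
assert (Hst1 : Rabs (s - t) < 1) by (apply Rlt_le_trans with (1 := Hst), Rmin_l).
assert (Hst2 : Rabs (s - t) < eps / (2 * M)).
{ apply Rlt_le_trans with (1 := Hst); eapply Rle_trans; [apply Rmin_r|apply Rmin_r]. }
assert (Hy1 : Rabs (y0 - x0) < 1) by (apply Rlt_le_trans with (1 := Hy0), Rmin_l).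
assert (Hst3 : Rabs (s - t) * C < d).
{ apply Rmult_lt_reg_r with (/ C); [apply Rinv_0_lt_compat; lra|].
  rewrite Rmult_assoc, Rinv_r, Rmult_1_r by lra.
  apply Rlt_le_trans with (1 := Hst); eapply Rle_trans; [apply Rmin_r|apply Rmin_l]. }
assert (Hy3 : Rabs (y0 - x0) * C < d).
{ apply Rmult_lt_reg_r with (/ C); [apply Rinv_0_lt_compat; lra|].
  rewrite Rmult_assoc, Rinv_r, Rmult_1_r by lra.
  apply Rlt_le_trans with (1 := Hy0); eapply Rle_trans; [apply Rmin_r|apply Rmin_l]. }
assert (Hst1' := Hst1); apply Rabs_def2 in Hst1'.
assert (HX : forall y r u, Rabs (y - x0) <= 1 -> 0 <= r <= t + 1 -> 0 <= u <= t + 1 ->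
   Rabs (y - c * (r - u)) <= X).
{ intros y r u H1 H2 H3; unfold X.
  apply Rabs_sub_bound with y.
  - apply Rabs_sub_bound with x0; lra.
  - replace (y - c * (r - u) - y) with (- (c * (r - u))) by ring.
    rewrite Rabs_Ropp, Rabs_mult; apply Rmult_le_compat_l; [apply Rabs_pos|].
    apply Rabs_le; lra. }
unfold Ich.
rewrite <- (RInt_Chasles (fun u => g (Rmax 0 u) (y0 - c * (s - u))) 0 t s) by (apply ex_Ich; auto).
change (Rabs (RInt (fun u => g (Rmax 0 u) (y0 - c * (s - u))) 0 t
     + RInt (fun u => g (Rmax 0 u) (y0 - c * (s - u))) t s
     - RInt (fun u => g (Rmax 0 u) (x0 - c * (t - u))) 0 t) < eps).
replace (_ - _) with (RInt (fun u => g (Rmax 0 u) (y0 - c * (s - u))) t s +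
  RInt (fun u => g (Rmax 0 u) (y0 - c * (s - u)) - g (Rmax 0 u) (x0 - c * (t - u))) 0 t).
2:{ rewrite RInt_minus_R by (apply ex_Ich; auto); ring. }
eapply Rle_lt_trans; [apply Rabs_triang|].
assert (H1 : Rabs (RInt (fun u => g (Rmax 0 u) (y0 - c * (s - u))) t s) <= Rabs (s - t) * M).
{ destruct (Rle_dec t s) as [Hle|Hle].
  - rewrite (Rabs_right (s - t)) by lra.
    apply abs_RInt_le_const; auto; [apply ex_Ich; auto|].
    intros u Hu'; rewrite Rmax0_id by lra; apply HMb; [lra|apply HX; lra].
  - rewrite <- opp_RInt_swap by (apply ex_Ich; auto).
    change (Rabs (- RInt (fun u => g (Rmax 0 u) (y0 - c * (s - u))) s t) <= Rabs (s - t) * M).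
    rewrite Rabs_Ropp, (Rabs_left1 (s - t)) by lra.
    replace (- (s - t)) with (t - s) by ring.
    apply abs_RInt_le_const; auto; [lra|apply ex_Ich; auto|].
    intros u Hu'; rewrite Rmax0_id by lra; apply HMb; [lra|apply HX; lra]. }
assert (H2 : Rabs (RInt (fun u => g (Rmax 0 u) (y0 - c * (s - u)) - g (Rmax 0 u) (x0 - c * (t - u))) 0 t)
   <= (t - 0) * (eps / (2 * (t + 1)))).
{ apply abs_RInt_le_const; auto.
  - apply (ex_RInt_minus (V := R_NormedModule) (fun u => g (Rmax 0 u) (y0 - c * (s - u)))
     (fun u => g (Rmax 0 u) (x0 - c * (t - u)))); apply ex_Ich; auto.
  - intros u Hu'; rewrite Rmax0_id by lra; left; apply Hu; try lra.
    + apply HX; [|lra|lra]. rewrite Rminus_diag, Rabs_R0; lra.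
    + apply HX; lra.
    + rewrite Rminus_diag, Rabs_R0; lra.
    + replace (_ - _) with ((y0 - x0) + - (c * (s - t))) by ring.
      eapply Rle_lt_trans; [apply Rabs_triang|].
      rewrite Rabs_Ropp, Rabs_mult.
      assert (Hc0 := Rabs_pos c); assert (Ha := Rabs_pos (s - t)); assert (Hb := Rabs_pos (y0 - x0)).
      assert (H5 : Rabs (y0 - x0) < d / C /\ Rabs (s - t) < d / C).
      { split; (apply Rmult_lt_reg_r with C; [lra|]);
        unfold Rdiv; rewrite Rmult_assoc, Rinv_l; lra. }
      assert (H6 : d = d / C + Rabs c * (d / C)).
      { unfold C; field; lra. }
      nra. }
assert (H3 : Rabs (s - t) * M < eps / 2).
{ replace (eps / 2) with (eps / (2 * M) * M) by (field; lra). nra. }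
assert (H4 : (t - 0) * (eps / (2 * (t + 1))) <= eps / 2).
{ replace (eps / 2) with ((t + 1) * (eps / (2 * (t + 1)))) by (field; lra). nra. }
lra.
Qed.

Lemma is_Dx_Ich c g gx :
  cont g -> cont gx ->
  (forall t x, 0 <= t -> is_Dx g t x (gx t x)) ->
  forall t x, is_Dx (Ich c g) t x (Ich c gx t x).
Proof.
intros Hg Hgx HD t x.
assert (HD' : forall (u : R) (v : R), is_derive (fun z => g (Rmax 0 u) (z - c * (t - u))) v
   (gx (Rmax 0 u) (v - c * (t - u)))).
{ intros u v.
  replace (gx _ _) with (1 * gx (Rmax 0 u) (v - c * (t - u))) by ring.
  apply (is_derive_comp_R (g (Rmax 0 u)) (fun z => z - c * (t - u))).
  - apply HD, Rmax0_ge.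
  - auto_derive; auto; ring. }
unfold is_Dx.
replace (Ich c gx t x) with
  (RInt (fun s => Derive (fun z => g (Rmax 0 s) (z - c * (t - s))) x) 0 t).
2:{ apply RInt_ext; intros; apply is_derive_unique, HD'. }
apply (is_derive_RInt_param (fun y s => g (Rmax 0 s) (y - c * (t - s)))).
- exists (mkposreal _ Rlt_0_1); intros; eexists; apply HD'.
- intros s _.
  apply continuity_2d_pt_ext with (fun u v => gx (Rmax 0 v) (u - c * (t - v))).
  { intros; symmetry; apply is_derive_unique, HD'. }
  apply continuity_2d_pt_filterlim.
  apply (continuous_comp_2 (fun p : R * R => snd p) (fun p : R * R => fst p - c * (t - snd p))
    (fun u v => gx (Rmax 0 u) v)).
  + apply continuous_snd.
  + apply (proj1 (continuity_2d_pt_filterlim (fun u v => u - c * (t - v)) x s)).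
    apply continuity_2d_pt_minus; [apply continuity_2d_pt_id1|].
    apply continuity_2d_pt_mult; [apply continuity_2d_pt_const|].
    apply continuity_2d_pt_minus; [apply continuity_2d_pt_const|apply continuity_2d_pt_id2].
  + apply (proj1 (continuity_2d_pt_filterlim (fun u v => gx (Rmax 0 u) v) _ _)), Hgx.
- exists (mkposreal _ Rlt_0_1); intros; apply ex_Ich; auto.
Qed.

(** * Transport equations and their integrated form *)

Lemma MVT_between (f df : R -> R) a b :
  (forall z, Rmin a b <= z <= Rmax a b -> is_derive f z (df z)) ->
  exists z, Rmin a b <= z <= Rmax a b /\ f b - f a = df z * (b - a).
Proof.
intros H; destruct (MVT_gen f a b df) as [z Hz].
- intros; apply H; lra.
- intros z Hz; apply continuity_pt_filterlim, (ex_derive_continuous f).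
  eexists; apply H; auto.
- exists z; auto.
Qed.

Lemma between_close a b z : Rmin a b <= z <= Rmax a b -> Rabs (z - a) <= Rabs (b - a).
Proof.
unfold Rmin, Rmax; destruct (Rle_dec a b); intros; unfold Rabs;
  repeat destruct Rcase_abs; lra.
Qed.

Definition clip (t s : R) : R := Rmin (Rmax 0 s) t.

Lemma clip_in t s : 0 <= t -> 0 <= clip t s <= t.
Proof.
intros Ht; unfold clip, Rmin, Rmax; destruct (Rle_dec 0 s);
match goal with |- context [Rle_dec ?a t] => destruct (Rle_dec a t) end; lra.
Qed.

Lemma clip_id t s : 0 <= s <= t -> clip t s = s.
Proof. intros; unfold clip; rewrite Rmax0_id, Rmin_left; lra. Qed.

Lemma clip_lip t s r : Rabs (clip t s - clip t r) <= Rabs (s - r).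
Proof.
unfold clip, Rmin, Rmax; destruct (Rle_dec 0 s), (Rle_dec 0 r);
repeat match goal with |- context [Rle_dec ?a t] => destruct (Rle_dec a t) end;
unfold Rabs; repeat destruct Rcase_abs; lra.
Qed.

(** No joint differentiability is assumed: a step along the characteristic is
    split into one in [t] at fixed [x], and one in [x] at fixed time, which the
    mean value theorem and continuity of [fx] control. *)
Lemma char_increment f ft fx t x c s eps :
  0 <= s <= t -> 0 < eps ->
  (forall s y, 0 <= s <= t -> is_Dt f s y (ft s y) /\ is_Dx f s y (fx s y)) ->
  cont (fun s y => fx (Rmin s t) y) ->
  exists d, 0 < d /\ forall r, 0 <= r <= t -> Rabs (r - s) < d ->
    Rabs (f r (x - c * (t - r)) - f s (x - c * (t - s))
          - (r - s) * (ft s (x - c * (t - s)) + c * fx s (x - c * (t - s))))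
    <= eps * Rabs (r - s).
Proof.
intros Hs He HD Hfx.
set (y := fun r => x - c * (t - r)).
assert (HC : 0 < Rabs c + 1) by (generalize (Rabs_pos c); lra).
assert (He1 : 0 < eps / 2 / (Rabs c + 1)) by (apply Rdiv_lt_0_compat; lra).
destruct (proj1 (is_Dt_iff f s (y s) _ (proj1 Hs)) (proj1 (HD s (y s) Hs))) as [F [HF HF']].
apply is_derive_Reals in HF'.
destruct (HF' (eps / 2) ltac:(lra)) as [d1 Hd1].
destruct (Hfx s (y s) (mkposreal _ He1)) as [d2 Hd2]; simpl in Hd2.
assert (Hd : 0 < Rmin d1 (d2 / (Rabs c + 1))).
{ apply Rmin_glb_lt; [apply cond_pos|apply Rdiv_lt_0_compat; [apply cond_pos|lra]]. }
exists (Rmin d1 (d2 / (Rabs c + 1))); split; auto.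
intros r Hr Hrs; fold (y r) (y s).
assert (Hr1 := Rlt_le_trans _ _ _ Hrs (Rmin_l _ _)).
assert (Hr2 : Rabs (r - s) * (Rabs c + 1) < d2).
{ apply Rmult_lt_reg_r with (/ (Rabs c + 1)); [apply Rinv_0_lt_compat; lra|].
  rewrite Rmult_assoc, Rinv_r, Rmult_1_r by lra.
  apply (Rlt_le_trans _ _ _ Hrs (Rmin_r _ _)). }
destruct (MVT_between (f r) (fx r) (y s) (y r)) as [z [Hz1 Hz2]].
{ intros; apply (HD r z Hr). }
assert (Hy : y r - y s = c * (r - s)) by (unfold y; ring).
assert (Hz3 : Rabs (fx r z - fx s (y s)) < eps / 2 / (Rabs c + 1)).
{ specialize (Hd2 r z).
  rewrite !Rmax0_id, !Rmin_left in Hd2 by lra.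
  apply Hd2; [generalize (Rabs_pos c) (Rabs_pos (r - s)); nra|].
  apply between_close in Hz1; rewrite Hy, Rabs_mult in Hz1.
  generalize (Rabs_pos c) (Rabs_pos (r - s)); nra. }
assert (Ht : Rabs (f r (y s) - f s (y s) - (r - s) * ft s (y s)) <= eps / 2 * Rabs (r - s)).
{ destruct (Req_dec (r - s) 0) as [H0|H0].
  - replace r with s by lra; rewrite !Rminus_diag, Rmult_0_l, Rminus_diag, Rabs_R0; lra.
  - specialize (Hd1 (r - s) H0 Hr1); replace (s + (r - s)) with r in Hd1 by ring.
    rewrite !HF in Hd1 by lra.
    replace (f r (y s) - f s (y s) - (r - s) * ft s (y s)) with
      (((f r (y s) - f s (y s)) / (r - s) - ft s (y s)) * (r - s)) by (field; auto).
    rewrite Rabs_mult; apply Rmult_le_compat_r; [apply Rabs_pos|lra]. }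
replace (_ - _ - _) with ((f r (y s) - f s (y s) - (r - s) * ft s (y s)) +
  (fx r z - fx s (y s)) * (c * (r - s))).
2:{ replace (f r (y r)) with (f r (y s) + fx r z * (c * (r - s))) by (rewrite <- Hy; lra). ring. }
eapply Rle_trans; [apply Rabs_triang|].
rewrite Rabs_mult, Rabs_mult.
replace (eps * Rabs (r - s)) with
  (eps / 2 * Rabs (r - s) + eps / 2 / (Rabs c + 1) * ((Rabs c + 1) * Rabs (r - s))) by (field; lra).
apply Rplus_le_compat; auto.
apply Rmult_le_compat; try (apply Rabs_pos); try lra.
- apply Rmult_le_pos; apply Rabs_pos.
- apply Rmult_le_compat_r; [apply Rabs_pos|lra].
Qed.

(** The fundamental theorem of calculus along a characteristic.  The derivatives
    are clipped at [t] to cover functions defined on a bounded time interval. *)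
Lemma transport_upto f ft fx t x c :
  0 <= t ->
  (forall s y, 0 <= s <= t -> is_Dt f s y (ft s y) /\ is_Dx f s y (fx s y)) ->
  cont (fun s y => ft (Rmin s t) y) -> cont (fun s y => fx (Rmin s t) y) ->
  f t x = f 0 (x - c * t) + Ich c (fun s y => ft (Rmin s t) y + c * fx (Rmin s t) y) t x.
Proof.
intros Ht HD Hft Hfx.
set (g := fun s y => ft (Rmin s t) y + c * fx (Rmin s t) y).
assert (Hg : cont g).
{ apply cont_plus; auto; apply cont_mult; auto; apply cont_const. }
set (G := fun s => g (Rmax 0 s) (x - c * (t - s))).
set (phi := fun s => f (clip t s) (x - c * (t - clip t s))).
assert (HJ : forall s, is_derive (fun s => RInt G 0 s) s (G s)).
{ intros s; apply (is_derive_RInt G _ 0).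
  - exists (mkposreal _ Rlt_0_1); intros; apply (RInt_correct (V := R_CompleteNormedModule)).
    apply (ex_Ich c g t x); auto.
  - apply (cont_on_char g c t x); auto. }
assert (HI : forall s eps, 0 <= s <= t -> 0 < eps -> exists d, 0 < d /\ forall r,
   0 <= r <= t -> Rabs (r - s) < d -> Rabs (phi r - phi s - (r - s) * G s) <= eps * Rabs (r - s)).
{ intros s eps Hs He.
  destruct (char_increment f ft fx t x c s eps Hs He HD Hfx) as [d [Hd H]].
  exists d; split; auto; intros r Hr Hrs.
  unfold phi, G, g; rewrite !clip_id, Rmax0_id, Rmin_left by lra; auto. }
destruct (MVT_gen (fun s => phi s - RInt G 0 s) 0 t (fun _ => 0)) as [z [_ Hz]].
- intros s; rewrite Rmin_left, Rmax_right by lra; intros Hs.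
  cut (is_derive (fun s => phi s - RInt G 0 s) s (G s - G s)); [rewrite Rminus_diag; auto|].
  apply (is_derive_minus phi (RInt G 0)); [|apply HJ].
  apply is_derive_Reals; intros eps He.
  destruct (HI s (eps / 2) ltac:(lra) ltac:(lra)) as [d [Hd H]].
  assert (Hm : 0 < Rmin d (Rmin s (t - s))) by (repeat apply Rmin_glb_lt; lra).
  exists (mkposreal _ Hm); simpl; intros h Hh0 Hh.
  assert (H1 := Rlt_le_trans _ _ _ Hh (Rmin_l _ _)).
  assert (H2 := Rlt_le_trans _ _ _ Hh (Rmin_r _ _)).
  assert (H3 := Rlt_le_trans _ _ _ H2 (Rmin_l _ _)).
  assert (H4 := Rlt_le_trans _ _ _ H2 (Rmin_r _ _)).
  apply Rabs_def2 in H3; apply Rabs_def2 in H4.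
  specialize (H (s + h) ltac:(lra)); replace (s + h - s) with h in H by ring.
  specialize (H H1).
  replace ((phi (s + h) - phi s) / h - G s) with ((phi (s + h) - phi s - h * G s) / h) by (field; auto).
  rewrite Rabs_div by auto.
  assert (Hh' := Rabs_pos_lt h Hh0).
  apply Rmult_lt_reg_r with (Rabs h); auto.
  unfold Rdiv; rewrite Rmult_assoc, Rinv_l by lra; nra.
- intros s _.
  apply continuity_pt_minus.
  2:{ apply continuity_pt_filterlim, (ex_derive_continuous (RInt G 0)); eexists; apply HJ. }
  apply continuity_pt_filterlim, filterlim_locally; intros eps.
  set (s0 := clip t s).
  assert (Hs0 := clip_in t s Ht : 0 <= s0 <= t).
  set (K := 1 + Rabs (G s0)).
  assert (HK : 1 <= K) by (unfold K; generalize (Rabs_pos (G s0)); lra).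
  destruct (HI s0 1 Hs0 Rlt_0_1) as [d [Hd H]].
  assert (Hm : 0 < Rmin d (eps / K)).
  { apply Rmin_glb_lt; auto; apply Rdiv_lt_0_compat; [apply cond_pos|lra]. }
  exists (mkposreal _ Hm); intros r Hr; change (Rabs (r - s) < Rmin d (eps / K)) in Hr.
  change (Rabs (phi r - phi s) < eps).
  assert (Hp : forall r, phi r = phi (clip t r)).
  { intros u; unfold phi; rewrite (clip_id t (clip t u)); auto; apply clip_in; auto. }
  rewrite (Hp r), (Hp s); fold s0; set (r0 := clip t r).
  assert (Hl := clip_lip t r s : Rabs (r0 - s0) <= Rabs (r - s)).
  assert (H1 := Rlt_le_trans _ _ _ Hr (Rmin_l _ _)).
  assert (H2 := Rlt_le_trans _ _ _ Hr (Rmin_r _ _)).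
  specialize (H r0 (clip_in t r Ht) ltac:(lra)).
  apply Rle_lt_trans with (K * Rabs (r0 - s0)).
  + generalize (Rabs_triang (phi r0 - phi s0 - (r0 - s0) * G s0) ((r0 - s0) * G s0)).
    replace (phi r0 - phi s0 - (r0 - s0) * G s0 + (r0 - s0) * G s0) with (phi r0 - phi s0) by ring.
    rewrite Rabs_mult; unfold K; nra.
  + apply Rmult_lt_reg_l with (/ K); [apply Rinv_0_lt_compat; lra|].
    rewrite <- Rmult_assoc, Rinv_l, Rmult_1_l by lra.
    unfold Rdiv in H2; lra.
- rewrite Rmult_0_l, (RInt_point (V := R_CompleteNormedModule)) in Hz.
  change (phi t - RInt G 0 t - (phi 0 - 0) = 0) in Hz.
  unfold phi in Hz; rewrite !clip_id in Hz by lra.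
  replace (x - c * (t - t)) with x in Hz by ring.
  replace (x - c * (t - 0)) with (x - c * t) in Hz by ring.
  unfold Ich; fold G; lra.
Qed.

Lemma cont_clip g t : cont g -> 0 <= t -> cont (fun s y => g (Rmin s t) y).
Proof.
intros Hg Ht s x.
apply continuity_2d_pt_ext with (fun s y => g (Rmax 0 (Rmin s t)) y).
{ intros u v; f_equal; unfold Rmin, Rmax; destruct (Rle_dec 0 u);
  repeat match goal with |- context [Rle_dec ?a ?b] => destruct (Rle_dec a b) end; lra. }
apply continuity_2d_pt_filterlim.
apply (continuous_comp_2 (fun p : R * R => Rmin (fst p) t) (fun p : R * R => snd p)
   (fun u v => g (Rmax 0 u) v)).
- apply (continuous_comp (fun p : R * R => fst p) (fun s => Rmin s t)).
  + apply continuous_fst.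
  + apply filterlim_locally; intros eps; exists eps; intros r Hr.
    apply Rle_lt_trans with (2 := Hr).
    change (Rabs (Rmin r t - Rmin s t) <= Rabs (r - s)).
    unfold Rmin; destruct (Rle_dec r t), (Rle_dec s t);
    unfold Rabs; repeat destruct Rcase_abs; lra.
- apply continuous_snd.
- apply (proj1 (continuity_2d_pt_filterlim (fun u v => g (Rmax 0 u) v) _ _)), Hg.
Qed.

Lemma transport f ft fx t x c :
  0 <= t ->
  (forall s y, 0 <= s -> is_Dt f s y (ft s y) /\ is_Dx f s y (fx s y)) ->
  cont ft -> cont fx ->
  f t x = f 0 (x - c * t) + Ich c (fun s y => ft s y + c * fx s y) t x.
Proof.
intros Ht HD Hft Hfx.
rewrite (transport_upto f ft fx t x c); auto.
- f_equal; apply Ich_ext; auto; intros s Hs; rewrite Rmin_left by lra; auto.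
- intros; apply HD; lra.
- apply cont_clip; auto.
- apply cont_clip; auto.
Qed.

(** The increment along the characteristic through [(t, x)] is an integral, whose
    derivative is [g t x]; what separates it from the increment in [t] is a step
    in [x]. *)
Lemma mild_is_Dt f0 f fx g c :
  (forall t x, 0 <= t -> f t x = f0 (x - c * t) + Ich c g t x) ->
  (forall t x, 0 <= t -> is_Dx f t x (fx t x)) ->
  cont g -> cont fx ->
  forall t x, 0 <= t -> is_Dt f t x (g t x - c * fx t x).
Proof.
intros Hf HD Hg Hfx t x Ht.
set (G := fun s => g (Rmax 0 s) (x - c * (t - s))).
assert (HJ : is_derive (fun s => RInt G 0 s) t (g t x)).
{ replace (g t x) with (G t).
  - apply (is_derive_RInt G _ 0).
    + exists (mkposreal _ Rlt_0_1); intros; apply (RInt_correct (V := R_CompleteNormedModule)).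
      apply (ex_Ich c g t x); auto.
    + apply (cont_on_char g c t x); auto.
  - unfold G; rewrite Rmax0_id by auto; f_equal; ring. }
apply is_derive_Reals in HJ.
apply filterlim_locally; intros eps.
assert (HC : 0 < Rabs c + 1) by (generalize (Rabs_pos c); lra).
assert (He1 : 0 < eps / 2 / (Rabs c + 1)).
{ apply Rdiv_lt_0_compat; [generalize (cond_pos eps)|]; lra. }
destruct (HJ (eps / 2) ltac:(generalize (cond_pos eps); lra)) as [d1 Hd1].
destruct (Hfx t x (mkposreal _ He1)) as [d2 Hd2]; simpl in Hd2.
assert (Hd : 0 < Rmin d1 (d2 / (Rabs c + 1))).
{ apply Rmin_glb_lt; [apply cond_pos|apply Rdiv_lt_0_compat; [apply cond_pos|lra]]. }
exists (mkposreal _ Hd); intros r; simpl in r; intros Hrs Hrt Hr.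
change (Rabs (r - t) < Rmin d1 (d2 / (Rabs c + 1))) in Hrs.
assert (Hr1 := Rlt_le_trans _ _ _ Hrs (Rmin_l _ _)).
assert (Hr2 : Rabs (r - t) * (Rabs c + 1) < d2).
{ apply Rmult_lt_reg_r with (/ (Rabs c + 1)); [apply Rinv_0_lt_compat; lra|].
  rewrite Rmult_assoc, Rinv_r, Rmult_1_r by lra.
  apply (Rlt_le_trans _ _ _ Hrs (Rmin_r _ _)). }
assert (H0 : r - t <> 0) by lra.
specialize (Hd1 (r - t) H0 Hr1); replace (t + (r - t)) with r in Hd1 by ring.
destruct (MVT_between (f r) (fx r) x (x + c * (r - t))) as [z [Hz1 Hz2]].
{ intros; apply HD; auto. }
assert (Hz3 : Rabs (fx r z - fx t x) < eps / 2 / (Rabs c + 1)).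
{ specialize (Hd2 r z).
  rewrite !Rmax0_id in Hd2 by lra.
  apply Hd2; [generalize (Rabs_pos c) (Rabs_pos (r - t)); nra|].
  apply between_close in Hz1.
  replace (x + c * (r - t) - x) with (c * (r - t)) in Hz1 by ring.
  rewrite Rabs_mult in Hz1.
  generalize (Rabs_pos c) (Rabs_pos (r - t)); nra. }
rewrite !Hf in Hz2 by auto.
assert (E1 : Ich c g r (x + c * (r - t)) = RInt G 0 r).
{ apply RInt_ext; intros; unfold G; f_equal; ring. }
assert (E2 : Ich c g t x = RInt G 0 t) by reflexivity.
rewrite E1 in Hz2; replace (x + c * (r - t) - c * r) with (x - c * t) in Hz2 by ring.
rewrite (Hf r), (Hf t) by auto.
rewrite E2.
change (Rabs ((f0 (x - c * r) + Ich c g r x - (f0 (x - c * t) + RInt G 0 t)) / (r - t)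
    - (g t x - c * fx t x)) < eps).
replace (_ - _) with (((RInt G 0 r - RInt G 0 t) / (r - t) - g t x) - c * (fx r z - fx t x)).
2:{ replace (f0 (x - c * r) + Ich c g r x) with
     (f0 (x - c * t) + RInt G 0 r - fx r z * (x + c * (r - t) - x)) by lra.
    field; auto. }
eapply Rle_lt_trans; [apply Rabs_triang|].
rewrite Rabs_Ropp, Rabs_mult.
assert (Hc : Rabs c * Rabs (fx r z - fx t x) <= (Rabs c + 1) * (eps / 2 / (Rabs c + 1))).
{ apply Rmult_le_compat; try (apply Rabs_pos); lra. }
replace ((Rabs c + 1) * (eps / 2 / (Rabs c + 1))) with (eps / 2) in Hc by (field; lra).
lra.
Qed.

(** * Calculus of smooth functions on the half-plane *)

(** Only first derivatives occur at each level, so that closure under an operation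
    is a single induction on [k]; that mixed derivatives commute is proved
    separately. *)
Fixpoint Ck (k : nat) (f : R -> R -> R) : Prop :=
  cont f /\
  match k with
  | O => True
  | S k => exists ft fx,
      (forall t x, 0 <= t -> is_Dt f t x (ft t x) /\ is_Dx f t x (fx t x)) /\
      Ck k ft /\ Ck k fx
  end.

Definition Cinf (f : R -> R -> R) : Prop := forall k, Ck k f.

Lemma Ck_cont k f : Ck k f -> cont f.
Proof. destruct k; intros H; apply H. Qed.

Lemma Ck_S k : forall f, Ck (S k) f -> Ck k f.
Proof.
induction k as [|k IH]; intros f [Hc [ft [fx [HD [H1 H2]]]]]; split; auto.
exists ft, fx; auto.
Qed.

Lemma Ck_ext k f g : (forall t x, 0 <= t -> f t x = g t x) -> Ck k f -> Ck k g.
Proof.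
intros H; destruct k; intros [Hc Hf]; split; auto; try (apply cont_ext with f; auto).
destruct Hf as [ft [fx [HD H12]]]; exists ft, fx; split; auto.
intros t x Ht; destruct (HD t x Ht); split.
- apply is_Dt_ext with f; auto.
- apply is_Dx_ext with f; auto.
Qed.

Lemma Cinf_ext f g : (forall t x, 0 <= t -> f t x = g t x) -> Cinf f -> Cinf g.
Proof. intros H Hf k; apply Ck_ext with f; auto. Qed.

Lemma Ck_const k c : Ck k (fun _ _ => c).
Proof.
revert c; induction k as [|k IH]; intros c; split; auto; try apply cont_const.
exists (fun _ _ => 0), (fun _ _ => 0); split; [split|split]; auto.
- apply is_Dt_const; auto.
- apply is_derive_Reals, derivable_pt_lim_const.
Qed.

Lemma Ck_plus k : forall f g, Ck k f -> Ck k g -> Ck k (fun t x => f t x + g t x).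
Proof.
induction k as [|k IH]; intros f g [Hf Hf'] [Hg Hg']; split; auto; try (apply cont_plus; auto).
destruct Hf' as [ft [fx [HDf [Hft Hfx]]]], Hg' as [gt [gx [HDg [Hgt Hgx]]]].
exists (fun t x => ft t x + gt t x), (fun t x => fx t x + gx t x).
split; [split|split]; auto.
- apply is_Dt_plus; auto; [apply HDf|apply HDg]; auto.
- apply (is_derive_plus (f t) (g t)); [apply HDf|apply HDg]; auto.
Qed.

Lemma Ck_mult k : forall f g, Ck k f -> Ck k g -> Ck k (fun t x => f t x * g t x).
Proof.
induction k as [|k IH]; intros f g Hf Hg;
  (split; [apply cont_mult; eapply Ck_cont; eauto|auto]).
assert (Hf1 := Ck_S _ _ Hf); assert (Hg1 := Ck_S _ _ Hg).
destruct Hf as [_ [ft [fx [HDf [Hft Hfx]]]]], Hg as [_ [gt [gx [HDg [Hgt Hgx]]]]].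
exists (fun t x => ft t x * g t x + f t x * gt t x), (fun t x => fx t x * g t x + f t x * gx t x).
split; [split|split]; try (apply Ck_plus; apply IH; auto).
- apply is_Dt_mult; auto; [apply HDf|apply HDg]; auto.
- apply is_derive_mult_R; [apply HDf|apply HDg]; auto.
Qed.

Lemma Ck_comp_step k (h : R -> R) f dh :
  Ck (S k) f -> (forall t x, 0 <= t -> is_derive h (f t x) (dh t x)) -> Ck k dh ->
  Ck (S k) (fun t x => h (f t x)).
Proof.
intros Hf Hh Hdh; split.
- apply cont_comp1; [|apply (Ck_cont _ _ Hf)].
  intros t x Ht; apply continuity_pt_filterlim, (ex_derive_continuous h).
  eexists; apply Hh; auto.
- assert (Hf1 := Ck_S _ _ Hf); destruct Hf as [_ [ft [fx [HDf [Hft Hfx]]]]].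
  exists (fun t x => ft t x * dh t x), (fun t x => fx t x * dh t x); split; [split|split].
  + apply is_Dt_comp; auto; apply HDf; auto.
  + apply (is_derive_comp_R h (f t)); [apply Hh; auto|apply HDf; auto].
  + apply Ck_mult; auto.
  + apply Ck_mult; auto.
Qed.

Lemma Cinf_const c : Cinf (fun _ _ => c).
Proof. intros k; apply Ck_const. Qed.

Lemma Cinf_plus f g : Cinf f -> Cinf g -> Cinf (fun t x => f t x + g t x).
Proof. intros Hf Hg k; apply Ck_plus; auto. Qed.

Lemma Cinf_mult f g : Cinf f -> Cinf g -> Cinf (fun t x => f t x * g t x).
Proof. intros Hf Hg k; apply Ck_mult; auto. Qed.

Lemma Cinf_minus f g : Cinf f -> Cinf g -> Cinf (fun t x => f t x - g t x).
Proof.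
intros Hf Hg; apply Cinf_ext with (fun t x => f t x + -1 * g t x); [intros; ring|].
apply Cinf_plus, Cinf_mult, Hg; auto using Cinf_const.
Qed.

Lemma Cinf_inv f : (forall t x, 0 <= t -> f t x <> 0) -> Cinf f -> Cinf (fun t x => / f t x).
Proof.
intros H0 Hf k; induction k as [|k IH].
- split; auto; apply cont_comp1; [|apply (Ck_cont _ _ (Hf O))].
  intros; apply continuity_pt_filterlim, continuous_Rinv; auto.
- apply Ck_comp_step with (fun t x => - 1 * (/ f t x * / f t x)); auto.
  + intros; auto_derive; auto; field; auto.
  + apply Ck_mult; auto using Ck_const, Ck_mult.
Qed.

Lemma Cinf_div f g : (forall t x, 0 <= t -> g t x <> 0) -> Cinf f -> Cinf g ->
  Cinf (fun t x => f t x / g t x).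
Proof. intros; apply Cinf_mult, Cinf_inv; auto. Qed.

Lemma Cinf_exp f : Cinf f -> Cinf (fun t x => exp (f t x)).
Proof.
intros Hf k; induction k as [|k IH].
- split; auto; apply cont_comp1; [|apply (Ck_cont _ _ (Hf O))].
  intros; apply continuity_pt_filterlim, continuous_exp.
- apply Ck_comp_step with (fun t x => exp (f t x)); auto.
  intros; apply is_derive_exp.
Qed.

Lemma Cinf_ln f : (forall t x, 0 <= t -> 0 < f t x) -> Cinf f -> Cinf (fun t x => ln (f t x)).
Proof.
intros H0 Hf k; apply Ck_S, Ck_comp_step with (fun t x => / f t x); auto.
- intros; apply is_derive_ln; auto.
- apply Cinf_inv; auto; intros t x Ht; specialize (H0 t x Ht); lra.
Qed.

(** On positive functions, [sqrt] is [exp (ln / 2)]. *)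
Lemma Cinf_sqrt f : (forall t x, 0 <= t -> 0 < f t x) -> Cinf f -> Cinf (fun t x => sqrt (f t x)).
Proof.
intros H0 Hf.
apply Cinf_ext with (fun t x => exp (/ 2 * ln (f t x))).
{ intros t x Ht; specialize (H0 t x Ht).
  rewrite <- (sqrt_def (f t x)) at 1 by lra.
  assert (0 < sqrt (f t x)) by (apply sqrt_lt_R0; auto).
  rewrite ln_mult by auto.
  replace (/ 2 * _) with (ln (sqrt (f t x))) by field; apply exp_ln; auto. }
apply Cinf_exp, Cinf_mult, Cinf_ln; auto using Cinf_const.
Qed.

Lemma Cinf_Rpower f d : (forall t x, 0 <= t -> 0 < f t x) -> Cinf f ->
  Cinf (fun t x => Rpower (f t x) d).
Proof. intros H0 Hf; apply Cinf_exp, Cinf_mult, Cinf_ln; auto using Cinf_const. Qed.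

Lemma Cinf_cosh f : Cinf f -> Cinf (fun t x => cosh (f t x)).
Proof.
intros Hf; apply Cinf_ext with (fun t x => / 2 * (exp (f t x) + exp (-1 * f t x))).
- intros; unfold cosh; replace (-1 * f t x) with (- f t x) by ring; field.
- apply Cinf_mult, Cinf_plus; auto using Cinf_const, Cinf_exp, Cinf_mult.
Qed.

Lemma Cinf_sinh f : Cinf f -> Cinf (fun t x => sinh (f t x)).
Proof.
intros Hf; apply Cinf_ext with (fun t x => / 2 * (exp (f t x) - exp (-1 * f t x))).
- intros; unfold sinh; replace (-1 * f t x) with (- f t x) by ring; field.
- apply Cinf_mult, Cinf_minus; auto using Cinf_const, Cinf_exp, Cinf_mult.
Qed.

Lemma Cinf_is_D f : Cinf f -> forall t x, 0 <= t ->
  is_Dt f t x (Dt f t x) /\ is_Dx f t x (Dx f t x).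
Proof.
intros Hf t x Ht; destruct (Hf 1%nat) as [_ [ft [fx [HD _]]]].
destruct (HD t x Ht) as [H1 H2].
rewrite (is_Dt_unique _ _ _ _ Ht H1); unfold Dx; rewrite (is_derive_unique _ _ _ H2); auto.
Qed.

Lemma Cinf_is_Dt f t x : Cinf f -> 0 <= t -> is_Dt f t x (Dt f t x).
Proof. intros; apply Cinf_is_D; auto. Qed.

Lemma Cinf_is_Dx f t x : Cinf f -> 0 <= t -> is_Dx f t x (Dx f t x).
Proof. intros; apply Cinf_is_D; auto. Qed.

Lemma Cinf_Dt f : Cinf f -> Cinf (Dt f).
Proof.
intros Hf k; destruct (Hf (S k)) as [_ [ft [fx [HD [H _]]]]].
apply Ck_ext with ft; auto; intros t x Ht; symmetry; apply is_Dt_unique; auto; apply HD; auto.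
Qed.

Lemma Cinf_Dx f : Cinf f -> Cinf (Dx f).
Proof.
intros Hf k; destruct (Hf (S k)) as [_ [ft [fx [HD [_ H]]]]].
apply Ck_ext with fx; auto; intros t x Ht; symmetry; apply is_derive_unique, HD; auto.
Qed.

Lemma Cinf_cont f : Cinf f -> cont f.
Proof. intros H; apply (H O). Qed.

(** Differentiate [f t x = f 0 x + int_0^t Dt f] under the integral sign, then
    read off the [t]-derivative of the result; this covers [t = 0] as well. *)
Lemma Dt_Dx_comm f t x : Cinf f -> 0 <= t -> Dt (Dx f) t x = Dx (Dt f) t x.
Proof.
intros Hf Ht.
assert (Hft := Cinf_Dt _ Hf); assert (Hfx := Cinf_Dx _ Hf).
assert (Hftx := Cinf_Dx _ Hft).
assert (E : forall t x, 0 <= t -> f t x = f 0 x + Ich 0 (Dt f) t x).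
{ intros s y Hs; rewrite (transport f (Dt f) (Dx f) s y 0) by
    (auto using Cinf_cont; intros; apply Cinf_is_D; auto).
  f_equal; [f_equal; ring|apply Ich_ext; auto; intros; ring]. }
replace (Dx (Dt f) t x) with (Dx (Dt f) t x - 0 * Dx (Dx f) t x) by ring.
apply is_Dt_unique; auto.
apply (mild_is_Dt (Dx f 0)); auto using Cinf_cont, Cinf_Dx, Cinf_is_Dx.
intros s y Hs; replace (y - 0 * s) with y by ring.
apply is_derive_unique, (is_derive_ext (fun y => f 0 y + Ich 0 (Dt f) s y)).
{ intros; symmetry; auto. }
apply (is_derive_plus (f 0)); [apply Cinf_is_Dx; auto; lra|].
apply is_Dx_Ich; auto using Cinf_cont, Cinf_is_Dx.
Qed.

Lemma before_infty t : before p_infty t <-> 0 <= t.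
Proof. unfold before; simpl; tauto. Qed.

Lemma cont_continuous_on f :
  cont f <-> continuous_on (fun p : R * R => before p_infty (fst p)) (fun p => f (fst p) (snd p)).
Proof.
split.
- intros Hf [t x] Ht; simpl in Ht; apply before_infty in Ht; simpl.
  apply filterlim_locally; intros eps.
  destruct (Hf t x eps) as [d Hd]; exists d; intros [s y] [H1 H2] Hs.
  apply before_infty in Hs; simpl in *.
  specialize (Hd s y H1 H2); rewrite !Rmax0_id in Hd by auto; exact Hd.
- intros Hf t x eps.
  destruct (proj1 (filterlim_locally _ _) (Hf (Rmax 0 t, x) (proj2 (before_infty _) (Rmax0_ge t))) eps)
    as [d Hd].
  exists d; intros s y Hs Hy; apply (Hd (Rmax 0 s, y)).
  + split; [|exact Hy]; apply Rle_lt_trans with (2 := Hs), Rmax0_lip.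
  + apply before_infty, Rmax0_ge.
Qed.

Lemma smooth_Cinf f : smooth f -> Cinf f.
Proof.
intros [J [HJ0 HJ]].
assert (H : forall k i j, Ck k (J i j)).
{ induction k as [|k IH]; intros i j; destruct (HJ i j) as [H1 [H2 H3]];
  (split; [apply cont_continuous_on; auto|auto]).
  exists (J (S i) j), (J i (S j)); split; [split|split]; auto.
  - apply H1, before_infty; auto.
  - apply H2, before_infty; auto. }
intros k; rewrite <- HJ0; apply H.
Qed.

Lemma Dx_iter_ext j : forall f g, (forall t x, 0 <= t -> f t x = g t x) ->
  forall t x, 0 <= t -> Nat.iter j Dx f t x = Nat.iter j Dx g t x.
Proof.
induction j as [|j IH]; intros f g H t x Ht; simpl; auto.
apply Derive_ext; intros; apply IH; auto.
Qed.

Lemma Cinf_iter_Dx j f : Cinf f -> Cinf (Nat.iter j Dx f).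
Proof. induction j; simpl; auto using Cinf_Dx. Qed.

(** All mixed derivatives can be taken in [t] first, because they commute. *)
Lemma Cinf_smooth f : Cinf f -> smooth f.
Proof.
intros Hf.
exists (fun i j => Nat.iter j Dx (Nat.iter i Dt f)); split; auto.
assert (Ht : forall i, Cinf (Nat.iter i Dt f)).
{ induction i; simpl; auto using Cinf_Dt. }
assert (Hc : forall j g, Cinf g -> forall t x, 0 <= t ->
   Dt (Nat.iter j Dx g) t x = Nat.iter j Dx (Dt g) t x).
{ induction j as [|j IH]; intros g Hg t x Ht0; auto.
  rewrite !Nat.iter_succ_r, IH by auto using Cinf_Dx.
  apply Dx_iter_ext; auto; intros; apply Dt_Dx_comm; auto. }
intros i j; assert (Hij := Cinf_iter_Dx j _ (Ht i)); split; [|split].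
- intros t x H; apply before_infty in H; simpl (Nat.iter (S i) _ _).
  rewrite <- Hc by auto; apply Cinf_is_Dt; auto.
- intros t x H; apply before_infty in H; apply Cinf_is_Dx; auto.
- apply cont_continuous_on, Cinf_cont; auto.
Qed.

Lemma smooth_fun_Derive g : smooth_fun g -> smooth_fun (Derive g).
Proof.
intros H n x; destruct n; simpl; auto.
apply ex_derive_ext with (Derive_n g (S n)); [|apply (H (S (S n)))].
intros y; rewrite <- (Nat.add_1_r n); symmetry; apply (Derive_n_comp g n 1).
Qed.

Lemma smooth_fun_Cinf g : smooth_fun g -> Cinf (fun _ x => g x).
Proof.
intros Hg k; revert g Hg; induction k as [|k IH]; intros g Hg.
- split; auto; apply (cont_comp1 g (fun _ x => x)); [|apply cont_space].
  intros t x _; apply continuity_pt_filterlim, (ex_derive_continuous g), (Hg 1%nat).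
- split.
  + apply (cont_comp1 g (fun _ x => x)); [|apply cont_space].
    intros t x _; apply continuity_pt_filterlim, (ex_derive_continuous g), (Hg 1%nat).
  + exists (fun _ _ => 0), (fun _ x => Derive g x); split; [split|split]; auto using Ck_const, smooth_fun_Derive.
    * apply is_Dt_iff; auto; exists (fun _ => g x); split; auto; auto_derive; auto.
    * apply Derive_correct, (Hg 1%nat).
Qed.

Lemma Derive_n_slice f t n x : Derive_n (f t) n x = Nat.iter n Dx f t x.
Proof.
revert x; induction n as [|n IH]; intros x; simpl; auto; apply Derive_ext, IH.
Qed.

Lemma Cinf_slice f t : Cinf f -> 0 <= t -> smooth_fun (f t).
Proof.
intros Hf Ht [|n] x; simpl; auto.
apply ex_derive_ext with (Nat.iter n Dx f t).
- intros; rewrite Derive_n_slice; auto.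
- eexists; apply (Cinf_is_Dx (Nat.iter n Dx f)); auto using Cinf_iter_Dx.
Qed.

(** * Diagonal systems of transport equations *)

Lemma half_pow_pos n : 0 < (/ 2) ^ n.
Proof. apply pow_lt; lra. Qed.

Lemma half_pow_small M e : 0 < e -> exists N, forall n, (N <= n)%nat -> M * (/ 2) ^ n <= e.
Proof.
intros He.
assert (HM : 0 < Rabs M + 1) by (generalize (Rabs_pos M); lra).
destruct (pow_lt_1_zero (/ 2) ltac:(rewrite Rabs_right; lra) (e / (Rabs M + 1))
  ltac:(apply Rdiv_lt_0_compat; lra)) as [N HN].
exists N; intros n Hn; specialize (HN n ltac:(lia)).
rewrite Rabs_right in HN by (generalize (half_pow_pos n); lra).
apply Rle_trans with ((Rabs M + 1) * (/ 2) ^ n).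
- apply Rmult_le_compat_r; [generalize (half_pow_pos n)|generalize (Rle_abs M)]; lra.
- apply Rmult_le_reg_r with (/ (Rabs M + 1)); [apply Rinv_0_lt_compat; lra|].
  replace ((Rabs M + 1) * (/ 2) ^ n * / (Rabs M + 1)) with ((/ 2) ^ n) by (field; lra).
  unfold Rdiv in HN; lra.
Qed.

Lemma le_half_pow a b M : (forall n, a <= b + M * (/ 2) ^ n) -> a <= b.
Proof.
intros H; apply Rle_plus_epsilon; intros e He.
destruct (half_pow_small M e He) as [N HN]; specialize (HN N (le_n N)); specialize (H N); lra.
Qed.

Lemma exp_mono a b : a <= b -> exp a <= exp b.
Proof. intros [H|H]; [left; apply exp_increasing; auto|rewrite H; lra]. Qed.

(** The constant [2] leaves room for the iteration: if [|D| <= B exp (2 L t)]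
    then the integral inequality improves [B] to [eta + T e + B / 2]. *)
Lemma gronwall (I : Type) (c : I -> R) (Om : R -> R -> Prop) (D g : I -> R -> R -> R)
  (L eta e T M : R) :
  0 < L -> 0 <= eta -> 0 <= e ->
  (forall i, cont (g i)) ->
  (forall t x, Om t x -> 0 <= t <= T) ->
  (forall i t x s, Om t x -> 0 <= s <= t -> Om s (x - c i * (t - s))) ->
  (forall i t x, Om t x -> Rabs (D i t x) <= eta + Rabs (Ich (c i) (g i) t x)) ->
  (forall i t x B, Om t x -> (forall j, Rabs (D j t x) <= B) -> Rabs (g i t x) <= L * B + e) ->
  (forall i t x, Om t x -> Rabs (D i t x) <= M) ->
  forall i t x, Om t x -> Rabs (D i t x) <= 2 * (eta + T * e) * exp (2 * L * t).
Proof.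
intros HL Heta He Hg HT Hch HD HgB HM i t x Hom.
assert (HM0 : 0 <= M) by (apply Rle_trans with (2 := HM i t x Hom), Rabs_pos).
set (K := eta + T * e).
assert (HT0 := HT t x Hom).
assert (HK : 0 <= K) by (unfold K; nra).
assert (Hn : forall n i t x, Om t x ->
  Rabs (D i t x) <= (2 * K + M * (/ 2) ^ n) * exp (2 * L * t)).
{ clear i t x Hom HT0; induction n as [|n IH]; intros i t x Hom; assert (HT0 := HT t x Hom).
  - assert (1 <= exp (2 * L * t)) by (rewrite <- exp_0; apply exp_mono; nra).
    generalize (HM i t x Hom); simpl; nra.
  - set (b := 2 * K + M * (/ 2) ^ n) in *.
    assert (Hb : 0 <= b) by (unfold b; generalize (half_pow_pos n); nra).
    eapply Rle_trans; [apply HD; auto|].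
    assert (HI : Rabs (Ich (c i) (g i) t x) <=
       (b / 2 * exp (2 * L * t) + e * t) - (b / 2 * exp (2 * L * 0) + e * 0)).
    { apply (Ich_le (c i) (g i) t x (fun s => b / 2 * exp (2 * L * s) + e * s)
        (fun s => L * (b * exp (2 * L * s)) + e)); auto; try lra.
      - intros; auto_derive; auto; field.
      - intros; apply (ex_derive_continuous (fun s => L * (b * exp (2 * L * s)) + e)).
        auto_derive; auto. }
    assert (E : (2 * K + M * (/ 2) ^ S n) = K + b / 2) by (unfold b; simpl; field).
    rewrite E; rewrite Rmult_0_r, exp_0 in HI.
    assert (1 <= exp (2 * L * t)) by (rewrite <- exp_0; apply exp_mono; nra).
    assert (eta + e * t <= K) by (unfold K; nra).
    nra. }
assert (HE := exp_pos (2 * L * t)).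
assert (HE' : 0 < / exp (2 * L * t)) by (apply Rinv_0_lt_compat; lra).
apply Rmult_le_reg_r with (/ exp (2 * L * t)); auto.
replace (2 * K * exp (2 * L * t) * / exp (2 * L * t)) with (2 * K) by (field; lra).
apply le_half_pow with M; intros n; specialize (Hn n i t x Hom).
replace (2 * K + M * (/ 2) ^ n) with
  ((2 * K + M * (/ 2) ^ n) * exp (2 * L * t) * / exp (2 * L * t)) by (field; lra).
apply Rmult_le_compat_r; lra.
Qed.

Definition cone (X t x : R) : Prop := 0 <= t /\ Rabs x + t <= X.

Lemma cone_char c X t x s :
  Rabs c <= 1 -> cone X t x -> 0 <= s <= t -> cone X s (x - c * (t - s)).
Proof.
intros Hc [Ht Hx] Hs; split; [lra|].
generalize (Rabs_triang x (- (c * (t - s)))).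
rewrite Rabs_Ropp, Rabs_mult, (Rabs_right (t - s)) by lra.
replace (x + - (c * (t - s))) with (x - c * (t - s)) by ring; nra.
Qed.

Lemma cone_box X t x : cone X t x -> 0 <= t <= X /\ Rabs x <= X.
Proof. intros [Ht Hx]; generalize (Rabs_pos x); lra. Qed.

Lemma cone_shift X t x h : Rabs h <= 1 -> cone X t x -> cone (X + 1) t (x + h).
Proof. intros Hh [Ht Hx]; split; auto; generalize (Rabs_triang x h); lra. Qed.

Lemma in_some_cone t x : 0 <= t -> cone (Rabs x + t) t x.
Proof. split; lra. Qed.

Definition limf (f : nat -> R -> R -> R) (t x : R) : R := real (Lim_seq (fun n => f n t x)).

Lemma uniform_limit (f : nat -> R -> R -> R) :
  (forall n, cont (f n)) ->
  (forall X e, 0 < e -> exists N, forall n m t x,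
     (N <= n)%nat -> (N <= m)%nat -> cone X t x -> Rabs (f n t x - f m t x) <= e) ->
  cont (limf f) /\ forall X e, 0 < e -> exists N, forall n t x,
     (N <= n)%nat -> cone X t x -> Rabs (f n t x - limf f t x) <= e.
Proof.
intros Hc HC.
set (F := limf f).
assert (HF : forall X e, 0 < e -> exists N, forall n t x,
     (N <= n)%nat -> cone X t x -> Rabs (f n t x - F t x) <= e).
{ intros X e He; destruct (HC X e He) as [N HN]; exists N; intros n t x Hn Htx.
  assert (Hl : is_lim_seq (fun m => f m t x) (F t x)).
  { apply Lim_seq_correct', ex_lim_seq_cauchy_corr; intros eps.
    destruct (HC X (eps / 2) ltac:(destruct eps; simpl; lra)) as [N' HN'].
    exists N'; intros p q Hp Hq; apply Rle_lt_trans with (eps / 2); auto.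
    destruct eps; simpl; lra. }
  assert (H2 := is_lim_seq_le (fun m => Rabs (f n t x - f (m + N)%nat t x)) (fun _ => e)
    (Rabs (f n t x - F t x)) e).
  apply H2; [intros m; apply HN; auto; lia| |apply is_lim_seq_const].
  apply (is_lim_seq_abs _ (Finite _)), is_lim_seq_minus'; [apply is_lim_seq_const|].
  apply (is_lim_seq_incr_n (fun m => f m t x) N); auto. }
split; auto.
intros t x eps.
set (t' := Rmax 0 t).
assert (He : 0 < eps / 3) by (destruct eps; simpl; lra).
destruct (HF (Rabs x + t' + 2) (eps / 3) He) as [N HN].
destruct (Hc N t x (mkposreal _ He)) as [d Hd]; simpl in Hd.
assert (Hm : 0 < Rmin d 1) by (apply Rmin_glb_lt; [apply cond_pos|lra]).
exists (mkposreal _ Hm); intros s y Hs Hy; simpl in Hs, Hy.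
assert (Hd' := Hd s y (Rlt_le_trans _ _ _ Hs (Rmin_l _ _)) (Rlt_le_trans _ _ _ Hy (Rmin_l _ _))).
assert (Hs1 := Rlt_le_trans _ _ _ Hs (Rmin_r _ _)).
assert (Hy1 := Rlt_le_trans _ _ _ Hy (Rmin_r _ _)).
assert (H1 := HN N (Rmax 0 t) x (le_n N)).
assert (H2 := HN N (Rmax 0 s) y (le_n N)).
assert (C1 : cone (Rabs x + t' + 2) (Rmax 0 t) x).
{ split; [apply Rmax0_ge|fold t'; lra]. }
assert (C2 : cone (Rabs x + t' + 2) (Rmax 0 s) y).
{ split; [apply Rmax0_ge|].
  assert (H3 := Rmax0_lip s t); fold t' in H3.
  assert (H4 := Rle_lt_trans _ _ _ H3 Hs1).
  apply Rabs_def2 in H4; generalize (Rabs_sub_bound y x 1 (Rabs x) (Rle_refl _) ltac:(lra)); lra. }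
specialize (H1 C1); specialize (H2 C2); fold t' in H1, Hd'.
apply Rabs_le_between in H1; apply Rabs_le_between in H2; apply Rabs_def2 in Hd'.
apply Rabs_def1; lra.
Qed.

(** * Existence near a reference solution *)

(** Picard iteration started at a solution [V], in the weighted sup norm
    [sup |u_i| / (w_i exp (2 K theta))].  The weight [w_i] is constant along the
    [i]-th characteristics and [theta] increases along all of them, so that an
    interaction term bounded by [w_i dtheta_i] is halved by integration: the
    iteration contracts on all times at once. *)
Lemma picard (I : Type) (c : I -> R) (F : I -> R -> R -> (I -> R) -> R)
  (V : I -> R -> R -> R) (V0 U0 : I -> R -> R) (w dth : I -> R -> R -> R)
  (theta : R -> R -> R) (rho K Th e0 : R) :
  0 < K -> 0 <= e0 -> 2 * e0 * exp (2 * K * Th) <= rho ->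
  (forall i, cont (V i)) ->
  (forall i t x, 0 <= t ->
     V i t x = V0 i (x - c i * t) + Ich (c i) (fun t x => F i t x (fun j => V j t x)) t x) ->
  (forall i y, continuity_pt (U0 i) y) ->
  (forall u, (forall j, cont (u j)) -> forall i, cont (fun t x => F i t x (fun j => u j t x))) ->
  (forall i t x, 0 < w i t x <= 1) ->
  (forall i t x s, w i s (x - c i * (t - s)) = w i t x) ->
  (forall i t x, 0 <= dth i t x) ->
  (forall t x, 0 <= theta t x <= Th) ->
  (forall i t x s, is_derive (fun s => theta s (x - c i * (t - s))) s (dth i s (x - c i * (t - s)))) ->
  (forall i t x s, continuous (fun s => dth i s (x - c i * (t - s))) s) ->
  (forall i t x u v B, 0 <= t -> 0 <= B ->
     (forall j, Rabs (u j - V j t x) <= rho * w j t x) ->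
     (forall j, Rabs (v j - V j t x) <= rho * w j t x) ->
     (forall j, Rabs (u j - v j) <= B * w j t x) ->
     Rabs (F i t x u - F i t x v) <= K * B * w i t x * dth i t x) ->
  (forall i y, Rabs (U0 i y - V0 i y) <= e0 * w i 0 y) ->
  exists U : I -> R -> R -> R,
    (forall i, cont (U i)) /\
    (forall i t x, 0 <= t -> Rabs (U i t x - V i t x) <= rho * w i t x) /\
    (forall i t x, 0 <= t ->
       U i t x = U0 i (x - c i * t) + Ich (c i) (fun t x => F i t x (fun j => U j t x)) t x).
Proof.
intros HK He0 Hrho HSc HS HU0c HFc Hw Hwc Hdth Hth HthD HdthC HF HU0.
set (Un := fix Un n := match n with
  | O => V
  | S n => fun i t x =>
      U0 i (x - c i * t) + Ich (c i) (fun t x => F i t x (fun j => Un n j t x)) t x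
  end).
assert (Hc : forall n i, cont (Un n i)).
{ induction n as [|n IH]; intros i; simpl; auto.
  apply cont_plus; [apply cont_char; auto|apply cont_Ich, HFc; auto]. }
set (E := fun t x => exp (2 * K * theta t x)).
assert (HE : forall t x, 1 <= E t x <= exp (2 * K * Th)).
{ intros t x; generalize (Hth t x); intros; unfold E; rewrite <- exp_0 at 1; split; apply exp_mono; nra. }
assert (Hint : forall i t x f B, 0 <= t -> 0 <= B -> cont f ->
   (forall s y, 0 <= s -> Rabs (f s y) <= K * (B * E s y) * w i s y * dth i s y) ->
   Rabs (Ich (c i) f t x) <= B / 2 * E t x * w i t x).
{ intros i t x f B Ht HB Hf Hb.
  eapply Rle_trans; [apply (Ich_le (c i) f t x
    (fun s => B / 2 * w i t x * E s (x - c i * (t - s)))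
    (fun s => K * (B * E s (x - c i * (t - s))) * w i t x * dth i s (x - c i * (t - s)))); auto|].
  - intros s; unfold E.
    assert (Hd := HthD i t x s).
    replace (K * (B * exp (2 * K * theta s (x - c i * (t - s)))) * w i t x * dth i s (x - c i * (t - s)))
      with (B / 2 * w i t x * ((2 * K * dth i s (x - c i * (t - s))) * exp (2 * K * theta s (x - c i * (t - s)))))
      by field.
    apply (is_derive_scal (fun s => exp (2 * K * theta s (x - c i * (t - s))))).
    apply (is_derive_comp_R exp (fun s => 2 * K * theta s (x - c i * (t - s)))).
    + apply is_derive_exp.
    + apply (is_derive_scal (fun s => theta s (x - c i * (t - s)))); auto.
  - intros s.
    apply (continuous_mult (fun s => K * (B * E s (x - c i * (t - s))) * w i t x)); auto.
    apply (ex_derive_continuous (fun s => K * (B * E s (x - c i * (t - s))) * w i t x)).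
    unfold E; eexists.
    apply (is_derive_ext (fun s => K * B * w i t x * exp (2 * K * theta s (x - c i * (t - s))))).
    { intros; simpl; ring. }
    apply (is_derive_scal (fun s => exp (2 * K * theta s (x - c i * (t - s))))).
    apply (is_derive_comp_R exp (fun s => 2 * K * theta s (x - c i * (t - s)))).
    + apply is_derive_exp.
    + apply (is_derive_scal (fun s => theta s (x - c i * (t - s)))); auto.
  - intros s Hs; rewrite <- (Hwc i t x s); apply Hb; lra.
  - replace (x - c i * (t - t)) with x by ring.
    generalize (Hw i t x) (HE 0 (x - c i * (t - 0))); intros.
    assert (0 <= B / 2 * w i t x * E 0 (x - c i * (t - 0))) by (repeat apply Rmult_le_pos; lra).
    lra. }
assert (Hind : forall n,
  (forall i t x, 0 <= t -> Rabs (Un n i t x - V i t x) <= e0 * (2 - 2 * (/ 2) ^ n) * E t x * w i t x) /\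
  (forall i t x, 0 <= t ->
     Rabs (Un (S n) i t x - Un n i t x) <= e0 * (/ 2) ^ n * E t x * w i t x)).
{ assert (Hrw : forall n t x, e0 * (2 - 2 * (/ 2) ^ n) * E t x <= rho).
  { intros n t x; generalize (half_pow_pos n) (HE t x); intros.
    apply Rle_trans with (2 := Hrho).
    assert (e0 * (2 - 2 * (/ 2) ^ n) <= 2 * e0) by nra.
    assert ((/ 2) ^ n <= 1) by (rewrite <- (pow1 n); apply pow_incr; lra).
    assert (0 <= e0 * (2 - 2 * (/ 2) ^ n)) by (apply Rmult_le_pos; lra).
    nra. }
  assert (Htri : forall n,
   (forall i t x, 0 <= t -> Rabs (Un n i t x - V i t x) <= e0 * (2 - 2 * (/ 2) ^ n) * E t x * w i t x) ->
   (forall i t x, 0 <= t ->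
     Rabs (Un (S n) i t x - Un n i t x) <= e0 * (/ 2) ^ n * E t x * w i t x) ->
   (forall i t x, 0 <= t -> Rabs (Un (S n) i t x - V i t x)
       <= e0 * (2 - 2 * (/ 2) ^ (S n)) * E t x * w i t x)).
  { intros n H1 H2 i t x Ht.
    replace (Un (S n) i t x - V i t x) with
      ((Un (S n) i t x - Un n i t x) + (Un n i t x - V i t x)) by ring.
    eapply Rle_trans; [apply Rabs_triang|].
    eapply Rle_trans; [apply Rplus_le_compat; [apply H2|apply H1]; auto|].
    right; simpl; field. }
  induction n as [|n [IH1 IH2]].
  - split; intros i t x Ht.
    + simpl; rewrite Rminus_diag, Rabs_R0; lra.
    + simpl (Un 0%nat); rewrite (HS i t x) by auto; simpl.
      replace (_ - _) with (U0 i (x - c i * t) - V0 i (x - c i * t)) by ring.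
      eapply Rle_trans; [apply HU0|].
      replace (x - c i * t) with (x - c i * (t - 0)) by ring; rewrite Hwc.
      generalize (HE t x) (Hw i t x); intros.
      apply Rmult_le_compat_r; [lra|]; rewrite Rmult_1_r; nra.
  - assert (IH3 := Htri n IH1 IH2).
    split; auto.
    intros i t x Ht.
    change (Rabs ((U0 i (x - c i * t) +
        Ich (c i) (fun t x => F i t x (fun j => Un (S n) j t x)) t x)
      - (U0 i (x - c i * t) + Ich (c i) (fun t x => F i t x (fun j => Un n j t x)) t x))
      <= e0 * (/ 2) ^ (S n) * E t x * w i t x).
    replace (_ - _) with (Ich (c i) (fun t x => F i t x (fun j => Un (S n) j t x)
       - F i t x (fun j => Un n j t x)) t x).
    2:{ rewrite Ich_minus by (apply HFc; auto); ring. }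
    replace (e0 * (/ 2) ^ S n) with (e0 * (/ 2) ^ n / 2) by (simpl; field).
    apply Hint; auto.
    + apply Rmult_le_pos; auto; apply Rlt_le, half_pow_pos.
    + apply cont_minus; apply HFc; auto.
    + intros s y Hs; apply HF; auto.
      * generalize (half_pow_pos n) (HE s y); intros; repeat apply Rmult_le_pos; lra.
      * intros j; eapply Rle_trans; [apply IH3; auto|].
        apply Rmult_le_compat_r; [generalize (Hw j s y); lra|apply Hrw].
      * intros j; eapply Rle_trans; [apply IH1; auto|].
        apply Rmult_le_compat_r; [generalize (Hw j s y); lra|apply Hrw]. }
set (M := e0 * exp (2 * K * Th)).
assert (HM : 0 <= M) by (apply Rmult_le_pos; auto; apply Rlt_le, exp_pos).
assert (Hstep : forall n i t x, 0 <= t ->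
  Rabs (Un (S n) i t x - Un n i t x) <= M * (/ 2) ^ n * w i t x).
{ intros n i t x Ht; eapply Rle_trans; [apply Hind; auto|].
  apply Rmult_le_compat_r; [generalize (Hw i t x); lra|].
  unfold M; generalize (HE t x) (half_pow_pos n); intros.
  assert (0 <= e0 * (/ 2) ^ n) by (apply Rmult_le_pos; lra).
  replace (e0 * exp (2 * K * Th) * (/ 2) ^ n) with (e0 * (/ 2) ^ n * exp (2 * K * Th)) by ring.
  apply Rmult_le_compat_l; lra. }
assert (Hgap : forall k n i t x, 0 <= t ->
  Rabs (Un (n + k)%nat i t x - Un n i t x) <= M * (2 - 2 * (/ 2) ^ k) * (/ 2) ^ n * w i t x).
{ induction k as [|k IH]; intros n i t x Ht.
  - rewrite Nat.add_0_r, Rminus_diag, Rabs_R0; simpl; lra.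
  - rewrite <- plus_n_Sm.
    replace (Un (S (n + k)) i t x - Un n i t x) with
      ((Un (S (n + k)) i t x - Un (n + k)%nat i t x) + (Un (n + k)%nat i t x - Un n i t x)) by ring.
    eapply Rle_trans; [apply Rabs_triang|].
    eapply Rle_trans; [apply Rplus_le_compat; [apply Hstep|apply IH]; auto|].
    right; rewrite pow_add; simpl; field. }
assert (Hgap2 : forall n m i t x, (n <= m)%nat -> 0 <= t ->
  Rabs (Un m i t x - Un n i t x) <= 2 * M * (/ 2) ^ n * w i t x).
{ intros n m i t x Hnm Ht; replace m with (n + (m - n))%nat by lia.
  eapply Rle_trans; [apply Hgap; auto|].
  apply Rmult_le_compat_r; [generalize (Hw i t x); lra|].
  apply Rmult_le_compat_r; [apply Rlt_le, half_pow_pos|].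
  generalize (half_pow_pos (m - n)); nra. }
set (U := fun i => limf (fun n => Un n i)).
assert (HU : forall i, cont (U i) /\ forall X e, 0 < e -> exists N, forall n t x,
     (N <= n)%nat -> cone X t x -> Rabs (Un n i t x - U i t x) <= e).
{ intros i; apply uniform_limit; auto.
  intros X e He; destruct (half_pow_small (4 * M) e He) as [N HN].
  exists N; intros n m t x Hn Hm [Ht _].
  replace (Un n i t x - Un m i t x) with ((Un n i t x - Un N i t x) - (Un m i t x - Un N i t x)) by ring.
  eapply Rle_trans; [apply Rabs_triang|]; rewrite Rabs_Ropp.
  eapply Rle_trans; [apply Rplus_le_compat; apply Hgap2; auto|].
  specialize (HN N (le_n N)); generalize (Hw i t x) (half_pow_pos N); intros.
  assert (0 <= 2 * M * (/ 2) ^ N) by (apply Rmult_le_pos; lra).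
  assert (2 * M * (/ 2) ^ N * w i t x <= 2 * M * (/ 2) ^ N * 1) by (apply Rmult_le_compat_l; lra).
  lra. }
assert (HUn : forall n i t x, 0 <= t -> Rabs (U i t x - Un n i t x) <= 2 * M * (/ 2) ^ n * w i t x).
{ intros n i t x Ht; apply Rle_plus_epsilon; intros e He.
  destruct (proj2 (HU i) (Rabs x + t) e He) as [N HN].
  specialize (HN (max n N) t x ltac:(lia) (in_some_cone t x Ht)).
  replace (U i t x - Un n i t x) with
    ((Un (max n N) i t x - Un n i t x) - (Un (max n N) i t x - U i t x)) by ring.
  eapply Rle_trans; [apply Rabs_triang|]; rewrite Rabs_Ropp.
  apply Rplus_le_compat; auto; apply Hgap2; auto; lia. }
assert (HMr : 2 * M <= rho) by (unfold M; lra).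
assert (Htube : forall n i t x, 0 <= t -> Rabs (Un n i t x - V i t x) <= rho * w i t x).
{ intros n i t x Ht; eapply Rle_trans; [apply (Hgap2 0%nat n); auto; lia|].
  simpl; rewrite Rmult_1_r; apply Rmult_le_compat_r; auto; generalize (Hw i t x); lra. }
assert (HtubeU : forall i t x, 0 <= t -> Rabs (U i t x - V i t x) <= rho * w i t x).
{ intros i t x Ht; eapply Rle_trans; [apply (HUn 0%nat); auto|].
  simpl; rewrite Rmult_1_r; apply Rmult_le_compat_r; auto; generalize (Hw i t x); lra. }
exists U; split; [intros; apply HU|]; split; auto.
intros i t x Ht.
apply Rminus_diag_uniq.
cut (Rabs (U i t x - (U0 i (x - c i * t) + Ich (c i) (fun t x => F i t x (fun j => U j t x)) t x)) <= 0).
{ intros H; destruct (Req_dec (U i t x - (U0 i (x - c i * t) +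
     Ich (c i) (fun t x => F i t x (fun j => U j t x)) t x)) 0) as [E0|E0]; auto.
  apply Rabs_pos_lt in E0; lra. }
apply le_half_pow with (M * w i t x + 2 * M * K * Th * w i t x); intros n.
rewrite Rplus_0_l.
replace (_ - _) with ((U i t x - Un (S n) i t x) +
  Ich (c i) (fun t x => F i t x (fun j => Un n j t x) - F i t x (fun j => U j t x)) t x).
2:{ rewrite Ich_minus by (apply HFc; auto; intros; apply HU); simpl; ring. }
eapply Rle_trans; [apply Rabs_triang|].
replace ((M * w i t x + 2 * M * K * Th * w i t x) * (/ 2) ^ n) with
  (2 * M * (/ 2) ^ S n * w i t x + 2 * M * (/ 2) ^ n * K * w i t x * Th) by (simpl; field).
apply Rplus_le_compat; auto.
set (b := 2 * M * (/ 2) ^ n * K * w i t x).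
assert (Hb : 0 <= b).
{ unfold b; generalize (half_pow_pos n) (Hw i t x); intros.
  apply Rmult_le_pos; [|lra]; apply Rmult_le_pos; [|lra]; apply Rmult_le_pos; lra. }
eapply Rle_trans; [apply (Ich_le (c i) _ t x (fun s => b * theta s (x - c i * (t - s)))
   (fun s => b * dth i s (x - c i * (t - s)))); auto|].
- apply cont_minus; apply HFc; auto; intros; apply HU.
- intros s; apply (is_derive_scal (fun s => theta s (x - c i * (t - s)))); auto.
- intros s; apply (continuous_scal_r b (fun s => dth i s (x - c i * (t - s)))); auto.
- intros s Hs; set (y := x - c i * (t - s)).
  eapply Rle_trans; [apply (HF i s y _ _ (2 * M * (/ 2) ^ n)); try lra|].
  + generalize (half_pow_pos n); intros; apply Rmult_le_pos; lra.
  + intros; apply Htube; lra.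
  + intros; apply HtubeU; lra.
  + intros j; rewrite Rabs_minus_sym; apply HUn; lra.
  + unfold b, y; rewrite Hwc; right; ring.
- generalize (Hth t (x - c i * (t - t))) (Hth 0 (x - c i * (t - 0))); nra.
Qed.

(** * Regularity in the space variable *)

Definition dq (f : R -> R -> R) (h t x : R) : R := (f t (x + h) - f t x) / h.

Lemma cont_shift f h : cont f -> cont (fun t x => f t (x + h)).
Proof.
intros Hf t x eps; destruct (Hf t (x + h) eps) as [d Hd]; exists d; intros s y Hs Hy.
apply Hd; auto; replace (y + h - (x + h)) with (y - x) by ring; auto.
Qed.

Lemma cont_dq f h : cont f -> cont (dq f h).
Proof.
intros Hf; apply cont_mult; [|apply cont_const].
apply cont_minus; auto; apply cont_shift; auto.
Qed.

Lemma dq_mild (U0 : R -> R) U G c h t x :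
  cont G -> 0 <= t ->
  (forall x, U t x = U0 (x - c * t) + Ich c G t x) ->
  dq U h t x = dq (fun _ => U0) h 0 (x - c * t) + Ich c (dq G h) t x.
Proof.
intros HG Ht H.
assert (E : Ich c (dq G h) t x = / h * (Ich c G t (x + h) - Ich c G t x)).
{ transitivity (Ich c (fun t x => / h * (G t (x + h) - G t x)) t x).
  { apply Ich_ext; auto; intros; unfold dq, Rdiv; ring. }
  rewrite Ich_scal by (apply cont_minus; auto using cont_shift).
  rewrite Ich_minus by auto using cont_shift.
  f_equal; f_equal; apply RInt_ext; intros; f_equal; ring. }
rewrite E; unfold dq, Rdiv; rewrite !H.
replace (x + h - c * t) with (x - c * t + h) by ring; ring.
Qed.

(** Control of the difference quotients of [G] by those of the unknowns [U]:
    they are bounded, and close for two small steps, whenever the ones of [U]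
    are.  Unlike differentiability this can be stated before any derivative of
    [U] is known to exist, and it is inherited by sums and products. *)
Definition dq_control {I : Type} (U : I -> R -> R -> R) (G : R -> R -> R) (X L C : R) : Prop :=
  (forall h t x B, 0 < Rabs h < 1 -> cone X t x -> 0 <= B ->
     (forall j, Rabs (dq (U j) h t x) <= B) -> Rabs (dq G h t x) <= L * B + C) /\
  (forall M e, 0 < e -> exists d, 0 < d /\ forall h k t x B,
     0 < Rabs h < d -> 0 < Rabs k < d -> cone X t x -> 0 <= B ->
     (forall j, Rabs (dq (U j) h t x) <= M) -> (forall j, Rabs (dq (U j) k t x) <= M) ->
     (forall j, Rabs (dq (U j) h t x - dq (U j) k t x) <= B) ->
     Rabs (dq G h t x - dq G k t x) <= L * B + e).

Definition tame {I : Type} (U : I -> R -> R -> R) (G : R -> R -> R) : Prop :=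
  forall X, exists L C, 0 <= L /\ 0 <= C /\ dq_control U G X L C.

Lemma tame_var (I : Type) (U : I -> R -> R -> R) i : tame U (U i).
Proof.
intros X; exists 1, 0; split; [lra|split; [lra|split]].
- intros h t x B _ _ _ H; specialize (H i); lra.
- intros M e He; exists 1; split; [lra|]; intros h k t x B _ _ _ _ _ _ H; specialize (H i); lra.
Qed.

Lemma dq_mean_value f fx h t x :
  (forall x, is_Dx f t x (fx t x)) -> h <> 0 ->
  exists z, Rabs (z - x) <= Rabs h /\ dq f h t x = fx t z.
Proof.
intros HD Hh.
destruct (MVT_between (f t) (fx t) x (x + h)) as [z [Hz1 Hz2]]; [intros; apply HD|].
exists z; split.
- apply between_close in Hz1; replace (x + h - x) with h in Hz1 by ring; auto.
- unfold dq; rewrite Hz2; field; auto.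
Qed.

Lemma Rabs_pos_neq h : 0 < Rabs h -> h <> 0.
Proof. intros H E; rewrite E, Rabs_R0 in H; lra. Qed.

Lemma dq_control_known (I : Type) (U : I -> R -> R -> R) f fx X :
  (forall t x, 0 <= t -> is_Dx f t x (fx t x)) -> cont fx ->
  exists C, 0 <= C /\ dq_control U f X 0 C.
Proof.
intros HD Hfx.
destruct (cont_bounded fx (X + 1) (X + 1) Hfx) as [C [HC HCb]].
exists C; split; [lra|split].
- intros h t x B Hh Hc HB _; apply cone_box in Hc.
  destruct (dq_mean_value f fx h t x) as [z [Hz E]].
  { intros; apply HD; lra. } { apply Rabs_pos_neq; lra. }
  rewrite E, Rmult_0_l, Rplus_0_l; apply HCb; [lra|].
  apply Rabs_sub_bound with x; lra.
- intros M e He.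
  destruct (cont_ucont fx (X + 1) (X + 1) (e / 2) Hfx ltac:(lra)) as [d [Hd Hu]].
  exists (Rmin d 1); split; [apply Rmin_glb_lt; lra|].
  intros h k t x B Hh Hk Hc HB _ _ _; apply cone_box in Hc.
  assert (Hh1 := Rlt_le_trans _ _ _ (proj2 Hh) (Rmin_l _ _)).
  assert (Hh2 := Rlt_le_trans _ _ _ (proj2 Hh) (Rmin_r _ _)).
  assert (Hk1 := Rlt_le_trans _ _ _ (proj2 Hk) (Rmin_l _ _)).
  assert (Hk2 := Rlt_le_trans _ _ _ (proj2 Hk) (Rmin_r _ _)).
  destruct (dq_mean_value f fx h t x) as [z [Hz E]].
  { intros; apply HD; lra. } { apply Rabs_pos_neq; lra. }
  destruct (dq_mean_value f fx k t x) as [y [Hy E']].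
  { intros; apply HD; lra. } { apply Rabs_pos_neq; lra. }
  rewrite E, E', Rmult_0_l, Rplus_0_l.
  assert (Ha : forall z, Rabs (z - x) < d -> Rabs (z - x) < 1 -> Rabs (fx t z - fx t x) < e / 2).
  { intros u Hu1 Hu2; apply Hu; try lra.
    - apply Rabs_sub_bound with x; lra.
    - rewrite Rminus_diag, Rabs_R0; lra. }
  replace (fx t z - fx t y) with ((fx t z - fx t x) - (fx t y - fx t x)) by ring.
  eapply Rle_trans; [apply Rabs_triang|]; rewrite Rabs_Ropp.
  generalize (Ha z ltac:(lra) ltac:(lra)) (Ha y ltac:(lra) ltac:(lra)); lra.
Qed.

Lemma tame_known (I : Type) (U : I -> R -> R -> R) f fx :
  (forall t x, 0 <= t -> is_Dx f t x (fx t x)) -> cont fx -> tame U f.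
Proof.
intros HD Hfx X; destruct (dq_control_known I U f fx X HD Hfx) as [C [HC H]].
exists 0, C; split; [lra|auto].
Qed.

Lemma tame_plus (I : Type) (U : I -> R -> R -> R) f g :
  tame U f -> tame U g -> tame U (fun t x => f t x + g t x).
Proof.
intros Hf Hg X; destruct (Hf X) as [L1 [C1 [HL1 [HC1 [Ha1 Hb1]]]]],
  (Hg X) as [L2 [C2 [HL2 [HC2 [Ha2 Hb2]]]]].
assert (E : forall h t x, dq (fun t x => f t x + g t x) h t x = dq f h t x + dq g h t x).
{ intros; unfold dq, Rdiv; ring. }
exists (L1 + L2), (C1 + C2); split; [lra|split; [lra|split]].
- intros h t x B Hh Hc HB H; rewrite E.
  eapply Rle_trans; [apply Rabs_triang|].
  generalize (Ha1 h t x B Hh Hc HB H) (Ha2 h t x B Hh Hc HB H); lra.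
- intros M e He.
  destruct (Hb1 M (e / 2) ltac:(lra)) as [d1 [Hd1 H1]], (Hb2 M (e / 2) ltac:(lra)) as [d2 [Hd2 H2]].
  exists (Rmin d1 d2); split; [apply Rmin_glb_lt; lra|].
  intros h k t x B Hh Hk Hc HB HM1 HM2 H.
  assert (Hm1 := Rmin_l d1 d2); assert (Hm2 := Rmin_r d1 d2).
  rewrite !E.
  replace (_ - _) with ((dq f h t x - dq f k t x) + (dq g h t x - dq g k t x)) by ring.
  eapply Rle_trans; [apply Rabs_triang|].
  generalize (H1 h k t x B ltac:(lra) ltac:(lra) Hc HB HM1 HM2 H)
   (H2 h k t x B ltac:(lra) ltac:(lra) Hc HB HM1 HM2 H); lra.
Qed.

Lemma tame_mult (I : Type) (U : I -> R -> R -> R) f g :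
  cont f -> cont g -> tame U f -> tame U g -> tame U (fun t x => f t x * g t x).
Proof.
intros Hcf Hcg Hf Hg X; destruct (Hf X) as [L1 [C1 [HL1 [HC1 [Ha1 Hb1]]]]],
  (Hg X) as [L2 [C2 [HL2 [HC2 [Ha2 Hb2]]]]].
destruct (cont_bounded f (X + 1) (X + 1) Hcf) as [Mf [HMf Hfb]].
destruct (cont_bounded g (X + 1) (X + 1) Hcg) as [Mg [HMg Hgb]].
assert (E : forall h t x, dq (fun t x => f t x * g t x) h t x =
  f t (x + h) * dq g h t x + g t x * dq f h t x).
{ intros; unfold dq, Rdiv; ring. }
assert (Hfs : forall h t x, Rabs h < 1 -> cone X t x -> Rabs (f t (x + h)) <= Mf).
{ intros h t x Hh Hc; apply (cone_shift X t x h) in Hc; [|lra].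
  apply cone_box in Hc; apply Hfb; lra. }
assert (Hg0 : forall t x, cone X t x -> Rabs (g t x) <= Mg).
{ intros t x Hc; apply cone_box in Hc; apply Hgb; lra. }
assert (Hab : forall a b A B, Rabs a <= A -> Rabs b <= B -> Rabs (a * b) <= A * B).
{ intros a b A B H1 H2; rewrite Rabs_mult; apply Rmult_le_compat; auto; apply Rabs_pos. }
exists (Mf * L2 + Mg * L1), (Mf * C2 + Mg * C1).
split; [|split; [|split]]; try (apply Rplus_le_le_0_compat; apply Rmult_le_pos; lra).
- intros h t x B Hh Hc HB H; rewrite E.
  eapply Rle_trans; [apply Rabs_triang|].
  generalize (Hab _ _ _ _ (Hfs h t x (proj2 Hh) Hc) (Ha2 h t x B Hh Hc HB H))
    (Hab _ _ _ _ (Hg0 t x Hc) (Ha1 h t x B Hh Hc HB H)); lra.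
- intros M0 e He.
  set (M := Rabs M0); assert (HM : 0 <= M) by apply Rabs_pos.
  assert (HM0 : M0 <= M) by apply Rle_abs.
  set (K := L2 * M + C2); assert (HK : 0 <= K) by (unfold K; nra).
  assert (He1 : 0 < e / 4 / (K + 1)) by (apply Rdiv_lt_0_compat; lra).
  destruct (Hb1 M0 (e / 4 / Mg)) as [d1 [Hd1 H1]]; [apply Rdiv_lt_0_compat; lra|].
  destruct (Hb2 M0 (e / 4 / Mf)) as [d2 [Hd2 H2]]; [apply Rdiv_lt_0_compat; lra|].
  destruct (cont_ucont f (X + 1) (X + 1) _ Hcf He1) as [d3 [Hd3 Hu]].
  set (d := Rmin (Rmin d1 d2) (Rmin (d3 / 2) 1)).
  assert (Hd : d <= d1 /\ d <= d2 /\ d <= d3 / 2 /\ d <= 1).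
  { unfold d; generalize (Rmin_l (Rmin d1 d2) (Rmin (d3 / 2) 1)) (Rmin_r (Rmin d1 d2) (Rmin (d3 / 2) 1))
     (Rmin_l d1 d2) (Rmin_r d1 d2) (Rmin_l (d3 / 2) 1) (Rmin_r (d3 / 2) 1); lra. }
  exists d; split; [unfold d; repeat apply Rmin_glb_lt; lra|].
  intros h k t x B Hh Hk Hc HB HM1 HM2 H.
  rewrite !E.
  replace (_ - _) with (f t (x + h) * (dq g h t x - dq g k t x) +
    (f t (x + h) - f t (x + k)) * dq g k t x + g t x * (dq f h t x - dq f k t x)) by ring.
  eapply Rle_trans; [apply Rabs_triang|].
  eapply Rle_trans; [apply Rplus_le_compat_r, Rabs_triang|].
  assert (B1 := Hab _ _ _ _ (Hfs h t x ltac:(lra) Hc)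
    (H2 h k t x B ltac:(lra) ltac:(lra) Hc HB HM1 HM2 H)).
  assert (B2 := Hab _ _ _ _ (Hg0 t x Hc) (H1 h k t x B ltac:(lra) ltac:(lra) Hc HB HM1 HM2 H)).
  assert (B3 : Rabs ((f t (x + h) - f t (x + k)) * dq g k t x) <= e / 4 / (K + 1) * K).
  { apply Hab.
    - left; apply Hu.
      + apply cone_box in Hc; lra.
      + apply (cone_shift X t x k) in Hc; [apply cone_box in Hc|]; lra.
      + apply cone_box in Hc; lra.
      + apply (cone_shift X t x h) in Hc; [apply cone_box in Hc|]; lra.
      + rewrite Rminus_diag, Rabs_R0; lra.
      + replace (x + h - (x + k)) with (h - k) by ring.
        eapply Rle_lt_trans; [apply Rabs_triang|]; rewrite Rabs_Ropp; lra.
    - unfold K; apply (Ha2 k t x M); auto; [lra|].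
      intros j; specialize (HM2 j); lra. }
  assert (B4 : e / 4 / (K + 1) * K <= e / 4).
  { replace (e / 4) with (e / 4 / (K + 1) * (K + 1)) at 2 by (field; lra).
    apply Rmult_le_compat_l; lra. }
  replace (Mf * (L2 * B + e / 4 / Mf)) with (Mf * (L2 * B) + e / 4) in B1 by (field; lra).
  replace (Mg * (L1 * B + e / 4 / Mg)) with (Mg * (L1 * B) + e / 4) in B2 by (field; lra).
  lra.
Qed.

Lemma list_upper_bound (I : Type) (P : I -> R -> Prop) (l : list I) :
  (forall i M M', M <= M' -> P i M -> P i M') -> (forall i, exists M, P i M) ->
  exists M, forall i, In i l -> P i M.
Proof.
intros Hm H; induction l as [|a l [M IH]].
- exists 0; intros i [].
- destruct (H a) as [Ma Ha]; exists (Rmax M Ma); intros i [Hi|Hi].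
  + rewrite <- Hi; apply Hm with Ma; auto; apply Rmax_r.
  + apply Hm with M; auto; apply Rmax_l.
Qed.

Lemma list_lower_bound (I : Type) (P : I -> R -> Prop) (l : list I) :
  (forall i d d', d' <= d -> P i d -> P i d') -> (forall i, exists d, 0 < d /\ P i d) ->
  exists d, 0 < d /\ forall i, In i l -> P i d.
Proof.
intros Hm H; induction l as [|a l [d [Hd IH]]].
- exists 1; split; [lra|]; intros i [].
- destruct (H a) as [da [Hda Ha]]; exists (Rmin d da); split; [apply Rmin_glb_lt; auto|].
  intros i [Hi|Hi].
  + rewrite <- Hi; apply Hm with da; auto; apply Rmin_r.
  + apply Hm with d; auto; apply Rmin_l.
Qed.

Lemma dq_control_weaken (I : Type) (U : I -> R -> R -> R) G X L C L' C' :
  L <= L' -> C <= C' -> dq_control U G X L C -> dq_control U G X L' C'.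
Proof.
intros HL HC [Ha Hb]; split.
- intros h t x B Hh Hc HB H; generalize (Ha h t x B Hh Hc HB H); nra.
- intros M e He; destruct (Hb M e He) as [d [Hd H]]; exists d; split; auto.
  intros h k t x B Hh Hk Hc HB H1 H2 H3; generalize (H h k t x B Hh Hk Hc HB H1 H2 H3); nra.
Qed.

(** The difference quotients of a solution solve the system obtained from that
    of the differences; Gronwall bounds them uniformly, and then shows that
    they are Cauchy as the step tends to 0. *)
Lemma space_derivative_exists (I : Type) (l : list I) (c : I -> R) (U G : I -> R -> R -> R)
  (U0 U0' : I -> R -> R) :
  (forall i, In i l) -> (forall i, Rabs (c i) <= 1) ->
  (forall i, cont (U i)) -> (forall i, cont (G i)) -> (forall i, tame U (G i)) ->
  (forall i y, is_derive (U0 i) y (U0' i y)) -> (forall i y, continuity_pt (U0' i) y) ->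
  (forall i t x, 0 <= t -> U i t x = U0 i (x - c i * t) + Ich (c i) (G i) t x) ->
  exists Y : I -> R -> R -> R, forall i, cont (Y i) /\
    forall t x, 0 <= t -> is_Dx (U i) t x (Y i t x).
Proof.
intros Hl Hc HU HG HT HD HD' HM.
set (V0 := fun i (_ : R) y => U0 i y).
assert (HV0 : forall X i, exists C, 0 <= C /\ dq_control U (V0 i) X 0 C).
{ intros X i; apply (dq_control_known I U (V0 i) (fun _ y => U0' i y)).
  - intros t x _; apply HD.
  - apply (cont_comp1 (U0' i) (fun _ x => x)); auto using cont_space. }
assert (Hconst : forall X, exists K, 0 < K /\ forall i,
   dq_control U (G i) X K K /\ dq_control U (V0 i) X 0 K).
{ intros X.
  destruct (list_upper_bound I (fun i K => dq_control U (G i) X K K /\ dq_control U (V0 i) X 0 K) l)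
    as [K HK].
  - intros i M M' HMM [H1 H2]; split; [apply dq_control_weaken with M M|apply dq_control_weaken with 0 M];
    auto; lra.
  - intros i; destruct (HT i X) as [L [C [HL [HC H1]]]], (HV0 X i) as [C' [HC' H2]].
    exists (L + C + C'); split; [apply dq_control_weaken with L C|apply dq_control_weaken with 0 C'];
    auto; lra.
  - exists (Rabs K + 1); split; [generalize (Rabs_pos K); lra|]; intros i.
    destruct (HK i (Hl i)) as [H1 H2]; generalize (Rle_abs K); intros.
    split; [apply dq_control_weaken with K K|apply dq_control_weaken with 0 K]; auto; lra. }
assert (Hdom : forall X t x, cone X t x -> 0 <= t <= X) by (intros X t x Hx; apply cone_box in Hx; lra).
assert (Hback : forall X i t x s, cone X t x -> 0 <= s <= t -> cone X s (x - c i * (t - s))).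
{ intros; apply cone_char; auto. }
assert (Hback0 : forall X i t x, cone X t x -> cone X 0 (x - c i * t)).
{ intros X i t x Hx; replace (x - c i * t) with (x - c i * (t - 0)) by ring.
  apply Hback; auto; generalize (Hdom _ _ _ Hx); lra. }
assert (Hmild : forall i h t x, 0 <= t -> h <> 0 ->
  dq (U i) h t x = dq (V0 i) h 0 (x - c i * t) + Ich (c i) (dq (G i) h) t x).
{ intros i h t x Ht Hh; apply dq_mild; auto. }
assert (Hbd : forall X (f : I -> R -> R -> R), (forall i, cont (f i)) -> exists M, forall i t x, cone X t x -> Rabs (f i t x) <= M).
{ intros X f Hf.
  destruct (list_upper_bound I (fun i M => forall t x, cone X t x -> Rabs (f i t x) <= M) l) as [M HMb].
  - intros i M M' HMM H t x Hx; specialize (H t x Hx); lra.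
  - intros i; destruct (cont_bounded (f i) X X (Hf i)) as [M [_ H]]; exists M.
    intros t x Hx; apply cone_box in Hx; apply H; lra.
  - exists M; intros i; apply HMb, Hl. }
assert (Hbound : forall X, exists M, forall i h t x, 0 < Rabs h < 1 -> cone X t x ->
   Rabs (dq (U i) h t x) <= M).
{ intros X; destruct (Hconst X) as [K [HK HKc]].
  exists (2 * (K + X * K) * exp (2 * K * X)).
  intros i h t x Hh Hx.
  destruct (Hbd X (fun i => dq (U i) h)) as [M HMb]; [intros; apply cont_dq; auto|].
  assert (Hx' := Hdom _ _ _ Hx).
  eapply Rle_trans; [apply (gronwall I c (cone X) (fun i => dq (U i) h) (fun i => dq (G i) h)
    K K K X M); try lra; auto|].
  - intros; apply cont_dq; auto.
  - exact (Hdom X).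
  - intros j s y Hy; rewrite Hmild by (try (apply Rabs_pos_neq); generalize (Hdom _ _ _ Hy); lra).
    eapply Rle_trans; [apply Rabs_triang|]; apply Rplus_le_compat_r.
    destruct (HKc j) as [_ [H1 _]].
    replace K with (0 * M + K) by ring; apply H1; auto.
    apply Rle_trans with (2 := HMb j s y Hy), Rabs_pos.
  - intros j s y B Hy HB; destruct (HKc j) as [[H1 _] _]; apply H1; auto.
    apply Rle_trans with (2 := HB j), Rabs_pos.
  - apply Rmult_le_compat_l; [nra|]; apply exp_mono; nra. }
assert (Hcauchy : forall X e, 0 < e -> exists d, 0 < d /\ forall i h k t x,
   0 < Rabs h < d -> 0 < Rabs k < d -> cone X t x -> Rabs (dq (U i) h t x - dq (U i) k t x) <= e).
{ intros X e He; destruct (Hconst X) as [K [HK HKc]], (Hbound X) as [M HMb].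
  set (A := 2 * (1 + Rabs X) * exp (2 * K * Rabs X)).
  assert (HA : 0 < A).
  { unfold A; generalize (Rabs_pos X) (exp_pos (2 * K * Rabs X)); intros.
    apply Rmult_lt_0_compat; lra. }
  set (e' := e / A); assert (He' : 0 < e') by (apply Rdiv_lt_0_compat; lra).
  destruct (list_lower_bound I (fun i d => forall h k t x B,
     0 < Rabs h < d -> 0 < Rabs k < d -> cone X t x -> 0 <= B ->
     (forall j, Rabs (dq (U j) h t x) <= M) -> (forall j, Rabs (dq (U j) k t x) <= M) ->
     (forall j, Rabs (dq (U j) h t x - dq (U j) k t x) <= B) ->
     Rabs (dq (G i) h t x - dq (G i) k t x) <= K * B + e' /\
     Rabs (dq (V0 i) h t x - dq (V0 i) k t x) <= e') l) as [d [Hd Hdl]].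
  - intros i d d' Hdd H h k t x B Hh Hk; apply H; lra.
  - intros i; destruct (HKc i) as [[_ H1] [_ H2]].
    destruct (H1 M e' He') as [d1 [Hd1 H1']], (H2 M e' He') as [d2 [Hd2 H2']].
    exists (Rmin d1 d2); split; [apply Rmin_glb_lt; auto|].
    assert (Hm1 := Rmin_l d1 d2); assert (Hm2 := Rmin_r d1 d2).
    intros h k t x B Hh Hk Hx HB K1 K2 K3; split; [apply H1'; auto; lra|].
    replace e' with (0 * B + e') by ring; apply H2'; auto; lra.
  - exists (Rmin d 1); split; [apply Rmin_glb_lt; lra|].
    assert (Hm1 := Rmin_l d 1); assert (Hm2 := Rmin_r d 1).
    intros i h k t x Hh Hk Hx.
    assert (Hx' := Hdom _ _ _ Hx).
    assert (HdM : forall j s y, cone X s y -> Rabs (dq (U j) h s y - dq (U j) k s y) <= 2 * M).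
    { intros j s y Hy; eapply Rle_trans; [apply Rabs_triang|]; rewrite Rabs_Ropp.
      generalize (HMb j h s y ltac:(lra) Hy) (HMb j k s y ltac:(lra) Hy); lra. }
    eapply Rle_trans; [apply (gronwall I c (cone X) (fun i t x => dq (U i) h t x - dq (U i) k t x)
      (fun i t x => dq (G i) h t x - dq (G i) k t x) K e' e' X (2 * M)); try lra; auto|].
    + intros; apply cont_minus; apply cont_dq; auto.
    + exact (Hdom X).
    + intros j s y Hy; assert (Hy' := Hdom _ _ _ Hy).
      rewrite !Hmild by (try (apply Rabs_pos_neq); lra).
      rewrite Ich_minus by (apply cont_dq; auto).
      replace (_ - _) with ((dq (V0 j) h 0 (y - c j * s) - dq (V0 j) k 0 (y - c j * s)) +
        (Ich (c j) (dq (G j) h) s y - Ich (c j) (dq (G j) k) s y)) by ring.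
      eapply Rle_trans; [apply Rabs_triang|]; apply Rplus_le_compat_r.
      assert (Hy0 := Hback0 X j s y Hy).
      apply (Hdl j (Hl j) h k 0 (y - c j * s) (2 * M)); auto; try lra.
      * generalize (HMb j h s y ltac:(lra) Hy) (Rabs_pos (dq (U j) h s y)); lra.
      * intros j'; apply HMb; auto; lra.
      * intros j'; apply HMb; auto; lra.
    + intros j s y B Hy HB; apply (Hdl j (Hl j)); auto; try lra.
      * apply Rle_trans with (2 := HB j), Rabs_pos.
      * intros j'; apply HMb; auto; lra.
      * intros j'; apply HMb; auto; lra.
    + apply Rle_trans with (A * e').
      * unfold A; rewrite (Rabs_right X) by lra.
        replace (2 * (e' + X * e')) with (e' * (2 * (1 + X))) by ring.
        replace (2 * (1 + X) * exp (2 * K * X) * e') with (e' * (2 * (1 + X)) * exp (2 * K * X)) by ring.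
        apply Rmult_le_compat_l; [nra|]; apply exp_mono; nra.
      * right; unfold e'; field; lra. }
set (hn := fun n => / INR (S (S n))).
assert (Hhn0 : forall n, 0 < hn n).
{ intros n; apply Rinv_0_lt_compat, lt_0_INR; lia. }
assert (Hhn : forall d, 0 < d -> exists N, forall n, (N <= n)%nat -> 0 < Rabs (hn n) < d).
{ intros d Hd; destruct (INR_unbounded (/ d)) as [N HN]; exists N; intros n Hn.
  rewrite Rabs_right by (generalize (Hhn0 n); lra); split; auto.
  unfold hn; rewrite <- (Rinv_inv d); apply Rinv_lt_contravar.
  - apply Rmult_lt_0_compat; [apply Rinv_0_lt_compat; auto|apply lt_0_INR; lia].
  - apply Rlt_trans with (1 := HN), lt_INR; lia. }
assert (HY : forall i, cont (limf (fun n => dq (U i) (hn n))) /\ forall X e, 0 < e ->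
  exists N, forall n t x, (N <= n)%nat -> cone X t x ->
    Rabs (dq (U i) (hn n) t x - limf (fun n => dq (U i) (hn n)) t x) <= e).
{ intros i; apply uniform_limit.
  - intros; apply cont_dq; auto.
  - intros X e He; destruct (Hcauchy X e He) as [d [Hd H]], (Hhn d Hd) as [N HN].
    exists N; intros n m t x Hn Hm Hx; apply H; auto. }
exists (fun i => limf (fun n => dq (U i) (hn n))); intros i; split; [apply HY|].
intros t x Ht; set (y := limf _ t x).
apply is_derive_Reals; intros e He.
assert (Hx := in_some_cone t x Ht).
destruct (Hcauchy (Rabs x + t) (e / 4) ltac:(lra)) as [d [Hd H]].
destruct (proj2 (HY i) (Rabs x + t) (e / 4) ltac:(lra)) as [N1 HN1], (Hhn d Hd) as [N2 HN2].
exists (mkposreal d Hd); simpl; intros h Hh0 Hh.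
assert (H1 := HN1 (max N1 N2) t x ltac:(lia) Hx); fold y in H1.
assert (H2 := H i h (hn (max N1 N2)) t x (conj (Rabs_pos_lt h Hh0) Hh) (HN2 (max N1 N2) ltac:(lia)) Hx).
change ((U i t (x + h) - U i t x) / h) with (dq (U i) h t x).
replace (_ - _) with ((dq (U i) h t x - dq (U i) (hn (max N1 N2)) t x) +
   (dq (U i) (hn (max N1 N2)) t x - y)) by ring.
eapply Rle_lt_trans; [apply Rabs_triang|]; lra.
Qed.

(** * Regularity of all orders for polynomial systems *)

(** Polynomials in the unknowns and their [x]-derivatives ([Var i n] is the
    [n]-th one of the unknown [i]) with smooth coefficients, as a syntax that
    differentiation in [x] acts on. *)
Inductive expr (I : Type) : Type :=
  | Var (i : I) (n : nat)
  | Coef (f : R -> R -> R)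
  | Add (a b : expr I)
  | Mul (a b : expr I).
Arguments Var {I}. Arguments Coef {I}. Arguments Add {I}. Arguments Mul {I}.

Fixpoint eval {I} (U : I -> R -> R -> R) (e : expr I) (t x : R) : R :=
  match e with
  | Var i n => Nat.iter n Dx (U i) t x
  | Coef f => f t x
  | Add a b => eval U a t x + eval U b t x
  | Mul a b => eval U a t x * eval U b t x
  end.

Fixpoint dx {I} (e : expr I) : expr I :=
  match e with
  | Var i n => Var i (S n)
  | Coef f => Coef (Dx f)
  | Add a b => Add (dx a) (dx b)
  | Mul a b => Add (Mul (dx a) b) (Mul a (dx b))
  end.

Fixpoint of_order {I} (n : nat) (e : expr I) : Prop :=
  match e with
  | Var i m => (m <= n)%nat
  | Coef f => Cinf f
  | Add a b | Mul a b => of_order n a /\ of_order n b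
  end.

Lemma of_order_dx I n (e : expr I) : of_order n e -> of_order (S n) (dx e).
Proof.
assert (Hw : forall e : expr I, of_order n e -> of_order (S n) e).
{ induction e0; simpl; intuition. }
induction e; simpl; intuition auto using Cinf_Dx; lia.
Qed.

Lemma of_order_iter_dx I n (e : expr I) : of_order 0 e -> of_order n (Nat.iter n dx e).
Proof. intros H; induction n; simpl; auto using of_order_dx. Qed.

Lemma eval_cont I (U : I -> R -> R -> R) n e :
  (forall i j, (j <= n)%nat -> cont (Nat.iter j Dx (U i))) ->
  of_order n e -> cont (eval U e).
Proof.
intros HU; induction e; simpl; intros H; auto using Cinf_cont.
- apply cont_plus; tauto.
- apply cont_mult; tauto.
Qed.

Lemma eval_is_Dx I (U : I -> R -> R -> R) n e :
  (forall i j t x, (j <= n)%nat -> 0 <= t ->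
     is_Dx (Nat.iter j Dx (U i)) t x (Nat.iter (S j) Dx (U i) t x)) ->
  of_order n e -> forall t x, 0 <= t -> is_Dx (eval U e) t x (eval U (dx e) t x).
Proof.
intros HU; induction e; simpl; intros H t x Ht.
- apply HU; auto.
- apply Cinf_is_Dx; auto.
- apply (is_derive_plus (eval U e1 t)); [apply IHe1|apply IHe2]; tauto.
- apply is_derive_mult_R; [apply IHe1|apply IHe2]; tauto.
Qed.

(** Lower-order variables are already known to be differentiable; the difference
    quotients of those of top order are the ones to be controlled. *)
Lemma eval_tame I (U : I -> R -> R -> R) n e :
  (forall i j, (j <= n)%nat -> cont (Nat.iter j Dx (U i))) ->
  (forall i j t x, (j < n)%nat -> 0 <= t ->
     is_Dx (Nat.iter j Dx (U i)) t x (Nat.iter (S j) Dx (U i) t x)) ->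
  of_order n e -> tame (fun i => Nat.iter n Dx (U i)) (eval U e).
Proof.
intros Hc HD; induction e; simpl; intros H.
- destruct (Nat.eq_dec n0 n) as [->|Hn].
  + apply (tame_var I (fun i => Nat.iter n Dx (U i)) i).
  + apply tame_known with (Nat.iter (S n0) Dx (U i)).
    * intros; apply HD; auto; lia.
    * apply Hc; lia.
- apply tame_known with (Dx f); auto using Cinf_cont, Cinf_Dx, Cinf_is_Dx.
- apply (tame_plus I _ (eval U e1) (eval U e2)); tauto.
- apply (tame_mult I _ (eval U e1) (eval U e2)); try tauto;
  apply eval_cont with n; tauto.
Qed.

(** Each [x]-derivative of a solution solves a system of the same kind, linear
    in the derivatives of top order, so that one more derivative exists; the
    [t]-derivatives are then given by the equations. *)
Lemma polynomial_system_smooth (I : Type) (l : list I) (c : I -> R) (U : I -> R -> R -> R)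
  (U0 : I -> R -> R) (E : I -> expr I) :
  (forall i, In i l) -> (forall i, Rabs (c i) <= 1) ->
  (forall i, smooth_fun (U0 i)) -> (forall i, of_order 0 (E i)) ->
  (forall i, cont (U i)) ->
  (forall i t x, 0 <= t -> U i t x = U0 i (x - c i * t) + Ich (c i) (eval U (E i)) t x) ->
  forall i, Cinf (U i).
Proof.
intros Hl Hc HU0 HE HU HM.
assert (HU0D : forall i n y, is_derive (Derive_n (U0 i) n) y (Derive_n (U0 i) (S n) y)).
{ intros i n y; apply Derive_correct, (HU0 i (S n)). }
assert (HP : forall n,
  (forall i j, (j <= n)%nat -> cont (Nat.iter j Dx (U i))) /\
  (forall i j t x, (j < n)%nat -> 0 <= t ->
     is_Dx (Nat.iter j Dx (U i)) t x (Nat.iter (S j) Dx (U i) t x)) /\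
  (forall i t x, 0 <= t -> Nat.iter n Dx (U i) t x =
     Derive_n (U0 i) n (x - c i * t) + Ich (c i) (eval U (Nat.iter n dx (E i))) t x)).
{ induction n as [|n [A [B M]]].
  - split; [|split]; auto.
    + intros i j Hj; replace j with 0%nat by lia; apply HU.
    + intros; lia.
  - destruct (space_derivative_exists I l c (fun i => Nat.iter n Dx (U i))
      (fun i => eval U (Nat.iter n dx (E i))) (fun i => Derive_n (U0 i) n)
      (fun i => Derive_n (U0 i) (S n))) as [Y HY]; auto.
    + intros i; apply eval_cont with n; auto using of_order_iter_dx.
    + intros i; apply eval_tame; auto using of_order_iter_dx.
    + intros i y; apply continuity_pt_filterlim, (ex_derive_continuous (Derive_n (U0 i) (S n))).
      apply (HU0 i (S (S n))).
    + assert (EY : forall i t x, 0 <= t -> Y i t x = Nat.iter (S n) Dx (U i) t x).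
      { intros i t x Ht; symmetry; apply is_derive_unique, HY; auto. }
      assert (B' : forall i j t x, (j < S n)%nat -> 0 <= t ->
        is_Dx (Nat.iter j Dx (U i)) t x (Nat.iter (S j) Dx (U i) t x)).
      { intros i j t x Hj Ht; destruct (Nat.eq_dec j n) as [->|Hn].
        - rewrite <- EY by auto; apply HY; auto.
        - apply B; auto; lia. }
      assert (A' : forall i j, (j <= S n)%nat -> cont (Nat.iter j Dx (U i))).
      { intros i j Hj; destruct (Nat.eq_dec j (S n)) as [->|Hn].
        - apply cont_ext with (Y i); auto; apply HY.
        - apply A; lia. }
      split; [|split]; auto.
      intros i t x Ht.
      apply is_derive_unique, (is_derive_ext (fun y => Derive_n (U0 i) n (y - c i * t) +
          Ich (c i) (eval U (Nat.iter n dx (E i))) t y)).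
      { intros; symmetry; apply M; auto. }
      apply (is_derive_plus (fun y => Derive_n (U0 i) n (y - c i * t))).
      * rewrite <- (Rmult_1_l (Derive_n _ _ _)).
        apply (is_derive_comp_R (Derive_n (U0 i) n) (fun y => y - c i * t)); auto.
        auto_derive; auto; ring.
      * apply is_Dx_Ich.
        -- apply eval_cont with n; auto using of_order_iter_dx.
        -- apply eval_cont with (S n); auto using of_order_iter_dx, of_order_dx.
        -- intros s y Hs; apply eval_is_Dx with n; auto using of_order_iter_dx.
           intros; apply B'; auto; lia. }
assert (HC : forall k j i, Ck k (Nat.iter j Dx (U i))).
{ induction k as [|k IH]; intros j i.
  - split; auto; apply (HP j); auto.
  - assert (Hev : forall n e, of_order n e -> Ck k (eval U e)).
    { induction e; simpl; intros H; auto.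
      - apply (Ck_plus k (eval U e1) (eval U e2)); tauto.
      - apply (Ck_mult k (eval U e1) (eval U e2)); tauto. }
    split; [apply (HP j); auto|].
    exists (fun t x => eval U (Nat.iter j dx (E i)) t x + - c i * Nat.iter (S j) Dx (U i) t x),
      (Nat.iter (S j) Dx (U i)); split; [|split].
    + intros t x Ht; split; [|apply (HP (S j)); auto].
      replace (_ + _) with (eval U (Nat.iter j dx (E i)) t x - c i * Nat.iter (S j) Dx (U i) t x) by ring.
      apply (mild_is_Dt (Derive_n (U0 i) j)); auto.
      * apply (HP j).
      * intros; apply (HP (S j)); auto.
      * apply eval_cont with j; auto using of_order_iter_dx; intros; apply (HP j); auto.
      * apply (HP (S j)); auto.
    + apply Ck_plus; [apply (Hev j); auto using of_order_iter_dx|].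
      apply Ck_mult; auto using Ck_const.
    + apply IH. }
intros i k; apply (HC k 0%nat).
Qed.

(** * Uniqueness *)

(** Only a Lipschitz bound near one of the two solutions is available, since the
    other may reach the singular set of the equations.  Uniform continuity keeps
    the difference [D] small during a time step of fixed length, in which the
    bound then forces it to vanish. *)
Lemma difference_vanishes (I : Type) (l : list I) (c : I -> R) (D g : I -> R -> R -> R)
  (t1 x1 L rho : R) (Om : R -> R -> Prop) :
  Om = (fun t x => 0 <= t /\ Rabs (x - x1) + t <= t1) ->
  0 < L -> 0 < rho -> (forall i, In i l) -> (forall i, Rabs (c i) <= 1) ->
  (forall i, cont (D i)) -> (forall i, cont (g i)) ->
  (forall i x, D i 0 x = 0) ->
  (forall i t x B, Om t x -> B <= rho -> (forall j, Rabs (D j t x) <= B) ->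
     Rabs (g i t x) <= L * B) ->
  (forall i t x, Om t x ->
     (forall j s, 0 <= s <= t -> Rabs (D j s (x - c i * (t - s))) <= rho) ->
     D i t x = Ich (c i) (g i) t x) ->
  forall i t x, Om t x -> D i t x = 0.
Proof.
intros HOm HL Hrho Hl Hc HDc Hgc HD0 Hlip Hmild.
assert (Hbox : forall t x, Om t x -> 0 <= t <= t1 /\ Rabs x <= Rabs x1 + t1).
{ intros t x H; rewrite HOm in H; generalize (Rabs_pos (x - x1)); intros.
  split; [lra|]; apply Rabs_sub_bound with x1; lra. }
assert (Hback : forall i t x s, Om t x -> 0 <= s <= t -> Om s (x - c i * (t - s))).
{ intros i t x s H Hs; rewrite HOm in *; split; [lra|].
  destruct (cone_char (c i) t1 t (x - x1) s (Hc i)) as [_ H1]; auto.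
  replace (x - c i * (t - s) - x1) with (x - x1 - c i * (t - s)) by ring; auto. }
destruct (list_lower_bound I (fun i d => forall t x s, Om t x -> 0 <= s <= t -> t - s < d ->
   Rabs (D i t x - D i s x) < rho) l) as [d [Hd HdD]].
{ intros i d d' Hdd H t x s Ht Hs Hts; apply H; auto; lra. }
{ intros i; destruct (cont_ucont (D i) t1 (Rabs x1 + t1) rho (HDc i) Hrho) as [d [Hd H]].
  exists d; split; auto; intros t x s Ht Hs Hts; apply Hbox in Ht.
  apply H; try lra.
  - rewrite Rabs_right; lra.
  - rewrite Rminus_diag, Rabs_R0; lra. }
set (h := d / 2).
assert (Hn : forall n i t x, Om t x -> t <= INR n * h -> D i t x = 0).
{ induction n as [|n IH]; intros i t x Ht Hth.
  - simpl in Hth; destruct (Hbox t x Ht); replace t with 0 by lra; apply HD0.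
  - assert (Hsmall : forall j s y, Om s y -> s <= INR (S n) * h -> Rabs (D j s y) <= rho).
    { intros j s y Hs Hsh; rewrite S_INR in Hsh; destruct (Hbox s y Hs) as [Hb _].
      assert (Hnh : 0 <= INR n * h) by (apply Rmult_le_pos; [apply pos_INR|unfold h; lra]).
      destruct (Rle_dec s (INR n * h)) as [H|H].
      - rewrite (IH j s y Hs H), Rabs_R0; lra.
      - replace (D j s y) with (D j s y - D j (INR n * h) y).
        + left; apply HdD; auto; [lra|unfold h in *; lra].
        + rewrite (IH j (INR n * h) y); [ring| |lra].
          rewrite HOm in *; lra. }
    apply Rabs_eq_0.
    apply Rle_antisym; [|apply Rabs_pos].
    set (Om' := fun t x => Om t x /\ t <= INR (S n) * h).
    eapply Rle_trans; [apply (gronwall I c Om' D g L 0 0 t1 rho); auto; try lra|].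
    + intros s y [Hs _]; apply Hbox in Hs; lra.
    + intros j s y r [Hs Hsh] Hr; split; [apply Hback; auto|lra].
    + intros j s y [Hs Hsh]; rewrite (Hmild j s y Hs); [lra|].
      intros k r Hr; apply Hsmall; [apply Hback; auto|lra].
    + intros j s y B [Hs Hsh] HB; rewrite Rplus_0_r.
      destruct (Rle_dec B rho) as [Hle|Hle]; [apply Hlip; auto|].
      apply Rle_trans with (L * rho); [|apply Rmult_le_compat_l; lra].
      apply Hlip; auto; lra.
    + intros j s y [Hs Hsh]; apply Hsmall; auto.
    + split; auto.
    + rewrite Rmult_0_r, Rplus_0_r, Rmult_0_r, Rmult_0_l; lra. }
intros i t x Ht.
destruct (INR_unbounded (t / h)) as [n Hnt].
apply (Hn n); auto; left.
assert (Hh : 0 < h) by (unfold h; lra).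
apply Rmult_lt_reg_r with (/ h); [apply Rinv_0_lt_compat; auto|].
replace (INR n * h * / h) with (INR n) by (field; lra); exact Hnt.
Qed.

(** * The 1-soliton *)

(** A relation and not a function, so that the derivative of an explicit formula
    is produced by the rules below; [s] is [1] or [-1], the null directions. *)
Definition isD (s : R) (f : R -> R -> R) (t x l : R) : Prop :=
  exists a b, is_Dt f t x a /\ is_Dx f t x b /\ l = a + s * b.

Lemma isD_unique s f t x l l' : 0 <= t -> isD s f t x l -> isD s f t x l' -> l = l'.
Proof.
intros Ht [a [b [Ha [Hb ->]]]] [a' [b' [Ha' [Hb' ->]]]].
rewrite <- (is_Dt_unique _ _ _ _ Ht Ha), <- (is_Dt_unique _ _ _ _ Ht Ha').
rewrite <- (is_derive_unique _ _ _ Hb), <- (is_derive_unique _ _ _ Hb'); auto.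
Qed.

Lemma isD_ext s f g t x l :
  0 <= t -> (forall t x, 0 <= t -> f t x = g t x) -> isD s f t x l -> isD s g t x l.
Proof.
intros Ht H [a [b [Ha [Hb E]]]]; exists a, b; split; [|split]; auto.
- apply is_Dt_ext with f; auto.
- apply is_Dx_ext with f; auto.
Qed.

Lemma isD_Cinf s f t x : Cinf f -> 0 <= t -> isD s f t x (Dt f t x + s * Dx f t x).
Proof.
intros Hf Ht; exists (Dt f t x), (Dx f t x); split; [|split]; auto using Cinf_is_Dt, Cinf_is_Dx.
Qed.

Lemma isD_const s c t x : 0 <= t -> isD s (fun _ _ => c) t x 0.
Proof.
intros Ht; exists 0, 0; split; [apply is_Dt_const; auto|split; [|ring]].
apply is_derive_Reals, derivable_pt_lim_const.
Qed.

Lemma isD_plus s f g t x a b : 0 <= t -> isD s f t x a -> isD s g t x b ->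
  isD s (fun t x => f t x + g t x) t x (a + b).
Proof.
intros Ht [a1 [a2 [H1 [H2 ->]]]] [b1 [b2 [H3 [H4 ->]]]].
exists (a1 + b1), (a2 + b2); split; [apply is_Dt_plus; auto|split; [|ring]].
apply (is_derive_plus (f t) (g t)); auto.
Qed.

Lemma isD_mult s f g t x a b : 0 <= t -> isD s f t x a -> isD s g t x b ->
  isD s (fun t x => f t x * g t x) t x (a * g t x + f t x * b).
Proof.
intros Ht [a1 [a2 [H1 [H2 ->]]]] [b1 [b2 [H3 [H4 ->]]]].
exists (a1 * g t x + f t x * b1), (a2 * g t x + f t x * b2).
split; [apply is_Dt_mult; auto|split; [|ring]].
apply is_derive_mult_R; auto.
Qed.

Lemma isD_comp s (h : R -> R) f t x dh a : 0 <= t -> is_derive h (f t x) dh -> isD s f t x a ->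
  isD s (fun t x => h (f t x)) t x (a * dh).
Proof.
intros Ht Hh [a1 [a2 [H1 [H2 ->]]]].
exists (a1 * dh), (a2 * dh); split; [apply is_Dt_comp; auto|split; [|ring]].
apply (is_derive_comp_R h (f t)); auto.
Qed.

Lemma isD_minus s f g t x a b : 0 <= t -> isD s f t x a -> isD s g t x b ->
  isD s (fun t x => f t x - g t x) t x (a - b).
Proof.
intros Ht Ha Hb.
replace (a - b) with (a + (0 * g t x + -1 * b)) by ring.
apply isD_ext with (fun t x => f t x + -1 * g t x); [auto|intros; ring|].
apply isD_plus, isD_mult; auto using isD_const.
Qed.

Lemma isD_inv s f t x a : 0 <= t -> f t x <> 0 -> isD s f t x a ->
  isD s (fun t x => / f t x) t x (- a / (f t x * f t x)).
Proof.
intros Ht H0 Ha.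
replace (- a / (f t x * f t x)) with (a * (- 1 / (f t x * f t x))) by (field; auto).
apply isD_comp; auto; auto_derive; auto; field; auto.
Qed.

Ltac isD_auto := first
 [ match goal with H : isD ?s ?f ?t ?x _ |- isD ?s (fun u v => ?f u v) ?t ?x _ => exact H end
 | match goal with
   | |- isD _ (fun u v => @?f u v + @?g u v) _ _ _ => apply (isD_plus _ f g); [assumption|isD_auto|isD_auto]
   | |- isD _ (fun u v => @?f u v - @?g u v) _ _ _ => apply (isD_minus _ f g); [assumption|isD_auto|isD_auto]
   | |- isD _ (fun u v => @?f u v * @?g u v) _ _ _ => apply (isD_mult _ f g); [assumption|isD_auto|isD_auto]
   | |- isD _ (fun u v => @?f u v / @?g u v) _ _ _ =>
       apply (isD_mult _ f (fun t x => / g t x)); [assumption|isD_auto|isD_auto]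
   | |- isD _ (fun u v => / @?f u v) _ _ _ => apply (isD_inv _ f); [assumption| |isD_auto]
   | |- isD _ (fun u v => sinh (@?f u v)) _ _ _ =>
       apply (isD_comp _ sinh f); [assumption|apply is_derive_Reals, derivable_pt_lim_sinh|isD_auto]
   | |- isD _ (fun u v => cosh (@?f u v)) _ _ _ =>
       apply (isD_comp _ cosh f); [assumption|apply is_derive_Reals, derivable_pt_lim_cosh|isD_auto]
   | |- isD _ (fun u v => sin (@?f u v)) _ _ _ =>
       apply (isD_comp _ sin f); [assumption|apply is_derive_sin|isD_auto]
   | |- isD _ (fun u v => cos (@?f u v)) _ _ _ =>
       apply (isD_comp _ cos f); [assumption|apply is_derive_cos|isD_auto]
   | |- isD _ (fun _ _ => _) _ _ _ => apply isD_const; assumption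
   end ].


(** The null derivatives of [ln alpha], the only quantities through which the
    background enters the equations. *)
Definition rlog (alpha : R -> R -> R) (s t x : R) : R := (Dt alpha t x + s * Dx alpha t x) / alpha t x.

Definition kappa (s m : R) : R := (1 + 2 * s * m + m * m) / (1 - m * m).

(** What the soliton formulas need to know of [alpha] and [m]: along the two
    null directions [log m] moves proportionally to [log alpha], with
    coefficients [(1 + m) / (1 - m)] and its inverse. *)
Definition soliton_frame (alpha m : R -> R -> R) : Prop :=
  Cinf alpha /\ Cinf m /\ (forall t x, 0 <= t -> wave_at alpha t x) /\
  (forall t x, 0 <= t -> 0 < alpha t x) /\ (forall t x, 0 <= t -> 0 < m t x < 1) /\
  (forall s t x, s * s = 1 -> 0 <= t ->
     isD s m t x (kappa s (m t x) * rlog alpha s t x * m t x)).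

Lemma isD_Rpower s f d t x a : 0 <= t -> 0 < f t x -> isD s f t x (a * f t x) ->
  isD s (fun t x => Rpower (f t x) d) t x (d * a * Rpower (f t x) d).
Proof.
intros Ht H0 Ha.
replace (d * a * Rpower (f t x) d) with (a * f t x * (d * / f t x * exp (d * ln (f t x)))).
2:{ unfold Rpower; field; lra. }
apply (isD_comp s (fun y => Rpower y d)); auto.
unfold Rpower; auto_derive; auto; ring.
Qed.

Lemma rlog_isD alpha s t x : Cinf alpha -> 0 <= t -> 0 < alpha t x ->
  isD s alpha t x (rlog alpha s t x * alpha t x).
Proof.
intros Ha Ht H0; unfold rlog.
replace (_ / _ * _) with (Dt alpha t x + s * Dx alpha t x) by (field; lra).
apply isD_Cinf; auto.
Qed.

(** The wave operator is the product of the two null derivatives. *)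
Lemma isD_transversal f s t x : Cinf f -> 0 <= t -> s * s = 1 ->
  isD (- s) (fun t x => Dt f t x + s * Dx f t x) t x (Dt (Dt f) t x - Dx (Dx f) t x).
Proof.
intros Hf Ht Hs.
assert (H1 := isD_Cinf (- s) (Dt f) t x (Cinf_Dt _ Hf) Ht).
assert (H2 := isD_Cinf (- s) (Dx f) t x (Cinf_Dx _ Hf) Ht).
assert (H : exists l, isD (- s) (fun t x => Dt f t x + s * Dx f t x) t x l /\
   l = Dt (Dt f) t x - Dx (Dx f) t x).
{ eexists; split; [isD_auto|]; cbv beta.
  rewrite (Dt_Dx_comm f t x) by auto.
  replace (Dt (Dt f) t x + - s * Dx (Dt f) t x + (0 * Dx f t x + s * (Dx (Dt f) t x + - s * Dx (Dx f) t x)))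
    with (Dt (Dt f) t x - s * s * Dx (Dx f) t x) by ring.
  rewrite Hs; ring. }
destruct H as [l [H E]]; rewrite <- E; auto.
Qed.

Lemma rlog_transversal alpha s t x :
  Cinf alpha -> wave_at alpha t x -> 0 <= t -> s * s = 1 -> 0 < alpha t x ->
  isD (- s) (rlog alpha s) t x (- (rlog alpha s t x * rlog alpha (- s) t x)).
Proof.
intros Ha Hw Ht Hs H0.
assert (H1 := isD_transversal alpha s t x Ha Ht Hs); rewrite Hw in H1.
assert (H2 := rlog_isD alpha (- s) t x Ha Ht H0).
assert (H : exists l, isD (- s) (fun t x => (Dt alpha t x + s * Dx alpha t x) / alpha t x) t x l /\
   l = - (rlog alpha s t x * rlog alpha (- s) t x)).
{ eexists; split.
  - apply (isD_mult _ (fun t x => Dt alpha t x + s * Dx alpha t x) (fun t x => / alpha t x)); auto.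
    + exact H1.
    + isD_auto; lra.
  - cbv beta; unfold rlog; field; lra. }
destruct H as [l [H E]]; rewrite <- E; auto.
Qed.

(** Entries of [g^(1) / alpha], with [a = alpha^d] and [p = m^d].  This matrix has
    determinant 1: it is a point of the hyperbolic plane [G11 G22 - G12^2 = 1]. *)
Definition G11 a p m := a * (m * m * (p * p) + 1) / (m * (p * p + 1)).
Definition G22 a p m := (p * p + m * m) / (a * m * (p * p + 1)).
Definition G12 p m := p * (1 - m * m) / (m * (p * p + 1)).

(** Derivatives of these along [d_t + s d_x], divided by [rlog alpha s]; here
    [k = kappa s m]. *)
Definition dG11 d k a p m :=
  a / (m * (p * p + 1)) * (d * (m * m * (p * p) + 1)
    - 2 * d * k * (1 - m * m) * (p * p) / (p * p + 1) + k * (m * m * (p * p) - 1)).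
Definition dG22 d k a p m :=
  1 / (a * m * (p * p + 1)) * (- d * (p * p + m * m)
    + 2 * d * k * (1 - m * m) * (p * p) / (p * p + 1) + k * (m * m - p * p)).
Definition dG12 d k p m :=
  p / (m * (p * p + 1)) * (d * k * (1 - m * m) * (1 - p * p) / (p * p + 1) - k * (1 + m * m)).

Lemma soliton_first_derivatives d alpha m s t x :
  soliton_frame alpha m -> s * s = 1 -> 0 <= t ->
  let A := fun t x => Rpower (alpha t x) d in
  let P := fun t x => Rpower (m t x) d in
  let k := kappa s (m t x) in let r := rlog alpha s t x in
  isD s (fun t x => G11 (A t x) (P t x) (m t x)) t x (r * dG11 d k (A t x) (P t x) (m t x)) /\
  isD s (fun t x => G22 (A t x) (P t x) (m t x)) t x (r * dG22 d k (A t x) (P t x) (m t x)) /\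
  isD s (fun t x => G12 (P t x) (m t x)) t x (r * dG12 d k (P t x) (m t x)).
Proof.
intros [Ha [Hm [Hw [Ha0 [Hm0 HmD]]]]] Hs Ht A P k r.
assert (HA : isD s A t x (d * r * A t x)).
{ apply isD_Rpower; auto; apply rlog_isD; auto. }
assert (HP : isD s P t x (d * (k * r) * P t x)).
{ apply isD_Rpower; auto; apply Hm0; auto. }
assert (HM : isD s m t x (k * r * m t x)) by (apply HmD; auto).
assert (HA0 : 0 < A t x) by apply exp_pos.
assert (HP0 : 0 < P t x) by apply exp_pos.
specialize (Hm0 t x Ht).
unfold G11, G22, G12.
assert (HPP : 0 < P t x * P t x) by (apply Rmult_lt_0_compat; auto).
assert (Hmm : m t x * m t x < 1) by nra.
assert (Hne : m t x * (P t x * P t x + 1) <> 0) by (apply Rgt_not_eq, Rmult_lt_0_compat; lra).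
assert (Hne2 : A t x * m t x * (P t x * P t x + 1) <> 0).
{ apply Rgt_not_eq, Rmult_lt_0_compat; [apply Rmult_lt_0_compat|]; lra. }
assert (HH : forall f l, (exists l', isD s f t x l' /\ l' = l) -> isD s f t x l).
{ intros f l [l' [H ->]]; auto. }
split; [|split]; apply HH; eexists; (split; [isD_auto; auto|]);
  unfold dG11, dG22, dG12; field; repeat split; lra.
Qed.

(** [tanh (ln p)]. *)
Definition tanh_ln p := (p * p - 1) / (p * p + 1).
Definition null_square d k p := d * d + 2 * d * tanh_ln p * k + k * k.
Definition null_product d k1 k2 p :=
  d * d * (1 - 8 * (p * p) / ((p * p + 1) * (p * p + 1))) + d * tanh_ln p * (k1 + k2) + k1 * k2.

(** Squared length and scalar product of the two null derivatives of the
    soliton, in the hyperbolic metric [dG12^2 - dG11 dG22]. *)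
Lemma null_square_eq d s a p m : s * s = 1 -> 0 < a -> 0 < p -> 0 < m < 1 ->
  let k := kappa s m in
  dG12 d k p m * dG12 d k p m - dG11 d k a p m * dG22 d k a p m = null_square d k p.
Proof.
intros Hs Ha Hp Hm.
assert (Hs' : s = 1 \/ s = -1).
{ assert (H : (s - 1) * (s + 1) = 0) by lra.
  apply Rmult_integral in H; lra. }
unfold kappa, dG12, dG11, dG22, null_square, tanh_ln; destruct Hs' as [-> | ->]; field;
repeat split; try lra; nra.
Qed.

Lemma null_product_eq d a p m : 0 < a -> 0 < p -> 0 < m < 1 ->
  let k1 := kappa 1 m in let k2 := kappa (-1) m in
  dG12 d k1 p m * dG12 d k2 p m - (dG11 d k1 a p m * dG22 d k2 a p m + dG11 d k2 a p m * dG22 d k1 a p m) / 2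
  = null_product d k1 k2 p.
Proof.
intros Ha Hp Hm; unfold kappa, dG12, dG11, dG22, null_product, tanh_ln; field.
repeat split; try lra; nra.
Qed.

(** The wave map equation in the hyperboloid model,
    [d_- d_+ G = - (r d_- G + s d_+ G) / 2 + <d_+ G, d_- G> G] with
    [r = d_+ ln alpha] and [s = d_- ln alpha]; there it is an identity between
    rational functions of [a], [p], [m]. *)
Lemma soliton_second_derivatives d alpha m t x :
  soliton_frame alpha m -> 0 <= t ->
  let A := fun t x => Rpower (alpha t x) d in
  let P := fun t x => Rpower (m t x) d in
  let r := rlog alpha 1 t x in let s := rlog alpha (-1) t x in
  let k1 := kappa 1 (m t x) in let k2 := kappa (-1) (m t x) in
  let K := null_product d k1 k2 (P t x) in
  isD (-1) (fun t x => rlog alpha 1 t x * dG11 d (kappa 1 (m t x)) (A t x) (P t x) (m t x)) t x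
    (r * s * (G11 (A t x) (P t x) (m t x) * K
      - (dG11 d k1 (A t x) (P t x) (m t x) + dG11 d k2 (A t x) (P t x) (m t x)) / 2)) /\
  isD (-1) (fun t x => rlog alpha 1 t x * dG22 d (kappa 1 (m t x)) (A t x) (P t x) (m t x)) t x
    (r * s * (G22 (A t x) (P t x) (m t x) * K
      - (dG22 d k1 (A t x) (P t x) (m t x) + dG22 d k2 (A t x) (P t x) (m t x)) / 2)) /\
  isD (-1) (fun t x => rlog alpha 1 t x * dG12 d (kappa 1 (m t x)) (P t x) (m t x)) t x
    (r * s * (G12 (P t x) (m t x) * K
      - (dG12 d k1 (P t x) (m t x) + dG12 d k2 (P t x) (m t x)) / 2)).
Proof.
intros [Ha [Hm [Hw [Ha0 [Hm0 HmD]]]]] Ht A P r s k1 k2 K.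
assert (HA : isD (-1) A t x (d * s * A t x)).
{ apply isD_Rpower; auto; apply rlog_isD; auto. }
assert (HP : isD (-1) P t x (d * (k2 * s) * P t x)).
{ apply isD_Rpower; auto; [apply Hm0; auto|apply HmD; auto; ring]. }
assert (HM : isD (-1) m t x (k2 * s * m t x)) by (apply HmD; auto; ring).
assert (HR : isD (-1) (rlog alpha 1) t x (- (r * s))).
{ replace (-1) with (- (1)) by ring; unfold s; replace (-1) with (- (1)) by ring.
  apply rlog_transversal; auto; ring. }
assert (HA0 : 0 < A t x) by apply exp_pos.
assert (HP0 : 0 < P t x) by apply exp_pos.
specialize (Hm0 t x Ht).
assert (HPP : 0 < P t x * P t x) by (apply Rmult_lt_0_compat; auto).
assert (Hmm : m t x * m t x < 1) by nra.
assert (Hmp : 0 < m t x * (P t x * P t x + 1)) by (apply Rmult_lt_0_compat; lra).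
assert (Hamp : 0 < A t x * m t x * (P t x * P t x + 1)).
{ apply Rmult_lt_0_compat; [apply Rmult_lt_0_compat|]; lra. }
unfold K, k1, k2 in *; clear K k1 k2.
unfold dG11, dG22, dG12, null_product, tanh_ln, G11, G22, G12, kappa in *.
assert (HH : forall f l, (exists l', isD (-1) f t x l' /\ l' = l) -> isD (-1) f t x l).
{ intros f l [l' [H ->]]; auto. }
split; [|split]; apply HH; eexists; (split; [isD_auto; lra|]);
  cbv beta; unfold r, s; field; repeat split; lra.
Qed.

Lemma cont_of_partials f ft fx :
  (forall t x, 0 <= t -> is_Dt f t x (ft t x) /\ is_Dx f t x (fx t x)) ->
  cont ft -> cont fx -> cont f.
Proof.
intros HD Hft Hfx.
apply cont_ext with (fun t x => f 0 (x - 0 * t) + Ich 0 (fun t x => ft t x + 0 * fx t x) t x).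
{ intros t x Ht; symmetry; apply transport; auto. }
apply cont_plus.
- apply cont_char; intros y; apply continuity_pt_filterlim, (ex_derive_continuous (f 0)).
  eexists; apply HD; lra.
- apply cont_Ich, cont_plus, cont_mult; auto using cont_const.
Qed.

Lemma conjugate_Cinf alpha beta : Cinf alpha -> conjugate_function alpha beta -> Cinf beta.
Proof.
intros Ha Hb [|k]; split; auto; try (apply (cont_of_partials beta (Dx alpha) (Dt alpha));
  auto using Cinf_cont, Cinf_Dx, Cinf_Dt).
exists (Dx alpha), (Dt alpha); split; [|split]; auto; [apply Cinf_Dx|apply Cinf_Dt]; auto.
Qed.

Lemma sup_gap (P : R -> R -> Prop) (f : R -> R -> R) w :
  (exists t x, P t x) ->
  Rbar_lt (Lub_Rbar (fun y => exists t x, P t x /\ y = f t x)) (Finite w) ->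
  exists del, 0 < del /\ forall t x, P t x -> f t x <= w - del.
Proof.
intros [t0 [x0 H0]] H.
destruct (Lub_Rbar_correct (fun y => exists t x, P t x /\ y = f t x)) as [Hub _].
destruct (Lub_Rbar _) as [l| |]; simpl in H; try tauto.
- exists (w - l); split; [lra|]; intros t x Ht.
  assert (Hl := Hub (f t x)); simpl in Hl.
  assert (f t x <= l) by (apply Hl; exists t, x; auto); lra.
- exfalso; apply (Hub (f t0 x0)); exists t0, x0; auto.
Qed.

(** [m = (q - sqrt (q^2 - a^2)) / a] is the root below 1 of [m + 1/m = 2 q / a]. *)
Lemma small_root q a : 0 < a < q ->
  let m := (q - sqrt (q ^ 2 - a ^ 2)) / a in 0 < m < 1 /\ a * (m * m + 1) = 2 * q * m.
Proof.
intros H m.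
assert (Hp : 0 < q ^ 2 - a ^ 2) by nra.
assert (Hs := sqrt_lt_R0 _ Hp); assert (Hss := sqrt_def _ (Rlt_le _ _ Hp)).
unfold m; set (s := sqrt (q ^ 2 - a ^ 2)) in *.
assert (H1 : s < q) by nra.
assert (H2 : q - s < a) by nra.
split.
- split; [apply Rdiv_lt_0_compat; lra|].
  apply Rmult_lt_reg_r with a; [lra|]; unfold Rdiv; rewrite Rmult_assoc, Rinv_l; lra.
- assert (Hss' : s * s = q * q - a * a) by (rewrite Hss; ring).
  assert (HM : a * ((q - s) / a) = q - s) by (field; lra).
  set (M := (q - s) / a) in *.
  apply Rmult_eq_reg_l with a; [|lra].
  replace (a * (a * (M * M + 1))) with ((a * M) * (a * M) + a * a) by ring.
  replace (a * (2 * q * M)) with (2 * q * (a * M)) by ring.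
  rewrite HM; nra.
Qed.

(** The derivatives of [m] come from [alpha (m^2 + 1) = 2 (w - beta) m], as the
    null derivatives of [beta] are plus or minus those of [alpha]. *)
Lemma soliton_frame_exists d Lambda phi alpha :
  one_soliton d Lambda phi alpha ->
  exists beta w del m,
    conjugate_function alpha beta /\ 0 < del /\
    (forall t x, 0 <= t -> alpha t x + beta t x <= w - del) /\
    soliton_frame alpha m /\
    (forall t x, 0 <= t -> alpha t x * (m t x * m t x + 1) = 2 * (w - beta t x) * m t x) /\
    Cinf phi /\
    (forall t x, 0 <= t -> 0 < Lambda t x /\
       g_coord (Lambda t x) (phi t x) (alpha t x) = g1 d (alpha t x) (m t x)).
Proof.
intros [[Ha [Hw [Ha0 _]]] [beta [w [Hb [Hw0 [Hlub [Hphi HL]]]]]]].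
apply smooth_Cinf in Ha; apply smooth_Cinf in Hphi.
assert (Hbeta := conjugate_Cinf alpha beta Ha Hb).
destruct (sup_gap (fun t x => 0 <= t) (fun t x => alpha t x + beta t x) w) as [del [Hdel Hsup]]; auto.
{ exists 0, 0; lra. }
assert (Hm : forall t x, 0 <= t -> 0 < mu w alpha beta t x / alpha t x < 1 /\
  alpha t x * (mu w alpha beta t x / alpha t x * (mu w alpha beta t x / alpha t x) + 1)
    = 2 * (w - beta t x) * (mu w alpha beta t x / alpha t x)).
{ intros t x Ht; apply small_root; specialize (Hsup t x Ht); specialize (Ha0 t x Ht); lra. }
exists beta, w, del, (fun t x => mu w alpha beta t x / alpha t x).
split; [|split; [|split; [|split; [|split; [|split]]]]]; auto.
2:{ intros t x Ht; apply Hm; auto. }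
assert (HmC : Cinf (fun t x => mu w alpha beta t x / alpha t x)).
{ apply Cinf_div; auto; [intros t x Ht; specialize (Ha0 t x Ht); lra|].
  unfold mu; apply Cinf_minus; [apply Cinf_minus; auto using Cinf_const|].
  apply Cinf_sqrt.
  - intros t x Ht; specialize (Hsup t x Ht); specialize (Ha0 t x Ht); nra.
  - apply Cinf_ext with (fun t x => (w - beta t x) * (w - beta t x) - alpha t x * alpha t x).
    { intros; ring. }
    apply Cinf_minus; apply Cinf_mult; auto; apply Cinf_minus; auto using Cinf_const. }
split; [|split; [|split; [|split; [|split]]]]; auto.
- intros t x Ht; apply Hm; auto.
- intros s t x Hs Ht.
  set (m := fun t x => mu w alpha beta t x / alpha t x) in *.
  assert (H1 := isD_Cinf s m t x HmC Ht).
  assert (H2 := isD_Cinf s alpha t x Ha Ht).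
  assert (H3 : isD s beta t x (s * (Dt alpha t x + s * Dx alpha t x))).
  { exists (Dx alpha t x), (Dt alpha t x); split; [|split]; try apply Hb; auto.
    replace (s * (Dt alpha t x + s * Dx alpha t x)) with (s * Dt alpha t x + s * s * Dx alpha t x) by ring.
    rewrite Hs; ring. }
  set (l := Dt m t x + s * Dx m t x) in *.
  set (da := Dt alpha t x + s * Dx alpha t x) in *.
  assert (HE : exists l1 l2, isD s (fun t x => alpha t x * (m t x * m t x + 1)) t x l1 /\
    isD s (fun t x => 2 * (w - beta t x) * m t x) t x l2 /\
    l1 = da * (m t x * m t x + 1) + alpha t x * (2 * m t x * l) /\
    l2 = -2 * (s * da) * m t x + 2 * (w - beta t x) * l).
  { eexists; eexists; split; [isD_auto|split; [isD_auto|split; cbv beta; ring]]. }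
  destruct HE as [l1 [l2 [E1 [E2 [E3 E4]]]]].
  assert (E : l1 = l2).
  { apply (isD_unique s (fun t x => 2 * (w - beta t x) * m t x) t x); auto.
    apply isD_ext with (fun t x => alpha t x * (m t x * m t x + 1)); auto.
    intros; apply Hm; auto. }
  rewrite E3, E4 in E.
  destruct (Hm t x Ht) as [Hm1 Hm2].
  change (mu w alpha beta t x / alpha t x) with (m t x) in *.
  cut (l = kappa s (m t x) * rlog alpha s t x * m t x).
  { intros E'; rewrite <- E'; auto. }
  unfold kappa, rlog; fold da.
  specialize (Ha0 t x Ht).
  assert (Hmm : m t x * m t x < 1) by nra.
  apply Rmult_eq_reg_r with (alpha t x * (1 - m t x * m t x)).
  2:{ apply Rgt_not_eq, Rmult_lt_0_compat; lra. }
  replace ((1 + 2 * s * m t x + m t x * m t x) / (1 - m t x * m t x) * (da / alpha t x) * m t x *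
    (alpha t x * (1 - m t x * m t x))) with ((1 + 2 * s * m t x + m t x * m t x) * da * m t x)
    by (field; lra).
  assert (E5 : da * (m t x * m t x + 1) * m t x + alpha t x * (2 * m t x * l) * m t x =
     -2 * (s * da) * m t x * m t x + l * (alpha t x * (m t x * m t x + 1))).
  { rewrite Hm2. replace (da * (m t x * m t x + 1) * m t x + alpha t x * (2 * m t x * l) * m t x) with
     ((da * (m t x * m t x + 1) + alpha t x * (2 * m t x * l)) * m t x) by ring.
    rewrite E; ring. }
  nra.
Qed.

Lemma soliton_entries d L p a m : 0 < a -> 0 < m < 1 ->
  g_coord L p a = g1 d a m ->
  cosh L + cos (2 * p) * sinh L = G11 (Rpower a d) (Rpower m d) m /\
  cosh L - cos (2 * p) * sinh L = G22 (Rpower a d) (Rpower m d) m /\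
  sin (2 * p) * sinh L = G12 (Rpower m d) m.
Proof.
intros Ha Hm H; unfold g_coord, g1 in H.
replace (- d - 1) with (- (d + 1)) in H by ring.
replace (d - 1) with (d + - (1)) in H by ring.
rewrite !Rpower_Ropp, !Rpower_plus, !Rpower_Ropp, !Rpower_1 in H by lra.
assert (HA : 0 < Rpower a d) by apply exp_pos.
assert (HP : 0 < Rpower m d) by apply exp_pos.
set (A := Rpower a d) in *; set (P := Rpower m d) in *.
unfold G11, G22, G12.
assert (HP2 : 0 < P * P + 1) by nra.
assert (HPi : 0 < P + / P) by (generalize (Rinv_0_lt_compat P HP); lra).
injection H; intros E4 E3 E2 E1.
assert (Hx : forall u v, a * u = a * v -> u = v) by (intros u v E; apply Rmult_eq_reg_l in E; lra).
split; [|split]; apply Hx.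
- rewrite E1; field; lra.
- rewrite E4; field; lra.
- rewrite E2; field; lra.
Qed.

Lemma cosh_sinh_sq x : cosh x * cosh x - sinh x * sinh x = 1.
Proof. unfold cosh, sinh; field_simplify_eq; generalize (exp_Ropp x) (exp_pos x); intros H H0.
rewrite H; field; lra. Qed.

Lemma sinh_pos x : 0 < x -> 0 < sinh x.
Proof.
intros H; unfold sinh; generalize (exp_increasing (- x) x ltac:(lra)); lra.
Qed.

Lemma cosh_ge_1 x : 1 <= cosh x.
Proof.
unfold cosh; rewrite exp_Ropp; generalize (exp_pos x); intros H.
apply Rmult_le_reg_r with (2 * exp x); [lra|].
field_simplify; [|lra]. generalize (pow2_ge_0 (exp x - 1)); nra.
Qed.

Lemma arcosh_formula L : 0 < L -> L = ln (cosh L + sqrt (cosh L * cosh L - 1)).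
Proof.
intros HL.
replace (cosh L * cosh L - 1) with (sinh L * sinh L) by (generalize (cosh_sinh_sq L); lra).
rewrite sqrt_square by (apply Rlt_le, sinh_pos; auto).
replace (cosh L + sinh L) with (exp L) by (unfold cosh, sinh; field).
rewrite ln_exp; auto.
Qed.

(** The polar form [dL^2 + 4 sinh(L)^2 dp^2] of the hyperbolic metric, and the
    components of the wave map equation in polar coordinates, extracted from
    the equations satisfied by the entries of the matrix. *)
Lemma polar_product C S c s Lp Lm fp fm :
  C * C - S * S = 1 -> c * c + s * s = 1 ->
  (C * Lp * s + 2 * S * c * fp) * (C * Lm * s + 2 * S * c * fm)
  - ((S * Lp + (C * Lp * c - 2 * S * s * fp)) * (S * Lm - (C * Lm * c - 2 * S * s * fm))
     + (S * Lm + (C * Lm * c - 2 * S * s * fm)) * (S * Lp - (C * Lp * c - 2 * S * s * fp))) / 2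
  = Lp * Lm + 4 * (S * S) * (fp * fm).
Proof.
intros HC Hc.
replace (S * S) with (C * C - 1) by lra.
replace (_ - _) with (C * C * (c * c + s * s) * Lp * Lm - (S * S) * Lp * Lm
  + 4 * (S * S) * (c * c + s * s) * fp * fm) by field.
rewrite Hc; replace (S * S) with (C * C - 1) by lra; ring.
Qed.

Lemma polar_second C S c s Lp Lm fp fm a b r q K n1 n2 y :
  C * C - S * S = 1 -> c * c + s * s = 1 -> 0 < S ->
  n1 = C * Lm * Lp + S * a + (S * Lm * Lp * c + C * a * c - C * Lp * (2 * s * fm)
        - 2 * C * Lm * s * fp - 2 * S * c * (2 * fm) * fp - 2 * S * s * b) ->
  n2 = C * Lm * Lp + S * a - (S * Lm * Lp * c + C * a * c - C * Lp * (2 * s * fm)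
        - 2 * C * Lm * s * fp - 2 * S * c * (2 * fm) * fp - 2 * S * s * b) ->
  y = S * Lm * Lp * s + C * a * s + C * Lp * (2 * c * fm)
        + 2 * C * Lm * c * fp - 2 * S * s * (2 * fm) * fp + 2 * S * c * b ->
  K = Lp * Lm + 4 * (S * S) * (fp * fm) ->
  n1 = (C + c * S) * K - (q * (S * Lp + (C * Lp * c - 2 * S * s * fp))
                        + r * (S * Lm + (C * Lm * c - 2 * S * s * fm))) / 2 ->
  n2 = (C - c * S) * K - (q * (S * Lp - (C * Lp * c - 2 * S * s * fp))
                        + r * (S * Lm - (C * Lm * c - 2 * S * s * fm))) / 2 ->
  y = s * S * K - (q * (C * Lp * s + 2 * S * c * fp) + r * (C * Lm * s + 2 * S * c * fm)) / 2 ->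
  a = - (r * Lm + q * Lp) / 2 + 4 * (S * C) * (fp * fm) /\
  b = - (r * fm + q * fp) / 2 - C / S * (Lp * fm + Lm * fp).
Proof.
intros HC Hc HS E1 E2 EY HK F1 F2 FY.
split; apply Rmult_eq_reg_l with S; try lra.
- assert (H : C * Lm * Lp + S * a = C * K - (q * (S * Lp) + r * (S * Lm)) / 2) by lra.
  rewrite HK in H; lra.
- assert (H1 : S * Lm * Lp * c + C * a * c - C * Lp * (2 * s * fm)
        - 2 * C * Lm * s * fp - 2 * S * c * (2 * fm) * fp - 2 * S * s * b =
     c * S * K - (q * (C * Lp * c - 2 * S * s * fp) + r * (C * Lm * c - 2 * S * s * fm)) / 2) by lra.
  assert (H2 := eq_trans (eq_sym EY) FY).
  assert (H3 : (c * c + s * s) * (2 * C * (fm * Lp + Lm * fp) + 2 * S * b) =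
    (c * c + s * s) * (- (q * (2 * S * fp) + r * (2 * S * fm)) / 2)).
  { transitivity (c * (S * Lm * Lp * s + C * a * s + C * Lp * (2 * c * fm)
        + 2 * C * Lm * c * fp - 2 * S * s * (2 * fm) * fp + 2 * S * c * b)
     - s * (S * Lm * Lp * c + C * a * c - C * Lp * (2 * s * fm)
        - 2 * C * Lm * s * fp - 2 * S * c * (2 * fm) * fp - 2 * S * s * b)); [ring|].
    rewrite H1, H2; field. }
  rewrite Hc, !Rmult_1_l in H3.
  replace (S * (- (r * fm + q * fp) / 2 - C / S * (Lp * fm + Lm * fp))) with
   (- (r * (S * fm) + q * (S * fp)) / 2 - C * (Lp * fm + Lm * fp)) by (field; lra).
  lra.
Qed.

Definition Dplus (f : R -> R -> R) (t x : R) : R := Dt f t x + 1 * Dx f t x.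
Definition Dminus (f : R -> R -> R) (t x : R) : R := Dt f t x + -1 * Dx f t x.
Definition box (f : R -> R -> R) (t x : R) : R := Dt (Dt f) t x - Dx (Dx f) t x.

Definition sinhcosh (u : R) : R := sinh u * cosh u.

(** The equations for [Lambda] and [phi] solved for their wave operators; the
    nonlinearities only involve products of a derivative along [d_t + d_x] and
    one along [d_t - d_x]. *)
Definition box_system (Lambda phi alpha : R -> R -> R) (t x : R) : Prop :=
  let r := rlog alpha 1 t x in let s := rlog alpha (-1) t x in
  let Lp := Dplus Lambda t x in let Lm := Dminus Lambda t x in
  let fp := Dplus phi t x in let fm := Dminus phi t x in
  box Lambda t x = - (r * Lm + s * Lp) / 2 + 4 * sinhcosh (Lambda t x) * (fp * fm) /\
  box phi t x = - (r * fm + s * fp) / 2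
    - cosh (Lambda t x) / sinh (Lambda t x) * (Lp * fm + Lm * fp).

Definition soliton_polar d (Lambda phi alpha m : R -> R -> R) : Prop :=
  Cinf Lambda /\ Cinf phi /\ (forall t x, 0 <= t -> 0 < Lambda t x) /\
  forall t x, 0 <= t ->
   let A := Rpower (alpha t x) d in let P := Rpower (m t x) d in
   cosh (Lambda t x) + cos (2 * phi t x) * sinh (Lambda t x) = G11 A P (m t x) /\
   cosh (Lambda t x) - cos (2 * phi t x) * sinh (Lambda t x) = G22 A P (m t x) /\
   sin (2 * phi t x) * sinh (Lambda t x) = G12 P (m t x).

(** [Lambda] is smooth because [cosh Lambda], a smooth function, exceeds 1. *)
Lemma soliton_is_polar d Lambda phi alpha m :
  soliton_frame alpha m -> Cinf phi ->
  (forall t x, 0 <= t -> 0 < Lambda t x /\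
       g_coord (Lambda t x) (phi t x) (alpha t x) = g1 d (alpha t x) (m t x)) ->
  soliton_polar d Lambda phi alpha m.
Proof.
intros [Ha [Hm [Hw [Ha0 [Hm0 HmD]]]]] Hphi HL.
assert (HE := fun t x (Ht : 0 <= t) => soliton_entries d _ _ _ _ (Ha0 t x Ht) (Hm0 t x Ht) (proj2 (HL t x Ht))).
split; [|split; [|split]]; auto; [|intros; apply HL; auto].
set (Z := fun t x => (G11 (Rpower (alpha t x) d) (Rpower (m t x) d) (m t x)
                    + G22 (Rpower (alpha t x) d) (Rpower (m t x) d) (m t x)) / 2).
assert (HZ : forall t x, 0 <= t -> Z t x = cosh (Lambda t x)).
{ intros t x Ht; unfold Z; destruct (HE t x Ht) as [<- [<- _]]; field. }
assert (HZC : Cinf Z).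
{ assert (HA : Cinf (fun t x => Rpower (alpha t x) d)) by (apply Cinf_Rpower; auto).
  assert (HP : Cinf (fun t x => Rpower (m t x) d)) by (apply Cinf_Rpower; auto; apply Hm0).
  assert (HPP : forall t x, 0 <= t -> 0 < m t x * (Rpower (m t x) d * Rpower (m t x) d + 1)).
  { intros t x Ht; apply Rmult_lt_0_compat; [apply Hm0; auto|].
    generalize (exp_pos (d * ln (m t x))); unfold Rpower; nra. }
  apply Cinf_div; auto using Cinf_const; try (intros; lra).
  apply Cinf_plus; apply Cinf_div;
   repeat (auto using Cinf_const; first [apply Cinf_plus|apply Cinf_mult]); auto using Cinf_const.
  - intros t x Ht; specialize (HPP t x Ht); lra.
  - intros t x Ht; specialize (HPP t x Ht).
    rewrite Rmult_assoc; apply Rgt_not_eq, Rmult_lt_0_compat; auto; apply exp_pos. }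
apply Cinf_ext with (fun t x => ln (Z t x + sqrt (Z t x * Z t x - 1))).
{ intros t x Ht; rewrite HZ by auto; symmetry; apply arcosh_formula, HL; auto. }
assert (H1 : forall t x, 0 <= t -> 0 < Z t x * Z t x - 1).
{ intros t x Ht; rewrite HZ by auto.
  replace (_ - 1) with (sinh (Lambda t x) * sinh (Lambda t x)) by (generalize (cosh_sinh_sq (Lambda t x)); lra).
  assert (H := sinh_pos _ (proj1 (HL t x Ht))); apply Rmult_lt_0_compat; auto. }
assert (H2 : Cinf (fun t x => Z t x * Z t x - 1)).
{ apply Cinf_minus; auto using Cinf_mult, Cinf_const. }
apply Cinf_ln.
- intros t x Ht; generalize (sqrt_lt_R0 _ (H1 t x Ht)); rewrite HZ by auto.
  generalize (cosh_ge_1 (Lambda t x)); lra.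
- apply Cinf_plus; auto; apply Cinf_sqrt; auto.
Qed.

Lemma soliton_null_derivatives d Lambda phi alpha m s t x :
  soliton_frame alpha m -> soliton_polar d Lambda phi alpha m -> s * s = 1 -> 0 <= t ->
  let A := Rpower (alpha t x) d in let P := Rpower (m t x) d in
  let C := cosh (Lambda t x) in let S := sinh (Lambda t x) in
  let c := cos (2 * phi t x) in let q := sin (2 * phi t x) in
  let l := Dt Lambda t x + s * Dx Lambda t x in
  let f := Dt phi t x + s * Dx phi t x in
  let r := rlog alpha s t x in let k := kappa s (m t x) in
  S * l + (C * l * c - 2 * S * q * f) = r * dG11 d k A P (m t x) /\
  S * l - (C * l * c - 2 * S * q * f) = r * dG22 d k A P (m t x) /\
  C * l * q + 2 * S * c * f = r * dG12 d k P (m t x).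
Proof.
intros HF [HL [Hphi [HL0 HE]]] Hs Ht A P C S c q l f r k.
assert (HD1 := isD_Cinf s Lambda t x HL Ht); fold l in HD1.
assert (HD2 := isD_Cinf s phi t x Hphi Ht); fold f in HD2.
destruct (soliton_first_derivatives d alpha m s t x HF Hs Ht) as [H1 [H2 H3]].
split; [|split].
- apply (isD_unique _ _ _ _ _ _ Ht) with (2 := H1).
  apply isD_ext with (fun t x => cosh (Lambda t x) + cos (2 * phi t x) * sinh (Lambda t x)); auto.
  { intros; apply HE; auto. }
  evar (z : R); replace (_ + _) with z; [unfold z; isD_auto|unfold z, C, S, c, q; ring].
- apply (isD_unique _ _ _ _ _ _ Ht) with (2 := H2).
  apply isD_ext with (fun t x => cosh (Lambda t x) - cos (2 * phi t x) * sinh (Lambda t x)); auto.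
  { intros; apply HE; auto. }
  evar (z : R); replace (_ - _) with z; [unfold z; isD_auto|unfold z, C, S, c, q; ring].
- apply (isD_unique _ _ _ _ _ _ Ht) with (2 := H3).
  apply isD_ext with (fun t x => sin (2 * phi t x) * sinh (Lambda t x)); auto.
  { intros; apply HE; auto. }
  evar (z : R); replace (_ + _) with z; [unfold z; isD_auto|unfold z, C, S, c, q; ring].
Qed.

(** The speed of the soliton in a null direction is that of [log alpha], up to
    the factor [d + kappa]: the exact one is [d^2 + 2 d kappa tanh (ln p) + kappa^2]
    for the squares. *)
Lemma soliton_speed d Lambda phi alpha m s t x :
  1 <= d -> soliton_frame alpha m -> soliton_polar d Lambda phi alpha m -> s * s = 1 -> 0 <= t ->
  let l := Dt Lambda t x + s * Dx Lambda t x in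
  let f := Dt phi t x + s * Dx phi t x in
  l * l + 4 * (sinh (Lambda t x) * sinh (Lambda t x)) * (f * f) <=
  (rlog alpha s t x * (d + kappa s (m t x))) ^ 2.
Proof.
intros Hd HF HP Hs Ht l f.
destruct (soliton_null_derivatives d Lambda phi alpha m s t x HF HP Hs Ht) as [E1 [E2 E3]].
fold l f in E1, E2, E3.
set (C := cosh (Lambda t x)) in *; set (S := sinh (Lambda t x)) in *.
set (c := cos (2 * phi t x)) in *; set (q := sin (2 * phi t x)) in *.
assert (HC : C * C - S * S = 1) by apply cosh_sinh_sq.
assert (Hc : c * c + q * q = 1).
{ generalize (sin2_cos2 (2 * phi t x)); unfold Rsqr, c, q; lra. }
assert (HH := polar_product C S c q l l f f HC Hc).
rewrite E1, E2, E3 in HH.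
destruct HF as [_ [_ [_ [_ [Hm0 _]]]]]; specialize (Hm0 t x Ht).
set (k := kappa s (m t x)) in *.
set (A := Rpower (alpha t x) d) in *; set (P := Rpower (m t x) d) in *.
assert (HA : 0 < A) by apply exp_pos.
assert (HPp : 0 < P) by apply exp_pos.
assert (HN := null_square_eq d s A P (m t x) Hs HA HPp Hm0); fold k in HN.
replace (l * l + 4 * (S * S) * (f * f)) with
  (rlog alpha s t x * rlog alpha s t x * null_square d k P) by (rewrite <- HH, <- HN; field).
replace ((rlog alpha s t x * (d + k)) ^ 2) with (rlog alpha s t x * rlog alpha s t x * ((d + k) * (d + k))) by ring.
apply Rmult_le_compat_l; [nra|].
assert (Hk : 0 <= k).
{ unfold k, kappa; apply Rmult_le_pos.
  - assert (Hs' : (1 + s * m t x) * (1 + s * m t x) = 1 + 2 * s * m t x + m t x * m t x)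
      by (transitivity (1 + 2 * s * m t x + s * s * (m t x * m t x)); [ring|rewrite Hs; ring]).
    rewrite <- Hs'; apply Rle_0_sqr.
  - apply Rlt_le, Rinv_0_lt_compat; nra. }
assert (Hth : tanh_ln P <= 1).
{ unfold tanh_ln; apply Rmult_le_reg_r with (P * P + 1); [nra|].
  unfold Rdiv; rewrite Rmult_assoc, Rinv_l; nra. }
unfold null_square; assert (0 <= d * k) by (apply Rmult_le_pos; lra); nra.
Qed.

Lemma soliton_wave_map d Lambda phi alpha m t x :
  soliton_frame alpha m -> soliton_polar d Lambda phi alpha m -> 0 <= t ->
  box_system Lambda phi alpha t x.
Proof.
intros HF HP Ht; unfold box_system.
set (r := rlog alpha 1 t x); set (s := rlog alpha (-1) t x); set (L := Lambda t x).
set (Lp := Dplus Lambda t x); set (Lm := Dminus Lambda t x).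
set (fp := Dplus phi t x); set (fm := Dminus phi t x); cbv zeta.
assert (HN := fun s t x => soliton_null_derivatives d Lambda phi alpha m s t x HF HP).
destruct (soliton_second_derivatives d alpha m t x HF Ht) as [S1 [S2 S3]].
destruct (HN 1 t x ltac:(ring) Ht) as [P1 [P2 P3]].
destruct (HN (-1) t x ltac:(ring) Ht) as [M1 [M2 M3]].
fold (Dplus Lambda t x) (Dplus phi t x) in P1, P2, P3.
fold (Dminus Lambda t x) (Dminus phi t x) in M1, M2, M3.
fold Lp fp in P1, P2, P3; fold Lm fm in M1, M2, M3.
destruct HP as [HL [Hphi [HL0 HE]]].
assert (HE0 := HE t x Ht); cbv zeta in HE0; destruct HE0 as [E1 [E2 E3]].
fold L in E1, E2, E3, P1, P2, P3, M1, M2, M3.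
assert (HD1 : isD (-1) Lambda t x Lm) by (apply isD_Cinf; auto).
assert (HD2 : isD (-1) phi t x fm) by (apply isD_Cinf; auto).
assert (HD3 : isD (-1) (Dplus Lambda) t x (box Lambda t x)).
{ replace (-1) with (- (1)) by ring; apply isD_transversal; auto; ring. }
assert (HD4 : isD (-1) (Dplus phi) t x (box phi t x)).
{ replace (-1) with (- (1)) by ring; apply isD_transversal; auto; ring. }
destruct HF as [_ [_ [_ [_ [Hm0 _]]]]]; specialize (Hm0 t x Ht).
assert (HA : 0 < Rpower (alpha t x) d) by apply exp_pos.
assert (HPp : 0 < Rpower (m t x) d) by apply exp_pos.
assert (HK := null_product_eq d _ _ _ HA HPp Hm0).
cbv zeta in *.
set (A := Rpower (alpha t x) d) in *; set (P := Rpower (m t x) d) in *.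
set (k1 := kappa 1 (m t x)) in *; set (k2 := kappa (-1) (m t x)) in *.
fold r s in S1, S2, S3, P1, P2, P3, M1, M2, M3.
assert (HC : cosh L * cosh L - sinh L * sinh L = 1) by apply cosh_sinh_sq.
assert (Hc : cos (2 * phi t x) * cos (2 * phi t x) + sin (2 * phi t x) * sin (2 * phi t x) = 1).
{ generalize (sin2_cos2 (2 * phi t x)); unfold Rsqr; lra. }
assert (Hpol := polar_product _ _ _ _ Lp Lm fp fm HC Hc).
rewrite P1, P2, P3, M1, M2, M3 in Hpol.
assert (HK' : r * s * null_product d k1 k2 P = Lp * Lm + 4 * (sinh L * sinh L) * (fp * fm)).
{ rewrite <- Hpol, <- HK; field. }
refine (polar_second (cosh L) (sinh L) (cos (2 * phi t x)) (sin (2 * phi t x)) Lp Lm fp fm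
  (box Lambda t x) (box phi t x) r s (r * s * null_product d k1 k2 P) _ _ _ HC Hc _
  eq_refl eq_refl eq_refl HK' _ _ _).
- apply sinh_pos, HL0; auto.
- rewrite E1, P1, M1.
  transitivity (r * s * (G11 A P (m t x) * null_product d k1 k2 P - (dG11 d k1 A P (m t x) + dG11 d k2 A P (m t x)) / 2));
    [|field].
  symmetry; apply (isD_unique _ _ _ _ _ _ Ht S1).
  apply isD_ext with (fun t x => sinh (Lambda t x) * Dplus Lambda t x +
    (cosh (Lambda t x) * Dplus Lambda t x * cos (2 * phi t x)
     - 2 * sinh (Lambda t x) * sin (2 * phi t x) * Dplus phi t x)); auto.
  { intros t' x' Ht'; destruct (HN 1 t' x' ltac:(ring) Ht') as [H _]; exact H. }
  evar (z : R); replace (_ + _) with z; [unfold z; isD_auto|unfold z; fold L Lp fp; ring].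
- rewrite E2, P2, M2.
  transitivity (r * s * (G22 A P (m t x) * null_product d k1 k2 P - (dG22 d k1 A P (m t x) + dG22 d k2 A P (m t x)) / 2));
    [|field].
  symmetry; apply (isD_unique _ _ _ _ _ _ Ht S2).
  apply isD_ext with (fun t x => sinh (Lambda t x) * Dplus Lambda t x -
    (cosh (Lambda t x) * Dplus Lambda t x * cos (2 * phi t x)
     - 2 * sinh (Lambda t x) * sin (2 * phi t x) * Dplus phi t x)); auto.
  { intros t' x' Ht'; destruct (HN 1 t' x' ltac:(ring) Ht') as [_ [H _]]; exact H. }
  evar (z : R); replace (_ - _) with z; [unfold z; isD_auto|unfold z; fold L Lp fp; ring].
- rewrite E3, P3, M3.
  transitivity (r * s * (G12 P (m t x) * null_product d k1 k2 P - (dG12 d k1 P (m t x) + dG12 d k2 P (m t x)) / 2));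
    [|field].
  symmetry; apply (isD_unique _ _ _ _ _ _ Ht S3).
  apply isD_ext with (fun t x => cosh (Lambda t x) * Dplus Lambda t x * sin (2 * phi t x)
     + 2 * sinh (Lambda t x) * cos (2 * phi t x) * Dplus phi t x); auto.
  { intros t' x' Ht'; destruct (HN 1 t' x' ltac:(ring) Ht') as [_ [_ H]]; exact H. }
  evar (z : R); replace (_ + _) with z; [unfold z; isD_auto|unfold z; fold L Lp fp; ring].
Qed.

(** * The Einstein system in characteristic form *)

Lemma smooth_before_jet T f : smooth_before T f ->
  exists J : nat -> nat -> R -> R -> R,
   (forall i j t x, before T t ->
      is_Dt (J i j) t x (J (S i) j t x) /\ is_Dx (J i j) t x (J i (S j) t x)) /\
   (forall i j, continuous_on (fun p : R * R => before T (fst p)) (fun p => J i j (fst p) (snd p))) /\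
   J 0%nat 0%nat = f /\
   forall t x, before T t ->
     (Dt f t x = J 1%nat 0%nat t x /\ Dx f t x = J 0%nat 1%nat t x) /\
     is_Dt (Dt f) t x (J 2%nat 0%nat t x) /\ is_Dx (Dx f) t x (J 0%nat 2%nat t x).
Proof.
intros [J [HJ0 HJ]]; exists J.
assert (H1 : forall i j t x, before T t ->
  is_Dt (J i j) t x (J (S i) j t x) /\ is_Dx (J i j) t x (J i (S j) t x)).
{ intros i j t x Ht; destruct (HJ i j) as [A [B _]]; auto. }
assert (E : forall t x, before T t -> Dt f t x = J 1%nat 0%nat t x /\ Dx f t x = J 0%nat 1%nat t x).
{ intros t x Ht; rewrite <- HJ0; destruct (H1 0%nat 0%nat t x Ht) as [A B]; split.
  - apply is_Dt_unique; auto; apply Ht.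
  - apply is_derive_unique; auto. }
split; [auto|split; [intros; apply HJ|split; auto]].
intros t x Ht; split; [auto|split].
- assert (Hnear : exists e, 0 < e /\ forall s, 0 <= s -> Rabs (s - t) < e -> before T s).
  { destruct Ht as [_ Ht]; destruct T as [T| |]; simpl in Ht; try tauto.
    - exists (T - t); split; [lra|]; intros s Hs Hst; split; auto; simpl.
      apply Rabs_def2 in Hst; lra.
    - exists 1; split; [lra|]; intros s Hs _; split; simpl; auto. }
  destruct Hnear as [e [He Hn]].
  apply is_Dt_ext_loc with (J 1%nat 0%nat) e; auto; [apply Ht| |apply (H1 1%nat 0%nat t x Ht)].
  intros s Hs Hst; symmetry; apply (E s x (Hn s Hs Hst)).
- apply is_Dx_ext with (J 0%nat 1%nat); [intros y; symmetry; apply (E t y Ht)|].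
  apply (H1 0%nat 1%nat t x Ht).
Qed.

Lemma smooth_before_D T f t x : smooth_before T f -> before T t ->
  is_Dt f t x (Dt f t x) /\ is_Dx f t x (Dx f t x) /\
  is_Dt (Dt f) t x (Dt (Dt f) t x) /\ is_Dx (Dx f) t x (Dx (Dx f) t x).
Proof.
intros Hf Ht; destruct (smooth_before_jet T f Hf) as [J [HJ [_ [HJ0 HE]]]].
destruct (HE t x Ht) as [[E1 E2] [H1 H2]], (HJ 0%nat 0%nat t x Ht) as [H3 H4].
rewrite HJ0 in H3, H4.
rewrite E1, E2, (is_Dt_unique _ _ _ _ (proj1 Ht) H1), (is_derive_unique _ _ _ H2 : Dx (Dx f) t x = _).
auto.
Qed.

Lemma before_le T t s : before T t -> 0 <= s <= t -> before T s.
Proof.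
intros [_ Ht] Hs; split; [lra|]; destruct T as [T| |]; simpl in *; auto; lra.
Qed.

Lemma cont_before T t1 (f : R -> R -> R) : before T t1 ->
  continuous_on (fun p : R * R => before T (fst p)) (fun p => f (fst p) (snd p)) ->
  cont (fun s y => f (Rmin s t1) y).
Proof.
intros Ht1 Hf s x eps.
assert (Hin : forall s, 0 <= Rmin (Rmax 0 s) t1 <= t1) by (intros; apply clip_in, Ht1).
destruct (proj1 (filterlim_locally _ _) (Hf (Rmin (Rmax 0 s) t1, x)
  (before_le _ _ _ Ht1 (Hin s))) eps) as [d Hd].
exists d; intros r y Hr Hy; apply (Hd (Rmin (Rmax 0 r) t1, y)).
- split; [|exact Hy]; apply Rle_lt_trans with (2 := Hr).
  apply (clip_lip t1 r s).
- apply (before_le _ _ _ Ht1 (Hin r)).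
Qed.

(** The wave operator is the derivative of [d_t f + d_x f] along [d_t - d_x], and
    that of [d_t f - d_x f] along [d_t + d_x]. *)
Lemma null_transport T f t1 : smooth_before T f -> before T t1 ->
  cont (fun s y => f (Rmin s t1) y) /\
  cont (fun s y => Dplus f (Rmin s t1) y) /\ cont (fun s y => Dminus f (Rmin s t1) y) /\
  cont (fun s y => box f (Rmin s t1) y) /\
  forall t x, 0 <= t <= t1 ->
   f t x = f 0 (x - 0 * t) + Ich 0 (fun s y => (Dplus f (Rmin s t1) y + Dminus f (Rmin s t1) y) / 2) t x /\
   Dplus f t x = Dplus f 0 (x - -1 * t) + Ich (-1) (fun s y => box f (Rmin s t1) y) t x /\
   Dminus f t x = Dminus f 0 (x - 1 * t) + Ich 1 (fun s y => box f (Rmin s t1) y) t x.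
Proof.
intros Hf Ht1; destruct (smooth_before_jet T f Hf) as [J [HJ [HJc [HJ0 HE]]]].
assert (Ht10 : 0 <= t1) by apply Ht1.
assert (E1 : forall t x, before T t -> Dt f t x = J 1%nat 0%nat t x) by (intros; apply HE; auto).
assert (E2 : forall t x, before T t -> Dx f t x = J 0%nat 1%nat t x) by (intros; apply HE; auto).
assert (E3 : forall t x, before T t -> box f t x = J 2%nat 0%nat t x - J 0%nat 2%nat t x).
{ intros s y Hs; destruct (HE s y Hs) as [_ [H1 H2]]; unfold box.
  rewrite (is_Dt_unique _ _ _ _ (proj1 Hs) H1), (is_derive_unique _ _ _ H2 : Dx (Dx f) s y = _); auto. }
assert (Hin : forall s, 0 <= s -> before T (Rmin s t1)).
{ intros s Hs; apply before_le with (1 := Ht1); split; [apply Rmin_glb; auto|apply Rmin_r]. }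
assert (Hc : forall i j, cont (fun s y => J i j (Rmin s t1) y)).
{ intros i j; apply cont_before with T; auto. }
assert (Cp : cont (fun s y => Dplus f (Rmin s t1) y)).
{ apply cont_ext with (fun s y => J 1%nat 0%nat (Rmin s t1) y + 1 * J 0%nat 1%nat (Rmin s t1) y).
  - intros; unfold Dplus; rewrite E1, E2; auto.
  - apply cont_plus, cont_mult; auto using cont_const. }
assert (Cm : cont (fun s y => Dminus f (Rmin s t1) y)).
{ apply cont_ext with (fun s y => J 1%nat 0%nat (Rmin s t1) y + -1 * J 0%nat 1%nat (Rmin s t1) y).
  - intros; unfold Dminus; rewrite E1, E2; auto.
  - apply cont_plus, cont_mult; auto using cont_const. }
split; [|split; [|split; [|split]]]; auto.
- rewrite <- HJ0; auto.
- apply cont_ext with (fun s y => J 2%nat 0%nat (Rmin s t1) y - J 0%nat 2%nat (Rmin s t1) y).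
  + intros; rewrite E3; auto.
  + apply cont_minus; auto.
- intros t x Ht.
  assert (Hbt : forall s, 0 <= s <= t -> before T s).
  { intros s Hs; apply before_le with t1; auto; lra. }
  assert (Hct : forall i j, cont (fun s y => J i j (Rmin s t) y)).
  { intros i j; apply cont_before with T; auto; apply before_le with t1; auto. }
  assert (Hsum : forall k, cont (fun s y => J 2%nat 0%nat (Rmin s t) y + k * J 1%nat 1%nat (Rmin s t) y) /\
     cont (fun s y => J 1%nat 1%nat (Rmin s t) y + k * J 0%nat 2%nat (Rmin s t) y) /\
     forall s y, 0 <= s <= t -> is_Dt (fun s y => J 1%nat 0%nat s y + k * J 0%nat 1%nat s y) s y
       (J 2%nat 0%nat s y + k * J 1%nat 1%nat s y) /\
      is_Dx (fun s y => J 1%nat 0%nat s y + k * J 0%nat 1%nat s y) s y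
       (J 1%nat 1%nat s y + k * J 0%nat 2%nat s y)).
  { intros k; split; [|split]; try (apply cont_plus, cont_mult; auto using cont_const).
    intros s y Hs; split.
    - destruct (HJ 1%nat 0%nat s y (Hbt s Hs)) as [A1 _], (HJ 0%nat 1%nat s y (Hbt s Hs)) as [A2 _].
      replace (k * J 1%nat 1%nat s y) with (0 * J 0%nat 1%nat s y + k * J 1%nat 1%nat s y) by ring.
      apply is_Dt_plus, is_Dt_mult; auto; try lra; apply is_Dt_const; lra.
    - destruct (HJ 1%nat 0%nat s y (Hbt s Hs)) as [_ B1], (HJ 0%nat 1%nat s y (Hbt s Hs)) as [_ B2].
      exact (is_derive_plus (J 1%nat 0%nat s) (fun y => k * J 0%nat 1%nat s y) y _ _ B1
        (is_derive_scal (J 0%nat 1%nat s) y k _ B2)). }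
  split; [|split].
  + rewrite (transport_upto f (Dt f) (Dx f) t x 0); try lra.
    * f_equal; apply Ich_ext; [lra|]; intros s Hs; rewrite !Rmin_left by lra.
      unfold Dplus, Dminus; field.
    * intros s y Hs; rewrite E1, E2, <- HJ0 by auto; apply (HJ 0%nat 0%nat s y (Hbt s Hs)).
    * apply cont_ext with (fun s y => J 1%nat 0%nat (Rmin s t) y); auto.
      intros; rewrite E1; auto; apply Hbt; split; [apply Rmin_glb; lra|apply Rmin_r].
    * apply cont_ext with (fun s y => J 0%nat 1%nat (Rmin s t) y); auto.
      intros; rewrite E2; auto; apply Hbt; split; [apply Rmin_glb; lra|apply Rmin_r].
  + destruct (Hsum 1) as [H1 [H2 H3]].
    unfold Dplus at 1 2; rewrite !E1, !E2 by (apply Hbt; lra).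
    rewrite (transport_upto _ _ _ t x (-1) (proj1 Ht) H3 H1 H2).
    f_equal; apply Ich_ext; [lra|]; intros s Hs; rewrite !Rmin_left by lra.
    rewrite E3 by (apply Hbt; lra); ring.
  + destruct (Hsum (-1)) as [H1 [H2 H3]].
    unfold Dminus at 1 2; rewrite !E1, !E2 by (apply Hbt; lra).
    rewrite (transport_upto _ _ _ t x 1 (proj1 Ht) H3 H1 H2).
    f_equal; apply Ich_ext; [lra|]; intros s Hs; rewrite !Rmin_left by lra.
    rewrite E3 by (apply Hbt; lra); ring.
Qed.

Lemma is_Dx_unique f t x l : is_Dx f t x l -> Dx f t x = l.
Proof. apply is_derive_unique. Qed.

Lemma Lambda_eq_box T Lambda phi alpha t x :
  smooth_before T Lambda -> smooth_before T alpha -> before T t -> 0 < alpha t x ->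
  Lambda_eq_at Lambda phi alpha t x <->
  box Lambda t x = - (rlog alpha 1 t x * Dminus Lambda t x + rlog alpha (-1) t x * Dplus Lambda t x) / 2
    + 4 * sinhcosh (Lambda t x) * (Dplus phi t x * Dminus phi t x).
Proof.
intros HL Ha Ht H0.
destruct (smooth_before_D T Lambda t x HL Ht) as [L1 [L2 [L3 L4]]].
destruct (smooth_before_D T alpha t x Ha Ht) as [A1 [A2 _]].
unfold Lambda_eq_at.
rewrite (is_Dt_unique (fun s y => alpha s y * Dt Lambda s y) t x _ (proj1 Ht)
  (is_Dt_mult _ _ _ _ _ _ (proj1 Ht) A1 L3)).
rewrite (is_Dx_unique (fun s y => alpha s y * Dx Lambda s y) t x _ (is_derive_mult_R _ _ _ _ _ A2 L4)).
replace (sinh (2 * Lambda t x)) with (2 * sinhcosh (Lambda t x)).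
2:{ unfold sinhcosh, sinh, cosh; replace (- (2 * Lambda t x)) with (- Lambda t x + - Lambda t x) by ring.
    replace (2 * Lambda t x) with (Lambda t x + Lambda t x) by ring; rewrite !exp_plus; field. }
unfold box, rlog, Dplus, Dminus.
set (q := sinhcosh (Lambda t x)).
split; intros H.
- apply Rmult_eq_reg_l with (alpha t x); [|lra].
  transitivity (Dt alpha t x * Dt Lambda t x + alpha t x * Dt (Dt Lambda) t x -
    (Dx alpha t x * Dx Lambda t x + alpha t x * Dx (Dx Lambda) t x)
    - Dt alpha t x * Dt Lambda t x + Dx alpha t x * Dx Lambda t x); [ring|].
  rewrite H; field; lra.
- transitivity (alpha t x * (Dt (Dt Lambda) t x - Dx (Dx Lambda) t x) +
    (Dt alpha t x * Dt Lambda t x - Dx alpha t x * Dx Lambda t x)); [ring|].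
  rewrite H; field; lra.
Qed.

Lemma phi_eq_box T Lambda phi alpha t x :
  smooth_before T Lambda -> smooth_before T phi -> smooth_before T alpha -> before T t ->
  0 < alpha t x -> 0 < Lambda t x ->
  phi_eq_at Lambda phi alpha t x <->
  box phi t x = - (rlog alpha 1 t x * Dminus phi t x + rlog alpha (-1) t x * Dplus phi t x) / 2
    - cosh (Lambda t x) / sinh (Lambda t x) *
      (Dplus Lambda t x * Dminus phi t x + Dminus Lambda t x * Dplus phi t x).
Proof.
intros HL Hp Ha Ht H0 HL0.
destruct (smooth_before_D T Lambda t x HL Ht) as [L1 [L2 _]].
destruct (smooth_before_D T phi t x Hp Ht) as [_ [_ [P3 P4]]].
destruct (smooth_before_D T alpha t x Ha Ht) as [A1 [A2 _]].
assert (HS := sinh_pos _ HL0).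
assert (Hh : is_derive (fun y => sinh y ^ 2) (Lambda t x) (2 * sinh (Lambda t x) * cosh (Lambda t x))).
{ apply (is_derive_ext (fun y => sinh y * sinh y)); [intros; simpl; ring|].
  assert (H := proj2 (is_derive_Reals _ _ _) (derivable_pt_lim_sinh (Lambda t x))).
  replace (2 * sinh (Lambda t x) * cosh (Lambda t x)) with
   (cosh (Lambda t x) * sinh (Lambda t x) + sinh (Lambda t x) * cosh (Lambda t x)) by ring.
  apply is_derive_mult_R; auto. }
unfold phi_eq_at.
rewrite (is_Dt_unique (fun s y => alpha s y * sinh (Lambda s y) ^ 2 * Dt phi s y) t x _ (proj1 Ht)
  (is_Dt_mult _ _ _ _ _ _ (proj1 Ht) (is_Dt_mult _ _ _ _ _ _ (proj1 Ht) A1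
     (is_Dt_comp _ _ _ _ _ _ (proj1 Ht) Hh L1)) P3)).
rewrite (is_Dx_unique (fun s y => alpha s y * sinh (Lambda s y) ^ 2 * Dx phi s y) t x _
  (is_derive_mult_R _ _ _ _ _
  (is_derive_mult_R _ _ _ _ _ A2 (is_derive_comp_R (fun y => sinh y ^ 2) (Lambda t) x _ _ Hh L2)) P4)).
unfold box, rlog, Dplus, Dminus.
set (S := sinh (Lambda t x)) in *; set (C := cosh (Lambda t x)) in *.
assert (Hp0 : 0 < alpha t x * S * S) by (apply Rmult_lt_0_compat; [apply Rmult_lt_0_compat|]; lra).
split; intros H.
- apply Rmult_eq_reg_l with (alpha t x * S * S); [|lra].
  match type of H with ?l - ?r = 0 =>
    transitivity (l - r
     - S * S * (Dt alpha t x * Dt phi t x - Dx alpha t x * Dx phi t x)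
     - 2 * alpha t x * S * C * (Dt Lambda t x * Dt phi t x - Dx Lambda t x * Dx phi t x)); [ring|] end.
  rewrite H; field; lra.
- transitivity (alpha t x * S * S * (Dt (Dt phi) t x - Dx (Dx phi) t x)
     + S * S * (Dt alpha t x * Dt phi t x - Dx alpha t x * Dx phi t x)
     + 2 * alpha t x * S * C * (Dt Lambda t x * Dt phi t x - Dx Lambda t x * Dx phi t x)); [ring|].
  rewrite H; field; lra.
Qed.

(** * Lipschitz bounds for the interaction terms *)

Lemma mult_lip x y x' y' X Y dX dY :
  Rabs x <= X -> Rabs y' <= Y -> Rabs (x - x') <= dX -> Rabs (y - y') <= dY ->
  Rabs (x * y - x' * y') <= X * dY + dX * Y.
Proof.
intros H1 H2 H3 H4; replace (x * y - x' * y') with (x * (y - y') + (x - x') * y') by ring.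
eapply Rle_trans; [apply Rabs_triang|]; rewrite !Rabs_mult.
apply Rplus_le_compat; apply Rmult_le_compat; auto; apply Rabs_pos.
Qed.

Lemma mult_bound x y X Y : Rabs x <= X -> Rabs y <= Y -> Rabs (x * y) <= X * Y.
Proof. intros; rewrite Rabs_mult; apply Rmult_le_compat; auto; apply Rabs_pos. Qed.

Lemma lip_of_derive (f df : R -> R) (P : R -> Prop) M :
  (forall u v z, P u -> P v -> Rmin u v <= z <= Rmax u v -> P z) ->
  (forall z, P z -> is_derive f z (df z)) -> (forall z, P z -> Rabs (df z) <= M) ->
  forall u v, P u -> P v -> Rabs (f u - f v) <= M * Rabs (u - v).
Proof.
intros HP HD HM u v Hu Hv.
destruct (MVT_between f df v u) as [z [Hz1 Hz2]].
{ intros; apply HD, (HP v u); auto. }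
rewrite Hz2, Rabs_mult; apply Rmult_le_compat_r; [apply Rabs_pos|].
apply HM, (HP v u); auto.
Qed.

Lemma cosh_le z K : Rabs z <= K -> cosh z <= exp K.
Proof.
intros H; apply Rabs_le_between in H; unfold cosh.
generalize (exp_mono z K ltac:(lra)) (exp_mono (- z) K ltac:(lra)); lra.
Qed.

Lemma sinh_le_cosh z : Rabs (sinh z) <= cosh z.
Proof.
unfold sinh, cosh; generalize (exp_pos z) (exp_pos (- z)); intros.
apply Rabs_le; lra.
Qed.

Lemma sinh_mono a b : a <= b -> sinh a <= sinh b.
Proof.
intros H; unfold sinh; generalize (exp_mono a b H) (exp_mono (- b) (- a) ltac:(lra)); lra.
Qed.

Lemma interval_convex a b u v z : a <= u <= b -> a <= v <= b -> Rmin u v <= z <= Rmax u v -> a <= z <= b.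
Proof. unfold Rmin, Rmax; destruct (Rle_dec u v); lra. Qed.

Lemma sinhcosh_lip K : exists M, 0 < M /\
  (forall u, Rabs u <= K -> Rabs (sinhcosh u) <= M) /\
  (forall u v, Rabs u <= K -> Rabs v <= K -> Rabs (sinhcosh u - sinhcosh v) <= M * Rabs (u - v)).
Proof.
exists (2 * (exp K * exp K)); assert (He := exp_pos K).
assert (He2 : 0 < exp K * exp K) by (apply Rmult_lt_0_compat; auto).
split; [lra|split].
- intros u Hu; unfold sinhcosh; apply Rle_trans with (exp K * exp K); [|lra].
  assert (Hc := cosh_le u K Hu).
  apply mult_bound.
  + apply Rle_trans with (1 := sinh_le_cosh u); auto.
  + rewrite Rabs_right; auto; generalize (cosh_ge_1 u); lra.
- apply (lip_of_derive sinhcosh (fun z => cosh z * cosh z + sinh z * sinh z) (fun u => Rabs u <= K)).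
  + intros u v z Hu Hv Hz; apply Rabs_le_between in Hu; apply Rabs_le_between in Hv.
    apply Rabs_le_between; apply (interval_convex (- K) K u v); auto.
  + intros z _; apply (is_derive_mult_R sinh cosh); apply is_derive_Reals;
    [apply derivable_pt_lim_sinh|apply derivable_pt_lim_cosh].
  + intros z Hz; assert (Hc := cosh_le z K Hz).
    assert (Hc1 : Rabs (cosh z) <= exp K) by (rewrite Rabs_right; auto; generalize (cosh_ge_1 z); lra).
    assert (Hs : Rabs (sinh z) <= exp K) by (apply Rle_trans with (1 := sinh_le_cosh z); auto).
    eapply Rle_trans; [apply Rabs_triang|].
    generalize (mult_bound _ _ _ _ Hc1 Hc1) (mult_bound _ _ _ _ Hs Hs); lra.
Qed.

(** [coth], frozen below [k]: equal to [coth] on the solutions of interest and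
    defined everywhere. *)
Definition cothc (k u : R) : R := cosh (Rmax k u) / sinh (Rmax k u).

Lemma cothc_eq k u : k <= u -> cothc k u = cosh u / sinh u.
Proof. intros H; unfold cothc; rewrite Rmax_right; auto. Qed.

Lemma coth_derive z : 0 < z ->
  is_derive (fun z => cosh z / sinh z) z (1 - cosh z / sinh z * (cosh z / sinh z)).
Proof.
intros Hz; assert (Hs := sinh_pos z Hz).
replace (1 - _) with (sinh z * / sinh z + cosh z * (cosh z * (- / (sinh z * sinh z)))) by (field; lra).
apply (is_derive_mult_R cosh (fun z => / sinh z)).
- apply is_derive_Reals, derivable_pt_lim_cosh.
- apply (is_derive_comp_R Rinv sinh).
  + auto_derive; [lra|field; lra].
  + apply is_derive_Reals, derivable_pt_lim_sinh.
Qed.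

Lemma cothc_lip k : 0 < k -> exists M, 0 < M /\
  (forall u, Rabs (cothc k u) <= M * (1 + Rabs u)) /\
  (forall u v, Rabs (cothc k u - cothc k v) <= M * Rabs (u - v)).
Proof.
intros Hk.
assert (Hsk := sinh_pos k Hk).
set (L := / (sinh k * sinh k)).
assert (HL : 0 < L) by (apply Rinv_0_lt_compat, Rmult_lt_0_compat; auto).
assert (Hlip : forall u v, Rabs (cothc k u - cothc k v) <= L * Rabs (u - v)).
{ intros u v.
  apply Rle_trans with (L * Rabs (Rmax k u - Rmax k v)).
  - apply (lip_of_derive (fun z => cosh z / sinh z) (fun z => 1 - cosh z / sinh z * (cosh z / sinh z))
      (fun z => k <= z)); try apply Rmax_l.
    + intros a b z Ha Hb [Hz _]; apply Rle_trans with (2 := Hz), Rmin_glb; auto.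
    + intros z Hz; apply coth_derive; lra.
    + intros z Hz; assert (Hs := sinh_mono k z Hz).
      replace (1 - _) with (- / (sinh z * sinh z)).
      2:{ transitivity (- (cosh z * cosh z - sinh z * sinh z) / (sinh z * sinh z)); [|field; lra].
          rewrite cosh_sinh_sq; field; lra. }
      rewrite Rabs_Ropp, Rabs_right.
      * apply Rinv_le_contravar; [apply Rmult_lt_0_compat; auto|apply Rmult_le_compat; lra].
      * apply Rle_ge, Rlt_le, Rinv_0_lt_compat, Rmult_lt_0_compat; lra.
  - apply Rmult_le_compat_l; [lra|].
    unfold Rmax; destruct (Rle_dec k u), (Rle_dec k v); unfold Rabs; repeat destruct Rcase_abs; lra. }
exists (L + Rabs (cothc k 0)); assert (H0 := Rabs_pos (cothc k 0)).
split; [lra|split].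
- intros u; replace (cothc k u) with ((cothc k u - cothc k 0) + cothc k 0) by ring.
  eapply Rle_trans; [apply Rabs_triang|]; specialize (Hlip u 0); rewrite Rminus_0_r in Hlip.
  generalize (Rabs_pos u); nra.
- intros u v; eapply Rle_trans; [apply Hlip|]; apply Rmult_le_compat_r; [apply Rabs_pos|lra].
Qed.

Lemma continuity_pt_lip (f : R -> R) M x : 0 < M ->
  (forall u v, Rabs (f u - f v) <= M * Rabs (u - v)) -> continuity_pt f x.
Proof.
intros HM H; apply continuity_pt_filterlim, filterlim_locally; intros eps.
assert (Hd : 0 < eps / M) by (apply Rdiv_lt_0_compat; [apply cond_pos|auto]).
exists (mkposreal _ Hd); intros y Hy; change (Rabs (y - x) < eps / M) in Hy.
change (Rabs (f y - f x) < eps); eapply Rle_lt_trans; [apply H|].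
apply Rmult_lt_compat_l with (r := M) in Hy; auto.
replace (M * (eps / M)) with (pos eps) in Hy by (field; lra); auto.
Qed.

(** The unknowns: [Lambda], [phi], and their derivatives along [d_t + d_x]
    ([LamP], [PhiP], transported at speed -1) and along [d_t - d_x] ([LamM],
    [PhiM], transported at speed 1). *)
Inductive field : Set := Lam | Phi | LamP | LamM | PhiP | PhiM.

Definition fields := Lam :: Phi :: LamP :: LamM :: PhiP :: PhiM :: nil.

Lemma in_fields i : In i fields.
Proof. destruct i; simpl; tauto. Qed.

Definition speed (i : field) : R :=
  match i with Lam | Phi => 0 | LamP | PhiP => -1 | LamM | PhiM => 1 end.

Definition rhsL (r s : R) (u : field -> R) : R :=
  - (r * u LamM + s * u LamP) / 2 + 4 * sinhcosh (u Lam) * (u PhiP * u PhiM).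

Definition rhsp (k r s : R) (u : field -> R) : R :=
  - (r * u PhiM + s * u PhiP) / 2 - cothc k (u Lam) * (u LamP * u PhiM + u LamM * u PhiP).

Definition rhs (k : R) (alpha : R -> R -> R) (i : field) (t x : R) (u : field -> R) : R :=
  match i with
  | Lam => (u LamP + u LamM) / 2
  | Phi => (u PhiP + u PhiM) / 2
  | LamP | LamM => rhsL (rlog alpha 1 t x) (rlog alpha (-1) t x) u
  | PhiP | PhiM => rhsp k (rlog alpha 1 t x) (rlog alpha (-1) t x) u
  end.

Definition field_of (Lambda phi : R -> R -> R) (i : field) : R -> R -> R :=
  match i with
  | Lam => Lambda | Phi => phi
  | LamP => Dplus Lambda | LamM => Dminus Lambda
  | PhiP => Dplus phi | PhiM => Dminus phi
  end.

(** The size of a field relative to weights [a], [b] for the quantities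
    transported along [x + t = const] and [x - t = const]. *)
Definition weight (a b : R) (i : field) : R :=
  match i with Lam | Phi => 1 | LamP | PhiP => a | LamM | PhiM => b end.

(** Every interaction term is a product of quantities from two different
    families (null structure), whence the factor [a * b].  The field [Phi] is left
    out of the bounds: the equations contain its derivatives only. *)
Lemma rhs_lip k K : 0 < k -> 0 < K -> exists C, 0 < C /\ forall r s a b B u v,
  0 < a <= 1 -> 0 < b <= 1 -> 0 <= B -> Rabs r <= K * a -> Rabs s <= K * b ->
  (forall i, i <> Phi -> Rabs (u i) <= K * weight a b i) ->
  (forall i, i <> Phi -> Rabs (v i) <= K * weight a b i) ->
  (forall i, Rabs (u i - v i) <= B * weight a b i) ->
  Rabs (rhsL r s u - rhsL r s v) <= C * B * (a * b) /\
  Rabs (rhsp k r s u - rhsp k r s v) <= C * B * (a * b).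
Proof.
intros Hk HK.
destruct (sinhcosh_lip K) as [M1 [HM1 [Q1 Q2]]], (cothc_lip k Hk) as [M2 [HM2 [C1 C2]]].
set (K2 := M2 * (1 + K)).
assert (HK2 : 0 < K2) by (apply Rmult_lt_0_compat; lra).
exists (K + 4 * (M1 * (2 * K) + M1 * (K * K)) + K2 * (4 * K) + M2 * (2 * (K * K))).
assert (HKK : 0 < K * K) by (apply Rmult_lt_0_compat; auto).
split; [nra|].
intros r s a b B u v Ha Hb HB Hr Hs Hu Hv Hd.
assert (Hab : 0 < a * b) by (apply Rmult_lt_0_compat; lra).
assert (HBab : 0 <= B * (a * b)) by (apply Rmult_le_pos; lra).
assert (UL := Hu Lam ltac:(discriminate)); assert (VL := Hv Lam ltac:(discriminate)); assert (DL := Hd Lam).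
simpl in UL, VL, DL; rewrite Rmult_1_r in UL, VL, DL.
assert (Hlin : forall x y, Rabs x <= B * b -> Rabs y <= B * a ->
  Rabs (- (r * x + s * y) / 2) <= K * (B * (a * b))).
{ intros x y Hx Hy; unfold Rdiv; rewrite Rabs_mult, Rabs_Ropp, (Rabs_right (/ 2)) by lra.
  generalize (Rabs_triang (r * x) (s * y)) (mult_bound _ _ _ _ Hr Hx) (mult_bound _ _ _ _ Hs Hy); intros.
  replace (K * a * (B * b)) with (K * (B * (a * b))) in * by ring.
  replace (K * b * (B * a)) with (K * (B * (a * b))) in * by ring. lra. }
assert (Hbil : forall p q p' q', Rabs p <= K * a -> Rabs q' <= K * b -> Rabs (p - p') <= B * a ->
   Rabs (q - q') <= B * b -> Rabs (p * q - p' * q') <= 2 * K * (B * (a * b))).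
{ intros p q p' q' H1 H2 H3 H4; eapply Rle_trans; [apply (mult_lip p q p' q' _ _ _ _ H1 H2 H3 H4)|].
  right; ring. }
assert (Hpr : forall p q, Rabs p <= K * a -> Rabs q <= K * b -> Rabs (p * q) <= K * K * (a * b)).
{ intros p q H1 H2; eapply Rle_trans; [apply (mult_bound _ _ _ _ H1 H2)|]; right; ring. }
assert (Ui := fun i H => Hu i H); assert (Vi := fun i H => Hv i H).
assert (DLp := Hd LamP); assert (DLm := Hd LamM); assert (Dpp := Hd PhiP); assert (Dpm := Hd PhiM).
assert (ULp := Hu LamP ltac:(discriminate)); assert (ULm := Hu LamM ltac:(discriminate)).
assert (Upp := Hu PhiP ltac:(discriminate)); assert (Upm := Hu PhiM ltac:(discriminate)).
assert (VLp := Hv LamP ltac:(discriminate)); assert (VLm := Hv LamM ltac:(discriminate)).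
assert (Vpp := Hv PhiP ltac:(discriminate)); assert (Vpm := Hv PhiM ltac:(discriminate)).
simpl in *.
set (z := B * (a * b)) in *.
split.
- unfold rhsL.
  replace (_ - _) with (- (r * (u LamM - v LamM) + s * (u LamP - v LamP)) / 2 +
    4 * (sinhcosh (u Lam) * (u PhiP * u PhiM) - sinhcosh (v Lam) * (v PhiP * v PhiM))) by field.
  eapply Rle_trans; [apply Rabs_triang|].
  rewrite (Rabs_mult 4), (Rabs_right 4) by lra.
  assert (T1 := Hlin _ _ DLm DLp).
  assert (T2 : Rabs (sinhcosh (u Lam) * (u PhiP * u PhiM) - sinhcosh (v Lam) * (v PhiP * v PhiM))
    <= M1 * (2 * K * z) + M1 * B * (K * K * (a * b))).
  { apply mult_lip; auto.
    eapply Rle_trans; [apply Q2; auto|]; apply Rmult_le_compat_l; lra. }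
  replace (M1 * B * (K * K * (a * b))) with (M1 * (K * K) * z) in T2 by (unfold z; ring).
  replace ((K + 4 * (M1 * (2 * K) + M1 * (K * K)) + K2 * (4 * K) + M2 * (2 * (K * K))) * B * (a * b))
    with ((K + 4 * (M1 * (2 * K) + M1 * (K * K)) + K2 * (4 * K) + M2 * (2 * (K * K))) * z) by (unfold z; ring).
  assert (0 <= (K2 * (4 * K) + M2 * (2 * (K * K))) * z).
  { apply Rmult_le_pos; auto; apply Rplus_le_le_0_compat; apply Rmult_le_pos; lra. }
  lra.
- unfold rhsp.
  replace (_ - _) with (- (r * (u PhiM - v PhiM) + s * (u PhiP - v PhiP)) / 2 -
    (cothc k (u Lam) * (u LamP * u PhiM + u LamM * u PhiP) - cothc k (v Lam) * (v LamP * v PhiM + v LamM * v PhiP))) by field.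
  eapply Rle_trans; [apply Rabs_triang|]; rewrite Rabs_Ropp.
  assert (T1 := Hlin _ _ Dpm Dpp).
  assert (T2 : Rabs (cothc k (u Lam) * (u LamP * u PhiM + u LamM * u PhiP)
     - cothc k (v Lam) * (v LamP * v PhiM + v LamM * v PhiP)) <= K2 * (4 * K * z) + M2 * B * (2 * (K * K) * (a * b))).
  { apply mult_lip.
    - unfold K2; eapply Rle_trans; [apply C1|]; apply Rmult_le_compat_l; lra.
    - eapply Rle_trans; [apply Rabs_triang|].
      rewrite (Rmult_comm (v LamM)).
      generalize (Hpr _ _ VLp Vpm) (Hpr _ _ Vpp VLm); lra.
    - eapply Rle_trans; [apply C2|]; apply Rmult_le_compat_l; lra.
    - replace (_ - _) with ((u LamP * u PhiM - v LamP * v PhiM) + (u PhiP * u LamM - v PhiP * v LamM)) by ring.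
      eapply Rle_trans; [apply Rabs_triang|].
      generalize (Hbil _ _ _ _ ULp Vpm DLp Dpm) (Hbil _ _ _ _ Upp VLm Dpp DLm); lra. }
  replace (M2 * B * (2 * (K * K) * (a * b))) with (M2 * (2 * (K * K)) * z) in T2 by (unfold z; ring).
  replace ((K + 4 * (M1 * (2 * K) + M1 * (K * K)) + K2 * (4 * K) + M2 * (2 * (K * K))) * B * (a * b))
    with ((K + 4 * (M1 * (2 * K) + M1 * (K * K)) + K2 * (4 * K) + M2 * (2 * (K * K))) * z) by (unfold z; ring).
  assert (0 <= 4 * (M1 * (2 * K) + M1 * (K * K)) * z).
  { apply Rmult_le_pos; auto; nra. }
  lra.
Qed.

Lemma rhs_cont k alpha (u : field -> R -> R -> R) : 0 < k ->
  cont (rlog alpha 1) -> cont (rlog alpha (-1)) -> (forall j, cont (u j)) ->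
  forall i, cont (fun t x => rhs k alpha i t x (fun j => u j t x)).
Proof.
intros Hk Hr Hs Hu.
destruct (cothc_lip k Hk) as [M [HM [_ Hlip]]].
assert (HQ : cont (fun t x => sinhcosh (u Lam t x))).
{ apply cont_comp1; auto; intros; apply continuity_pt_mult; apply derivable_continuous_pt.
  - apply derivable_pt_sinh.
  - apply derivable_pt_cosh. }
assert (HC : cont (fun t x => cothc k (u Lam t x))).
{ apply cont_comp1; auto; intros; apply continuity_pt_lip with M; auto. }
assert (Hlin : forall i j, cont (fun t x => - (rlog alpha 1 t x * u i t x + rlog alpha (-1) t x * u j t x) / 2)).
{ intros i j; apply cont_ext with (fun t x => - (1) / 2 * (rlog alpha 1 t x * u i t x + rlog alpha (-1) t x * u j t x)).
  - intros; field.
  - apply cont_mult; auto using cont_const, cont_plus, cont_mult. }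
assert (HL : cont (fun t x => rhsL (rlog alpha 1 t x) (rlog alpha (-1) t x) (fun j => u j t x))).
{ unfold rhsL; apply cont_plus; auto; apply cont_mult; auto using cont_mult, cont_const. }
assert (HP : cont (fun t x => rhsp k (rlog alpha 1 t x) (rlog alpha (-1) t x) (fun j => u j t x))).
{ unfold rhsp; apply cont_minus; auto; apply cont_mult; auto using cont_plus, cont_mult, cont_const. }
intros [| | | | |]; simpl; auto; (apply cont_mult; auto using cont_plus, cont_const).
Qed.

(** Where [Lambda >= k] the frozen [coth] is the true one.  The hypothesis is
    restricted to one backward characteristic, since the solutions that uniqueness
    has to deal with are not known in advance to satisfy it elsewhere. *)
Lemma solution_mild T k Lambda phi alpha t1 t x i :
  smooth_before T Lambda -> smooth_before T phi -> before T t1 -> 0 <= t <= t1 -> 0 < k ->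
  (forall s, 0 <= s <= t -> let y := x - speed i * (t - s) in
     k <= Lambda s y /\ box_system Lambda phi alpha s y) ->
  field_of Lambda phi i t x = field_of Lambda phi i 0 (x - speed i * t) +
   Ich (speed i) (fun s y => rhs k alpha i (Rmin s t1) y (fun j => field_of Lambda phi j (Rmin s t1) y)) t x.
Proof.
intros HL Hp Ht1 Ht Hk H.
destruct (null_transport T Lambda t1 HL Ht1) as [_ [_ [_ [_ TL]]]].
destruct (null_transport T phi t1 Hp Ht1) as [_ [_ [_ [_ TP]]]].
destruct (TL t x Ht) as [T1 [T2 T3]], (TP t x Ht) as [T4 [T5 T6]].
destruct i; simpl in H |- *.
- rewrite T1; reflexivity.
- rewrite T4; reflexivity.
- rewrite T2; f_equal; apply Ich_ext; [lra|]; intros s Hs; destruct (H s Hs) as [_ [E _]].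
  rewrite !Rmin_left by lra; rewrite E; reflexivity.
- rewrite T3; f_equal; apply Ich_ext; [lra|]; intros s Hs; destruct (H s Hs) as [_ [E _]].
  rewrite !Rmin_left by lra; rewrite E; reflexivity.
- rewrite T5; f_equal; apply Ich_ext; [lra|]; intros s Hs; destruct (H s Hs) as [Hk' [_ E]].
  rewrite !Rmin_left by lra; unfold rhsp; rewrite E, cothc_eq by auto; reflexivity.
- rewrite T6; f_equal; apply Ich_ext; [lra|]; intros s Hs; destruct (H s Hs) as [Hk' [_ E]].
  rewrite !Rmin_left by lra; unfold rhsp; rewrite E, cothc_eq by auto; reflexivity.
Qed.

(** * Decay of the background *)

Definition decay (y : R) : R := / (1 + y * y).

Lemma decay_pos y : 0 < decay y <= 1.
Proof.
unfold decay; split; [apply Rinv_0_lt_compat; nra|].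
rewrite <- Rinv_1; apply Rinv_le_contravar; nra.
Qed.

Lemma decay_intro f C y : 0 <= C -> Rabs f * (1 + y * y) <= C -> Rabs f <= C * decay y.
Proof.
intros HC H; unfold decay; apply Rmult_le_reg_r with (1 + y * y); [nra|].
rewrite Rmult_assoc, Rinv_l; nra.
Qed.

Lemma Schwartz_decay f : Schwartz f -> exists C, 0 < C /\ forall y, Rabs (f y) <= C * decay y.
Proof.
intros [_ H]; destruct (H 0%nat 0%nat) as [C0 H0], (H 2%nat 0%nat) as [C2 H2].
assert (HC : forall y, Rabs (f y) * (1 + y * y) <= C0 + C2).
{ intros y; specialize (H0 y); specialize (H2 y); simpl in H0, H2.
  replace (y * y) with (Rabs y * Rabs y) by (rewrite <- Rabs_mult; apply Rabs_right; nra).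
  lra. }
exists (Rabs (C0 + C2) + 1); split; [generalize (Rabs_pos (C0 + C2)); lra|].
intros y; apply decay_intro; [generalize (Rabs_pos (C0 + C2)); lra|].
specialize (HC y); generalize (Rle_abs (C0 + C2)); lra.
Qed.

Lemma Cc_decay f : Cc_infty f -> exists C, 0 < C /\ forall y, Rabs (f y) <= C * decay y.
Proof.
intros [Hf [r Hr]].
destruct (cont_bounded (fun _ y => f y) 0 (Rabs r)) as [M [HM Hb]].
{ apply Cinf_cont, (smooth_fun_Cinf f Hf). }
exists (M * (1 + r * r)); split; [apply Rmult_lt_0_compat; nra|].
intros y; apply decay_intro; [apply Rmult_le_pos; nra|].
destruct (Rlt_dec r (Rabs y)) as [H|H].
- rewrite Hr, Rabs_R0 by auto; rewrite Rmult_0_l; apply Rmult_le_pos; nra.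
- assert (H1 : Rabs y <= Rabs r) by (generalize (Rle_abs r); lra).
  apply Rmult_le_compat; [apply Rabs_pos|nra|apply (Hb 0); auto; lra|].
  assert (Rabs y * Rabs y <= Rabs r * Rabs r) by (apply Rmult_le_compat; auto; apply Rabs_pos).
  rewrite <- !Rabs_mult, !Rabs_right in H0 by nra; lra.
Qed.

Lemma Cc_Derive f : Cc_infty f -> Cc_infty (Derive f).
Proof.
intros [Hf [r Hr]]; split; [apply smooth_fun_Derive; auto|].
exists r; intros x Hx; apply is_derive_unique, (is_derive_ext_loc (fun _ => 0)).
- assert (Hd : 0 < Rabs x - r) by lra.
  exists (mkposreal _ Hd); intros y; simpl in y; intros Hy; change (Rabs (y - x) < Rabs x - r) in Hy.
  symmetry; apply Hr.
  generalize (Rabs_triang_inv x (x - y)); rewrite (Rabs_minus_sym x y).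
  replace (x - (x - y)) with y by ring; lra.
- auto_derive; auto.
Qed.

(** The wave operator factors as [D+ D-], so each null derivative is constant
    along the opposite family of characteristics. *)
Lemma wave_null_transport alpha t x :
  Cinf alpha -> (forall t x, 0 <= t -> wave_at alpha t x) -> 0 <= t ->
  Dplus alpha t x = Dplus alpha 0 (x + t) /\ Dminus alpha t x = Dminus alpha 0 (x - t).
Proof.
intros Ha Hw Ht.
assert (Ht' : before p_infty t) by (apply before_infty; auto).
destruct (null_transport p_infty alpha t (Cinf_smooth _ Ha) Ht') as [_ [_ [_ [Hb HT]]]].
destruct (HT t x ltac:(lra)) as [_ [T1 T2]].
assert (H0 : forall c, Ich c (fun s y => box alpha (Rmin s t) y) t x = 0).
{ intros c; assert (H := Ich_le_const c (fun s y => box alpha (Rmin s t) y) t x 0 Hb Ht).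
  rewrite Rmult_0_r in H.
  cut (Rabs (Ich c (fun s y => box alpha (Rmin s t) y) t x) <= 0).
  { intros H'; apply Rabs_eq_0, Rle_antisym; [auto|apply Rabs_pos]. }
  apply H; intros s Hs; rewrite Rmin_left by lra.
  unfold box; rewrite (Hw s (x - c * (t - s))) by lra; rewrite Rabs_R0; lra. }
rewrite T1, T2, !H0.
replace (x - -1 * t) with (x + t) by ring; replace (x - 1 * t) with (x - t) by ring; lra.
Qed.

(** [m] stays away from 1 because [w] exceeds the supremum of [alpha + beta]:
    [alpha (1 - m)^2 = 2 m (w - beta - alpha)]. *)
Lemma m_gap (alpha m b : R -> R -> R) w del M :
  0 < del ->
  (forall t x, 0 <= t -> 0 < alpha t x <= M) -> (forall t x, 0 <= t -> 0 < m t x < 1) ->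
  (forall t x, 0 <= t -> alpha t x + b t x <= w - del) ->
  (forall t x, 0 <= t -> alpha t x * (m t x * m t x + 1) = 2 * (w - b t x) * m t x) ->
  exists eta, 0 < eta <= / 2 /\ forall t x, 0 <= t -> m t x <= 1 - eta.
Proof.
intros Hdel Ha Hm Hs He.
assert (HM : 0 < M) by (generalize (Ha 0 0 ltac:(lra)); lra).
assert (HdM : 0 < del / M) by (apply Rdiv_lt_0_compat; auto).
exists (Rmin (/ 2) (del / M)).
split; [split; [apply Rmin_glb_lt; lra|apply Rmin_l]|].
intros t x Ht; specialize (Ha t x Ht); specialize (Hm t x Ht); specialize (Hs t x Ht); specialize (He t x Ht).
destruct (Rle_dec (m t x) (/ 2)) as [H|H].
- generalize (Rmin_l (/ 2) (del / M)); lra.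
- cut (del / M <= 1 - m t x); [generalize (Rmin_r (/ 2) (del / M)); lra|].
  assert (H1 : alpha t x * ((1 - m t x) * (1 - m t x)) >= del).
  { replace (alpha t x * ((1 - m t x) * (1 - m t x))) with
     (2 * (w - b t x) * m t x - 2 * alpha t x * m t x) by (rewrite <- He; ring).
    replace (_ - _) with (2 * m t x * (w - b t x - alpha t x)) by ring. nra. }
  apply Rmult_le_reg_r with M; auto.
  unfold Rdiv; rewrite Rmult_assoc, Rinv_l by lra.
  assert ((1 - m t x) * (1 - m t x) <= 1 - m t x) by nra.
  assert (alpha t x * ((1 - m t x) * (1 - m t x)) <= M * (1 - m t x)).
  { apply Rmult_le_compat; try lra; nra. }
  lra.
Qed.

Lemma kappa_bound s m eta : s * s = 1 -> 0 < m -> 0 < eta -> m <= 1 - eta ->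
  0 <= kappa s m <= 2 / eta.
Proof.
intros Hs Hm Heta H.
assert (Hs' : s = 1 \/ s = -1).
{ assert (E : (s - 1) * (s + 1) = 0) by lra.
  apply Rmult_integral in E; lra. }
assert (Hmm : 0 < 1 - m * m) by nra.
unfold kappa; split.
- apply Rmult_le_pos; [destruct Hs' as [-> | ->]; nra|apply Rlt_le, Rinv_0_lt_compat; auto].
- apply Rmult_le_reg_r with ((1 - m * m) * eta); [apply Rmult_lt_0_compat; auto|].
  replace ((1 + 2 * s * m + m * m) / (1 - m * m) * ((1 - m * m) * eta)) with
    ((1 + 2 * s * m + m * m) * eta) by (field; lra).
  replace (2 / eta * ((1 - m * m) * eta)) with (2 * (1 - m * m)) by (field; lra).
  assert (1 + 2 * s * m + m * m <= (1 + m) * (1 + m)) by (destruct Hs' as [-> | ->]; nra).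
  assert ((1 + m) * eta <= (1 + m) * (1 - m)) by (apply Rmult_le_compat_l; lra).
  nra.
Qed.

Lemma rlog_decay alpha c0 C :
  Cinf alpha -> (forall t x, 0 <= t -> wave_at alpha t x) -> 0 < c0 ->
  (forall t x, 0 <= t -> c0 <= alpha t x) ->
  (forall y, Rabs (Dplus alpha 0 y) <= C * decay y) ->
  (forall y, Rabs (Dminus alpha 0 y) <= C * decay y) ->
  forall t x, 0 <= t -> Rabs (rlog alpha 1 t x) <= C / c0 * decay (t + x) /\
     Rabs (rlog alpha (-1) t x) <= C / c0 * decay (t - x).
Proof.
intros Ha Hw Hc0 Ha0 HP HM t x Ht.
destruct (wave_null_transport alpha t x Ha Hw Ht) as [E1 E2].
assert (Hi : forall f y, Rabs f <= C * decay y -> Rabs (f / alpha t x) <= C / c0 * decay y).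
{ intros f y Hf; specialize (Ha0 t x Ht).
  unfold Rdiv; rewrite Rabs_mult, (Rabs_right (/ alpha t x)).
  2:{ apply Rle_ge, Rlt_le, Rinv_0_lt_compat; lra. }
  replace (C * / c0 * decay y) with (C * decay y * / c0) by ring.
  apply Rmult_le_compat; auto; [apply Rabs_pos| |apply Rinv_le_contravar; auto].
  apply Rlt_le, Rinv_0_lt_compat; lra. }
split.
- unfold rlog; fold (Dplus alpha t x); rewrite E1, (Rplus_comm t); auto.
- unfold rlog; fold (Dminus alpha t x); rewrite E2; apply Hi.
  replace (decay (t - x)) with (decay (x - t)) by (unfold decay; f_equal; ring); auto.
Qed.

(** * Decay of the energy of the soliton inside the light cone *)

Lemma energy_null Lambda phi t x :
  energy_density Lambda phi t x =
  (Dplus Lambda t x * Dplus Lambda t x + sinh (Lambda t x) * sinh (Lambda t x) * (Dplus phi t x * Dplus phi t x)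
   + (Dminus Lambda t x * Dminus Lambda t x + sinh (Lambda t x) * sinh (Lambda t x) * (Dminus phi t x * Dminus phi t x))) / 2.
Proof. unfold energy_density, Dplus, Dminus; field. Qed.

Lemma decay_le y a : 0 < a -> a <= y -> decay y <= / (a * a).
Proof. intros Ha Hy; apply Rinv_le_contravar; nra. Qed.

(** In the region of integration [|t + x|] and [|t - x|] are at least a multiple of
    [t], so the energy density, quadratic in the null derivatives, is [O(t^-4)] on
    an interval of length [O(t)]. *)
Lemma energy_decay d c0 Lambda phi alpha F H v :
  1 <= d -> one_soliton d Lambda phi alpha -> cosmological_type alpha -> 0 < c0 ->
  (forall t x, 0 <= t -> c0 < alpha t x) -> Schwartz F -> Schwartz H ->
  (forall t x, 0 <= t -> Dt alpha t x = F (t + x) + H (t - x)) -> Rabs v < 1 ->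
  is_lim (fun t => RInt (fun x => energy_density Lambda phi t x)
                        (v * t - omega t) (v * t + omega t)) p_infty (Finite 0).
Proof.
intros Hd Hsol Hcos Hc0 Hac HF HH Hdt Hv.
destruct (soliton_frame_exists d Lambda phi alpha Hsol)
  as [beta [w [del [m [Hb [Hdel [Hsup [Hfr [Hme [Hphi Hg]]]]]]]]]].
assert (Hpol := soliton_is_polar d Lambda phi alpha m Hfr Hphi Hg).
assert (HLC : Cinf Lambda) by apply Hpol.
assert (Hfr' := Hfr); destruct Hfr' as [Ha [Hm [Hw [Ha0 [Hm0 _]]]]].
destruct Hsol as [[_ [_ [_ [M HM]]]] _].
destruct (m_gap alpha m beta w del M Hdel) as [eta [Heta Hgap]]; auto.
destruct (Schwartz_decay F HF) as [CF [HCF DF]], (Schwartz_decay H HH) as [CH [HCH DH]].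
assert (Hdt0 : forall y, Rabs (Dt alpha 0 y) <= (CF + CH) * decay y).
{ intros y; rewrite Hdt by lra.
  eapply Rle_trans; [apply Rabs_triang|].
  generalize (DF (0 + y)) (DH (0 - y)).
  replace (decay (0 - y)) with (decay y) by (unfold decay; f_equal; ring).
  rewrite Rplus_0_l; lra. }
(* [|d_x alpha| < d_t alpha] bounds both null derivatives by [d_t alpha] *)
assert (Hnull : forall y s, s = 1 \/ s = -1 -> Rabs (Dt alpha 0 y + s * Dx alpha 0 y) <= 2 * (CF + CH) * decay y).
{ intros y s Hs; destruct (Hcos 0 y ltac:(lra)) as [_ [H1 H2]].
  specialize (Hdt0 y); rewrite Rabs_right in Hdt0 by lra.
  assert (H3 : - Dt alpha 0 y < Dx alpha 0 y < Dt alpha 0 y) by (split; nra).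
  assert (Rabs (Dt alpha 0 y + s * Dx alpha 0 y) <= 2 * Dt alpha 0 y).
  { apply Rabs_le; destruct Hs as [-> | ->]; lra. }
  lra. }
assert (Hr := rlog_decay alpha c0 (2 * (CF + CH)) Ha Hw Hc0
  (fun t x Ht => Rlt_le _ _ (Hac t x Ht))
  (fun y => Hnull y 1 (or_introl eq_refl)) (fun y => Hnull y (-1) (or_intror eq_refl))).
set (C1 := 2 * (CF + CH) / c0) in Hr.
set (C2 := C1 * (d + 2 / eta)).
assert (HC1 : 0 <= C1) by (unfold C1; apply Rmult_le_pos; [lra|apply Rlt_le, Rinv_0_lt_compat; auto]).
assert (He2 : 0 < 2 / eta) by (apply Rdiv_lt_0_compat; lra).
assert (HC2 : 0 <= C2) by (unfold C2; apply Rmult_le_pos; lra).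
assert (Hspeed : forall s t x y, s * s = 1 -> 0 <= t -> Rabs (rlog alpha s t x) <= C1 * decay y ->
  let l := Dt Lambda t x + s * Dx Lambda t x in let f := Dt phi t x + s * Dx phi t x in
  l * l + sinh (Lambda t x) * sinh (Lambda t x) * (f * f) <= (C2 * decay y) * (C2 * decay y)).
{ intros s t x y Hs Ht Hry l f.
  assert (H1 := soliton_speed d Lambda phi alpha m s t x Hd Hfr Hpol Hs Ht).
  fold l f in H1.
  destruct (kappa_bound s (m t x) eta Hs (proj1 (Hm0 t x Ht)) (proj1 Heta) (Hgap t x Ht)) as [K1 K2].
  assert (H2 : Rabs (rlog alpha s t x * (d + kappa s (m t x))) <= C2 * decay y).
  { replace (C2 * decay y) with (C1 * decay y * (d + 2 / eta)) by (unfold C2; ring).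
    apply mult_bound; auto; rewrite Rabs_right; lra. }
  assert (H3 := mult_bound _ _ _ _ H2 H2); rewrite Rabs_right in H3 by apply Rle_ge, Rle_0_sqr.
  assert (0 <= sinh (Lambda t x) * sinh (Lambda t x) * (f * f)) by (apply Rmult_le_pos; apply Rle_0_sqr).
  simpl in H1; lra. }
(* [2 q] is the distance of [v] to the light cone; half of it absorbs [omega] *)
set (q := (1 - Rabs v) / 2).
assert (Hq : 0 < q) by (unfold q; lra).
assert (Hcone : exists T, 1 <= T /\ forall t, T < t -> 0 < omega t <= q * t /\ omega t <= t).
{ set (l := / q + 1).
  assert (Hl : 1 < l) by (unfold l; generalize (Rinv_0_lt_compat q Hq); lra).
  exists (exp l); split; [generalize (exp_ineq1_le l); lra|].
  intros t Ht.
  assert (Ht0 : 0 < t) by (generalize (exp_pos l); lra).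
  assert (Hln : l < ln t) by (rewrite <- (ln_exp l); apply ln_increasing; auto; apply exp_pos).
  assert (Hln2 : l <= ln t * ln t) by nra.
  unfold omega; replace (ln t ^ 2) with (ln t * ln t) by ring.
  assert (Hq1 : / (ln t * ln t) <= q).
  { rewrite <- (Rinv_inv q); apply Rinv_le_contravar; [apply Rinv_0_lt_compat; auto|unfold l in *; lra]. }
  assert (Hq2 : 0 < / (ln t * ln t)) by (apply Rinv_0_lt_compat; lra).
  assert (q <= 1) by (unfold q; generalize (Rabs_pos v); lra).
  unfold Rdiv; split; [split|].
  - apply Rmult_lt_0_compat; auto.
  - rewrite Rmult_comm; apply Rmult_le_compat_r; lra.
  - apply Rle_trans with (t * 1); [apply Rmult_le_compat_l; lra|lra]. }
destruct Hcone as [T [HT Hcone]].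
set (C3 := 2 * (C2 * / (q * q)) * (C2 * / (q * q))).
assert (Hqq : 0 < / (q * q)) by (apply Rinv_0_lt_compat, Rmult_lt_0_compat; auto).
assert (HC2q : 0 <= C2 * / (q * q)) by (apply Rmult_le_pos; lra).
assert (HC3 : 0 <= C3).
{ unfold C3; rewrite Rmult_assoc; apply Rmult_le_pos; [lra|]; apply Rmult_le_pos; auto. }
assert (Hen : forall t, T < t -> Rabs (RInt (fun x => energy_density Lambda phi t x)
                        (v * t - omega t) (v * t + omega t)) <= C3 / t).
{ intros t Ht; destruct (Hcone t Ht) as [[Ho1 Ho2] Ho3].
  assert (Hec : forall x, continuous (fun x => energy_density Lambda phi t x) x).
  { intros x; apply (ex_derive_continuous (fun x => energy_density Lambda phi t x)).
    assert (HE : Cinf (energy_density Lambda phi)).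
    { assert (HsC := Cinf_sinh Lambda HLC).
      assert (Hp2 : forall f, Cinf f -> Cinf (fun t x => f t x ^ 2)).
      { intros f Hf; apply Cinf_ext with (fun t x => f t x * f t x); [intros; ring|].
        apply Cinf_mult; auto. }
      apply Cinf_plus; [apply Cinf_plus; apply Hp2; auto using Cinf_Dt, Cinf_Dx|].
      apply Cinf_mult; [apply (Hp2 _ HsC)|].
      apply Cinf_plus; apply Hp2; auto using Cinf_Dt, Cinf_Dx. }
    eexists; apply (Cinf_is_Dx _ t x HE); lra. }
  assert (Hqt : 0 < q * t) by (apply Rmult_lt_0_compat; lra).
  eapply Rle_trans; [apply (abs_RInt_le_const _ _ _ ((C2 * / (q * t * (q * t))) * (C2 * / (q * t * (q * t)))))|].
  - lra.
  - apply (ex_RInt_continuous (V := R_CompleteNormedModule)); intros; apply Hec.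
  - intros x Hx.
    assert (Hv' : - Rabs v <= v <= Rabs v) by (apply Rabs_le_between; lra).
    assert (Hvt : - Rabs v * t <= v * t <= Rabs v * t) by (split; apply Rmult_le_compat_r; lra).
    assert (Hqv : t = Rabs v * t + 2 * (q * t)) by (unfold q; field).
    assert (Hx1 : q * t <= t + x) by lra.
    assert (Hx2 : q * t <= t - x) by lra.
    destruct (Hr t x ltac:(lra)) as [R1 R2].
    assert (S1 := Hspeed 1 t x (t + x) ltac:(ring) ltac:(lra) R1).
    assert (S2 := Hspeed (-1) t x (t - x) ltac:(ring) ltac:(lra) R2).
    assert (Dd : forall y, q * t <= y -> (C2 * decay y) * (C2 * decay y) <=
       (C2 * / (q * t * (q * t))) * (C2 * / (q * t * (q * t)))).
    { intros y Hy; assert (H1 := decay_le y (q * t) Hqt Hy); assert (H2 := decay_pos y).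
      apply Rmult_le_compat; try (apply Rmult_le_pos; lra); apply Rmult_le_compat_l; lra. }
    assert (D1 := Dd _ Hx1); assert (D2 := Dd _ Hx2).
    rewrite energy_null; unfold Dplus, Dminus; cbv zeta in S1, S2.
    rewrite Rabs_right; [lra|].
    apply Rle_ge; repeat first [apply Rplus_le_le_0_compat | apply Rle_0_sqr | apply Rmult_le_pos]; lra.
  - replace (v * t + omega t - (v * t - omega t)) with (2 * omega t) by ring.
    assert (Ht1 : 1 <= t) by lra.
    replace (/ (q * t * (q * t))) with (/ (q * q) * / (t * t)) by (field; lra).
    assert (Hit : 0 < / t <= 1).
    { split; [apply Rinv_0_lt_compat; lra|rewrite <- Rinv_1; apply Rinv_le_contravar; lra]. }
    replace (2 * omega t * (C2 * (/ (q * q) * / (t * t)) * (C2 * (/ (q * q) * / (t * t))))) with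
      (C3 / t * (omega t * / t * / t * / t)) by (unfold C3; field; lra).
    apply Rle_trans with (C3 / t * 1); [|lra]; apply Rmult_le_compat_l; [apply Rmult_le_pos; lra|].
    assert (omega t * / t <= 1).
    { apply Rmult_le_reg_r with t; [lra|]; rewrite Rmult_assoc, Rinv_l; lra. }
    assert (0 <= omega t * / t) by (apply Rmult_le_pos; lra).
    assert (omega t * / t * / t <= 1) by nra.
    assert (0 <= omega t * / t * / t) by (apply Rmult_le_pos; lra). nra. }
apply is_lim_spec; intros eps.
exists (Rmax T (C3 / eps)); intros t Ht.
assert (Ht1 := Rle_lt_trans _ _ _ (Rmax_l _ _) Ht).
assert (Ht2 := Rle_lt_trans _ _ _ (Rmax_r _ _) Ht).
rewrite Rminus_0_r; eapply Rle_lt_trans; [apply Hen; auto|].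
assert (Heps := cond_pos eps).
apply Rmult_lt_reg_r with t; [lra|].
unfold Rdiv; rewrite Rmult_assoc, Rinv_l by lra.
apply Rmult_lt_compat_r with (r := eps) in Ht2; auto.
unfold Rdiv in Ht2; rewrite Rmult_assoc, Rinv_l in Ht2 by lra; lra.
Qed.

(** * Bounds on the soliton with data close to a constant *)

Lemma Linf_sum_bound f g c :
  Rbar_lt (Rbar_plus (Linf_norm f) (Linf_norm g)) (Finite c) -> forall x, Rabs (f x) < c.
Proof.
intros H x.
assert (Hub : forall h y, Rbar_le (Finite (Rabs (h y))) (Linf_norm h)).
{ intros h y; apply (proj1 (Lub_Rbar_correct (fun z => exists x, z = Rabs (h x)))); exists y; auto. }
assert (Hf := Hub f x); assert (Hg := Hub g x).
generalize (Rabs_pos (f x)) (Rabs_pos (g x)); intros.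
destruct (Linf_norm f) as [a| |], (Linf_norm g) as [b| |]; simpl in *; try tauto; lra.
Qed.

(** [C atan] is a primitive of the bound. *)
Lemma comparison_decay (f df : R -> R) C :
  0 <= C -> (forall y, is_derive f y (df y)) -> (forall y, Rabs (df y) <= C * decay y) ->
  forall y, Rabs (f y - f 0) <= C * 2.
Proof.
intros HC HD Hb y.
assert (Hg : forall k z, is_derive (fun y => f y + k * atan y) z (df z + k * decay z)).
{ intros k z; apply (is_derive_plus f (fun y => k * atan y)); auto.
  apply (is_derive_scal atan), is_derive_atan. }
assert (Hat : Rabs (atan y) <= 2).
{ destruct (atan_bound y); generalize PI_4; intros; apply Rabs_le; lra. }
destruct (MVT_between (fun y => f y + C * atan y) (fun z => df z + C * decay z) 0 y) as [z1 [_ E1]]; auto.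
destruct (MVT_between (fun y => f y + - C * atan y) (fun z => df z + - C * decay z) 0 y) as [z2 [_ E2]]; auto.
assert (B1 := Hb z1); assert (B2 := Hb z2).
apply Rabs_le_between in B1; apply Rabs_le_between in B2; rewrite atan_0 in *.
apply Rabs_le_between in Hat.
assert (HCa : - (C * 2) <= C * atan y <= C * 2) by (split; nra).
apply Rabs_le; destruct (Rle_dec 0 y) as [H|H].
- assert (0 <= (df z1 + C * decay z1) * (y - 0)) by (apply Rmult_le_pos; lra).
  assert (0 <= - (df z2 + - C * decay z2) * (y - 0)) by (apply Rmult_le_pos; lra). lra.
- assert (0 <= (df z1 + C * decay z1) * (0 - y)) by (apply Rmult_le_pos; lra).
  assert (0 <= - (df z2 + - C * decay z2) * (0 - y)) by (apply Rmult_le_pos; lra). lra.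
Qed.

(** d'Alembert's formula, up to the integral of [d_t alpha], which is positive. *)
Lemma alpha_lower_bound alpha a0 alpha1 t x :
  Cinf alpha -> (forall t x, 0 <= t -> wave_at alpha t x) -> smooth_fun a0 ->
  (forall x, alpha 0 x = 1 + a0 x) -> (forall x, Dt alpha 0 x = alpha1 x) ->
  (forall x, 0 < alpha1 x) -> 0 <= t ->
  1 + (a0 (x + t) + a0 (x - t)) / 2 <= alpha t x.
Proof.
intros Ha Hw Has H0 H1 Hpos Ht.
assert (Hd0 : forall y, is_derive a0 y (Derive a0 y)) by (intros; apply Derive_correct, (Has 1%nat)).
assert (HDx : forall y, Dx alpha 0 y = Derive a0 y).
{ intros y; apply is_derive_unique, (is_derive_ext (fun y => 1 + a0 y)); [intros; auto|].
  rewrite <- (Rplus_0_l (Derive a0 y)); apply (is_derive_plus (fun _ => 1) a0); auto.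
  apply is_derive_Reals, derivable_pt_lim_const. }
assert (HDt : forall s, 0 <= s -> Dt alpha s x =
  (alpha1 (x + s) + Derive a0 (x + s) + (alpha1 (x - s) - Derive a0 (x - s))) / 2).
{ intros s Hs; destruct (wave_null_transport alpha s x Ha Hw Hs) as [E1 E2].
  replace (Dt alpha s x) with ((Dplus alpha s x + Dminus alpha s x) / 2) by (unfold Dplus, Dminus; field).
  rewrite E1, E2; unfold Dplus, Dminus; rewrite !H1, !HDx; field. }
rewrite (transport alpha (Dt alpha) (Dx alpha) t x 0); auto using Cinf_cont, Cinf_Dt, Cinf_Dx.
2:{ intros; apply Cinf_is_D; auto. }
rewrite H0; replace (x - 0 * t) with x by ring.
assert (HI : is_RInt (fun s => (Derive a0 (x + s) - Derive a0 (x - s)) / 2) 0 t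
   ((a0 (x + t) + a0 (x - t)) / 2 - (a0 (x + 0) + a0 (x - 0)) / 2)).
{ apply (is_RInt_derive (fun s => (a0 (x + s) + a0 (x - s)) / 2)).
  - intros s _.
    replace ((Derive a0 (x + s) - Derive a0 (x - s)) / 2) with
      (/ 2 * (1 * Derive a0 (x + s) + -1 * Derive a0 (x - s))) by field.
    apply (is_derive_ext (fun s => / 2 * (a0 (x + s) + a0 (x - s)))); [intros; simpl; field|].
    apply (is_derive_scal (fun s => a0 (x + s) + a0 (x - s))).
    apply (is_derive_plus (fun s => a0 (x + s)) (fun s => a0 (x - s))).
    + apply (is_derive_comp_R a0 (fun s => x + s)); auto; auto_derive; auto; ring.
    + apply (is_derive_comp_R a0 (fun s => x - s)); auto; auto_derive; auto; ring.
  - intros s _.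
    assert (Hc : forall y, continuous (Derive a0) y).
    { intros y; apply (ex_derive_continuous (Derive a0)), (Has 2%nat). }
    apply (continuous_mult (fun s => Derive a0 (x + s) - Derive a0 (x - s)) (fun _ => / 2)).
    + apply (continuous_minus (fun s => Derive a0 (x + s)) (fun s => Derive a0 (x - s))).
      * apply (continuous_comp (fun s => x + s) (Derive a0)); auto.
        apply (ex_derive_continuous (fun s => x + s)); auto_derive; auto.
      * apply (continuous_comp (fun s => x - s) (Derive a0)); auto.
        apply (ex_derive_continuous (fun s => x - s)); auto_derive; auto.
    + apply continuous_const. }
rewrite Rplus_0_r, Rminus_0_r in HI.
assert (Hle : (a0 (x + t) + a0 (x - t)) / 2 - (a0 x + a0 x) / 2 <=
   Ich 0 (fun s y => Dt alpha s y + 0 * Dx alpha s y) t x).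
{ rewrite <- (is_RInt_unique _ _ _ _ HI); apply RInt_le; auto.
  - eexists; apply HI.
  - apply (ex_Ich 0 (fun s y => Dt alpha s y + 0 * Dx alpha s y)).
    apply cont_plus, cont_mult; auto using cont_const, Cinf_cont, Cinf_Dt, Cinf_Dx.
  - intros s Hs; rewrite Rmax0_id by lra; replace (x - 0 * (t - s)) with x by ring.
    rewrite HDt by lra; generalize (Hpos (x + s)) (Hpos (x - s)); lra. }
lra.
Qed.

(** [beta - alpha] is constant along [x - t = const], and the initial [beta] has
    the integrable derivative [alpha1]. *)
Lemma conjugate_bounded alpha beta alpha1 C M :
  Cinf alpha -> conjugate_function alpha beta -> 0 <= C ->
  (forall x, Dt alpha 0 x = alpha1 x) -> (forall y, Rabs (alpha1 y) <= C * decay y) ->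
  (forall t x, 0 <= t -> 0 < alpha t x <= M) ->
  exists B, forall t x, 0 <= t -> Rabs (beta t x) <= B.
Proof.
intros Ha Hb HC H1 Hd HM.
assert (HbC := conjugate_Cinf alpha beta Ha Hb).
assert (Hf : Cinf (fun t x => beta t x - alpha t x)) by (apply Cinf_minus; auto).
assert (Htr : forall t x, 0 <= t -> beta t x - alpha t x = beta 0 (x - t) - alpha 0 (x - t)).
{ intros t x Ht.
  rewrite (transport (fun t x => beta t x - alpha t x) (fun t x => Dx alpha t x - Dt alpha t x)
    (fun t x => Dt alpha t x - Dx alpha t x) t x 1 Ht).
  - replace (x - 1 * t) with (x - t) by ring.
    assert (E : Ich 1 (fun s y => Dx alpha s y - Dt alpha s y + 1 * (Dt alpha s y - Dx alpha s y)) t x = 0).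
    { rewrite (Ich_ext 1 _ (fun _ _ => 0 * 1)) by (auto; intros; ring).
      rewrite (Ich_scal 1 0 (fun _ _ => 1)) by apply cont_const; ring. }
    rewrite E; ring.
  - intros s y Hs; destruct (Hb s y Hs) as [B1 B2]; split.
    + replace (Dx alpha s y - Dt alpha s y) with (Dx alpha s y + (0 * alpha s y + -1 * Dt alpha s y)) by ring.
      apply is_Dt_ext with (fun s y => beta s y + -1 * alpha s y); auto; [intros; ring|].
      apply is_Dt_plus; auto; apply is_Dt_mult; auto using is_Dt_const, Cinf_is_Dt.
    + apply (is_derive_minus (beta s) (alpha s)); auto; apply Cinf_is_Dx; auto.
  - apply cont_minus; auto using Cinf_cont, Cinf_Dt, Cinf_Dx.
  - apply cont_minus; auto using Cinf_cont, Cinf_Dt, Cinf_Dx. }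
assert (H0 : forall y, Rabs (beta 0 y - beta 0 0) <= C * 2).
{ apply (comparison_decay (beta 0) alpha1); auto.
  intros y; rewrite <- H1; apply Hb; lra. }
exists (C * 2 + Rabs (beta 0 0) + M + M); intros t x Ht.
replace (beta t x) with ((beta 0 (x - t) - beta 0 0) + beta 0 0 + (alpha t x - alpha 0 (x - t)))
  by (specialize (Htr t x Ht); lra).
eapply Rle_trans; [apply Rabs_triang|].
eapply Rle_trans; [apply Rplus_le_compat_r, Rabs_triang|].
assert (Rabs (alpha t x - alpha 0 (x - t)) <= M + M).
{ generalize (HM t x Ht) (HM 0 (x - t) ltac:(lra)); intros; apply Rabs_le; lra. }
specialize (H0 (x - t)); lra.
Qed.

Lemma sinh_le_mult L : 0 <= L <= 1 -> sinh L <= L * exp 1.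
Proof.
intros HL; destruct (MVT_between sinh cosh 0 L) as [z [Hz E]].
{ intros; apply is_derive_Reals, derivable_pt_lim_sinh. }
rewrite Rmin_left, Rmax_right in Hz by lra.
replace (sinh 0) with 0 in E by (unfold sinh; rewrite Ropp_0; lra).
assert (Hc := cosh_le z 1 ltac:(rewrite Rabs_right; lra)).
rewrite Rminus_0_r in E; rewrite E; nra.
Qed.

Lemma Rpower_mono_base a b d : 0 <= d -> 0 < a <= b -> Rpower a d <= Rpower b d.
Proof.
intros Hd Hab; apply Rle_Rpower_l; auto.
Qed.

(** [alpha] lies between two positive constants and [beta] is bounded, so [m] stays
    in a compact part of (0, 1).  Then the explicit entries bound [Lambda] away
    from 0 and infinity, and [soliton_speed] gives the decay of the derivatives. *)
Lemma soliton_bounds d Lambda phi alpha a0 alpha1 :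
  1 <= d -> one_soliton d Lambda phi alpha -> Cc_infty a0 -> Schwartz alpha1 ->
  (forall x, alpha 0 x = 1 + a0 x) -> (forall x, Dt alpha 0 x = alpha1 x) ->
  (forall x, 0 < alpha1 x) -> (forall x, Rabs (a0 x) <= / 2) ->
  Cinf alpha /\ Cinf Lambda /\ Cinf phi /\
  (forall t x, 0 <= t -> wave_at alpha t x /\ 0 < alpha t x) /\
  (forall t x, 0 <= t -> box_system Lambda phi alpha t x) /\
  exists c K, 0 < c /\ 0 < K /\ forall t x, 0 <= t ->
    c <= Lambda t x /\
    Rabs (rlog alpha 1 t x) <= K * decay (t + x) /\ Rabs (rlog alpha (-1) t x) <= K * decay (t - x) /\
    forall i, i <> Phi ->
      Rabs (field_of Lambda phi i t x) <= K * weight (decay (t + x)) (decay (t - x)) i.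
Proof.
intros Hd Hsol Ha0c Ha1 Hd0 Hd1 Hpos Hsmall.
destruct (soliton_frame_exists d Lambda phi alpha Hsol)
  as [beta [w [del [m [Hb [Hdel [Hsup [Hfr [Hme [Hphi Hg]]]]]]]]]].
assert (Hpol := soliton_is_polar d Lambda phi alpha m Hfr Hphi Hg).
assert (HLC : Cinf Lambda) by apply Hpol.
assert (Hfr' := Hfr); destruct Hfr' as [Ha [Hm [Hw [Ha0 [Hm0 _]]]]].
destruct Hsol as [[_ [_ [_ [M HM]]]] _].
split; [|split; [|split; [|split; [|split]]]]; auto.
{ intros t x Ht; apply (soliton_wave_map d Lambda phi alpha m t x Hfr Hpol Ht). }
destruct (m_gap alpha m beta w del M Hdel) as [eta [Heta Hgap]]; auto.
assert (Hlow : forall t x, 0 <= t -> / 2 <= alpha t x).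
{ intros t x Ht; eapply Rle_trans; [|apply (alpha_lower_bound alpha a0 alpha1); auto; apply Ha0c].
  generalize (Hsmall (x + t)) (Hsmall (x - t)); intros B1 B2.
  apply Rabs_le_between in B1; apply Rabs_le_between in B2; lra. }
destruct (Schwartz_decay alpha1 Ha1) as [C1 [HC1 D1]].
destruct (Cc_decay _ (Cc_Derive a0 Ha0c)) as [C2 [HC2 D2]].
assert (HDx : forall y, Dx alpha 0 y = Derive a0 y).
{ intros y; apply is_derive_unique, (is_derive_ext (fun y => 1 + a0 y)); [intros; auto|].
  rewrite <- (Rplus_0_l (Derive a0 y)); apply (is_derive_plus (fun _ => 1) a0).
  - apply is_derive_Reals, derivable_pt_lim_const.
  - apply Derive_correct, (proj1 Ha0c 1%nat). }
assert (Hnull : forall s y, Rabs s <= 1 -> Rabs (Dt alpha 0 y + s * Dx alpha 0 y) <= (C1 + C2) * decay y).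
{ intros s y Hs; rewrite Hd1, HDx; eapply Rle_trans; [apply Rabs_triang|]; rewrite Rabs_mult.
  specialize (D1 y); specialize (D2 y); generalize (Rabs_pos (Derive a0 y)); nra. }
assert (Hr := rlog_decay alpha (/ 2) (C1 + C2) Ha Hw ltac:(lra) Hlow
  (fun y => Hnull 1 y ltac:(rewrite Rabs_right; lra)) (fun y => Hnull (-1) y ltac:(rewrite Rabs_left; lra))).
set (Kr := (C1 + C2) / / 2) in Hr.
assert (HKr : 0 < Kr) by (unfold Kr; lra).
destruct (conjugate_bounded alpha beta alpha1 C1 M Ha Hb (Rlt_le _ _ HC1) Hd1 D1) as [B HB]; auto.
(* [1 / m <= m + 1 / m = 2 (w - beta) / alpha] is bounded *)
set (W := Rabs w + Rabs B + 1).
assert (HW : 0 < W) by (unfold W; generalize (Rabs_pos w) (Rabs_pos B); lra).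
set (m0 := / (4 * W)).
assert (Hm00 : 0 < m0) by (apply Rinv_0_lt_compat; lra).
assert (Hmlow : forall t x, 0 <= t -> m0 <= m t x).
{ intros t x Ht; specialize (Hme t x Ht); specialize (Hlow t x Ht); destruct (Hm0 t x Ht) as [M1 M2].
  specialize (HB t x Ht); apply Rabs_le_between in HB.
  assert (HwB : w - beta t x <= W) by (unfold W; generalize (Rle_abs w) (Rle_abs B); lra).
  apply Rmult_le_reg_r with (4 * W); [lra|]; unfold m0; rewrite Rinv_l by lra.
  assert (alpha t x * 1 <= alpha t x * (m t x * m t x + 1)) by (apply Rmult_le_compat_l; nra).
  assert ((w - beta t x) * m t x <= W * m t x) by (apply Rmult_le_compat_r; lra). lra. }
set (P0 := Rpower m0 d); assert (HP0 : 0 < P0) by apply exp_pos.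
(* lower bound of the off-diagonal entry [sin 2phi sinh Lambda] *)
set (s0 := P0 * eta / 2).
assert (Hs0 : 0 < s0) by (unfold s0; apply Rdiv_lt_0_compat; [apply Rmult_lt_0_compat|]; lra).
assert (Hsinh : forall t x, 0 <= t -> s0 <= sinh (Lambda t x)).
{ intros t x Ht; destruct Hpol as [_ [_ [HL0 HE]]].
  destruct (HE t x Ht) as [_ [_ E]]; cbv zeta in E.
  assert (HS := sinh_pos _ (HL0 t x Ht)).
  apply Rle_trans with (sin (2 * phi t x) * sinh (Lambda t x)).
  2:{ destruct (SIN_bound (2 * phi t x)); nra. }
  rewrite E; clear E; unfold G12.
  destruct (Hm0 t x Ht) as [M1 M2]; specialize (Hmlow t x Ht); specialize (Hgap t x Ht).
  assert (HP1 : P0 <= Rpower (m t x) d) by (apply Rpower_mono_base; lra).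
  assert (HP2 : Rpower (m t x) d <= 1).
  { replace 1 with (Rpower 1 d) by (unfold Rpower; rewrite ln_1, Rmult_0_r; apply exp_0); apply Rpower_mono_base; lra. }
  set (P := Rpower (m t x) d) in *.
  apply Rmult_le_reg_r with (m t x * (P * P + 1)); [nra|].
  unfold Rdiv at 1; rewrite Rmult_assoc, Rinv_l, Rmult_1_r by nra.
  apply Rle_trans with (s0 * 2); [apply Rmult_le_compat_l; nra|].
  unfold s0; replace (P0 * eta / 2 * 2) with (P0 * eta) by field.
  apply Rmult_le_compat; nra. }
set (A1 := Rpower M d); set (A0 := Rpower (/ 2) d).
assert (HA1 : 0 < A1) by apply exp_pos; assert (HA0 : 0 < A0) by apply exp_pos.
set (KL := A1 * / m0 + / (A0 * m0)).
assert (HKL : 0 < KL).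
{ unfold KL; apply Rplus_lt_0_compat; [apply Rmult_lt_0_compat; auto; apply Rinv_0_lt_compat; auto|].
  apply Rinv_0_lt_compat, Rmult_lt_0_compat; auto. }
assert (HLup : forall t x, 0 <= t -> Lambda t x <= KL).
{ intros t x Ht; destruct Hpol as [_ [_ [HL0 HE]]].
  destruct (HE t x Ht) as [E1 [E2 _]]; cbv zeta in E1, E2.
  apply Rle_trans with (exp (Lambda t x)); [generalize (exp_ineq1_le (Lambda t x)); lra|].
  apply Rle_trans with (cosh (Lambda t x) + cosh (Lambda t x)).
  { unfold cosh; generalize (exp_pos (- Lambda t x)); lra. }
  replace (cosh (Lambda t x) + cosh (Lambda t x)) with
    (G11 (Rpower (alpha t x) d) (Rpower (m t x) d) (m t x) + G22 (Rpower (alpha t x) d) (Rpower (m t x) d) (m t x))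
    by (rewrite <- E1, <- E2; ring).
  destruct (Hm0 t x Ht) as [M1 M2]; specialize (Hmlow t x Ht); specialize (Hlow t x Ht).
  assert (HA2 : Rpower (alpha t x) d <= A1) by (apply Rpower_mono_base; auto; lra).
  assert (HA3 : A0 <= Rpower (alpha t x) d) by (apply Rpower_mono_base; lra).
  assert (HPp : 0 < Rpower (m t x) d) by apply exp_pos.
  set (A := Rpower (alpha t x) d) in *; set (P := Rpower (m t x) d) in *.
  assert (Him : / m t x <= / m0) by (apply Rinv_le_contravar; auto).
  assert (Him0 : 0 < / m t x) by (apply Rinv_0_lt_compat; auto).
  assert (Hq : forall u, 0 <= u <= P * P + 1 -> u / (P * P + 1) <= 1).
  { intros u Hu; apply Rmult_le_reg_r with (P * P + 1); [nra|].
    unfold Rdiv; rewrite Rmult_assoc, Rinv_l by nra; lra. }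
  assert (Hmm : m t x * m t x <= 1) by nra.
  assert (HPP : 0 < P * P) by (apply Rmult_lt_0_compat; auto).
  unfold G11, G22, KL; apply Rplus_le_compat.
  - replace (A * (m t x * m t x * (P * P) + 1) / (m t x * (P * P + 1))) with
      (A * / m t x * ((m t x * m t x * (P * P) + 1) / (P * P + 1))) by (field; lra).
    apply Rle_trans with (A * / m t x * 1).
    + apply Rmult_le_compat_l; [apply Rmult_le_pos; lra|]; apply Hq; nra.
    + rewrite Rmult_1_r; apply Rmult_le_compat; lra.
  - assert (HAi : 0 < / (A * m t x)) by (apply Rinv_0_lt_compat, Rmult_lt_0_compat; lra).
    replace ((P * P + m t x * m t x) / (A * m t x * (P * P + 1))) with
      (/ (A * m t x) * ((P * P + m t x * m t x) / (P * P + 1))) by (field; lra).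
    apply Rle_trans with (/ (A * m t x) * 1).
    + apply Rmult_le_compat_l; [lra|]; apply Hq; nra.
    + rewrite Rmult_1_r; apply Rinv_le_contravar; [apply Rmult_lt_0_compat; auto|].
      apply Rmult_le_compat; lra. }
assert (He2 : 0 < 2 / eta) by (apply Rdiv_lt_0_compat; lra).
set (Ks := Kr * (d + 2 / eta)).
assert (HKs : 0 < Ks) by (apply Rmult_lt_0_compat; lra).
assert (Hspeed : forall s t x y, s * s = 1 -> 0 <= t -> Rabs (rlog alpha s t x) <= Kr * decay y ->
  Rabs (Dt Lambda t x + s * Dx Lambda t x) <= Ks * decay y /\
  Rabs (Dt phi t x + s * Dx phi t x) <= Ks / s0 * decay y).
{ intros s t x y Hs Ht Hry.
  assert (H1 := soliton_speed d Lambda phi alpha m s t x Hd Hfr Hpol Hs Ht); cbv zeta in H1.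
  set (l := Dt Lambda t x + s * Dx Lambda t x) in *; set (f := Dt phi t x + s * Dx phi t x) in *.
  destruct (kappa_bound s (m t x) eta Hs (proj1 (Hm0 t x Ht)) (proj1 Heta) (Hgap t x Ht)) as [K1 K2].
  assert (H2 : Rabs (rlog alpha s t x * (d + kappa s (m t x))) <= Ks * decay y).
  { replace (Ks * decay y) with (Kr * decay y * (d + 2 / eta)) by (unfold Ks; ring).
    apply mult_bound; auto; rewrite Rabs_right; lra. }
  assert (Hdy := decay_pos y); specialize (Hsinh t x Ht).
  assert (HKd : 0 <= Ks * decay y) by (apply Rmult_le_pos; lra).
  assert (H3 : (rlog alpha s t x * (d + kappa s (m t x))) ^ 2 <= (Ks * decay y) ^ 2).
  { rewrite <- (pow2_abs (rlog alpha s t x * _)); apply pow_incr; split; auto; apply Rabs_pos. }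
  assert (Hsqr : forall u v, 0 <= v -> u * u <= v ^ 2 -> Rabs u <= v).
  { intros u v Hv Huv; apply Rabs_le; split; nra. }
  assert (Hf2 : 0 <= f * f) by apply Rle_0_sqr.
  assert (Hl2 : 0 <= l * l) by apply Rle_0_sqr.
  assert (Hss : s0 * s0 <= sinh (Lambda t x) * sinh (Lambda t x)) by (apply Rmult_le_compat; lra).
  split; [apply Hsqr; nra|].
  replace (Ks / s0 * decay y) with (Ks * decay y * / s0) by (field; lra).
  apply Rmult_le_reg_r with s0; auto; rewrite Rmult_assoc, Rinv_l, Rmult_1_r by lra.
  rewrite <- (Rabs_right s0) by lra; rewrite <- Rabs_mult; apply Hsqr; auto.
  assert (s0 * s0 * (f * f) <= sinh (Lambda t x) * sinh (Lambda t x) * (f * f)) by (apply Rmult_le_compat_r; auto).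
  assert (0 <= sinh (Lambda t x) * sinh (Lambda t x) * (f * f)) by (apply Rmult_le_pos; auto; apply Rle_0_sqr).
  replace (f * s0 * (f * s0)) with (s0 * s0 * (f * f)) by ring. lra. }
exists (Rmin 1 (s0 * / exp 1)), (Kr + KL + Ks + Ks / s0).
assert (Hex : 0 < / exp 1) by (apply Rinv_0_lt_compat, exp_pos).
assert (HKss : 0 < Ks / s0) by (apply Rdiv_lt_0_compat; auto).
split; [apply Rmin_glb_lt; [lra|apply Rmult_lt_0_compat; auto]|split; [lra|]].
intros t x Ht; destruct (Hr t x Ht) as [R1 R2].
assert (D3 := decay_pos (t + x)); assert (D4 := decay_pos (t - x)).
assert (Hwk : forall k y u, k <= Kr + KL + Ks + Ks / s0 -> 0 < decay y -> Rabs u <= k * decay y ->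
   Rabs u <= (Kr + KL + Ks + Ks / s0) * decay y).
{ intros k y u Hk Hy Hu; eapply Rle_trans; [apply Hu|]; apply Rmult_le_compat_r; lra. }
split; [|split; [|split]].
- destruct (Rle_dec (Lambda t x) 1) as [H|H]; [|generalize (Rmin_l 1 (s0 * / exp 1)); lra].
  apply Rle_trans with (1 := Rmin_r _ _).
  apply Rmult_le_reg_r with (exp 1); [apply exp_pos|].
  rewrite Rmult_assoc, Rinv_l, Rmult_1_r by apply Rgt_not_eq, exp_pos.
  apply Rle_trans with (1 := Hsinh t x Ht), sinh_le_mult.
  destruct Hpol as [_ [_ [HL0 _]]]; specialize (HL0 t x Ht); lra.
- apply Hwk with Kr; auto; lra.
- apply Hwk with Kr; auto; lra.
- destruct (Hspeed 1 t x (t + x) ltac:(ring) Ht R1) as [S1 S2].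
  destruct (Hspeed (-1) t x (t - x) ltac:(ring) Ht R2) as [S3 S4].
  intros [| | | | |] Hi; simpl.
  + specialize (HLup t x Ht); destruct Hpol as [_ [_ [HL0 _]]]; specialize (HL0 t x Ht).
    rewrite Rabs_right; lra.
  + tauto.
  + apply Hwk with Ks; auto; lra.
  + apply Hwk with Ks; auto; lra.
  + apply Hwk with (Ks / s0); auto; lra.
  + apply Hwk with (Ks / s0); auto; lra.
Qed.

(** * Global solutions near the soliton *)

Lemma Cinf_rlog alpha s : Cinf alpha -> (forall t x, 0 <= t -> 0 < alpha t x) -> Cinf (rlog alpha s).
Proof.
intros Ha H0; apply Cinf_div; auto.
- intros t x Ht; specialize (H0 t x Ht); lra.
- apply Cinf_plus, Cinf_mult; auto using Cinf_const, Cinf_Dt, Cinf_Dx.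
Qed.

(** [Lambda'] may vanish, where the equation for [phi'] degenerates; but as long as
    it is within [k] of [Lambda >= 2 k] the Lipschitz bounds apply. *)
Lemma solution_unique T Lambda phi Lambda' phi' alpha k :
  Cinf alpha -> (forall t x, 0 <= t -> 0 < alpha t x) -> Cinf Lambda -> Cinf phi -> 0 < k ->
  (forall t x, 0 <= t -> 2 * k <= Lambda t x /\ box_system Lambda phi alpha t x) ->
  solution_before T Lambda' phi' alpha ->
  (forall x, Lambda' 0 x = Lambda 0 x /\ phi' 0 x = phi 0 x /\
     Dt Lambda' 0 x = Dt Lambda 0 x /\ Dt phi' 0 x = Dt phi 0 x) ->
  forall t x, before T t -> Lambda' t x = Lambda t x /\ phi' t x = phi t x.
Proof.
intros Ha Ha0 HL Hp Hk Hsys [HL' [Hp' [Ha' Hsol]]] Hdata t1 x1 Ht1.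
assert (Ht10 : 0 <= t1) by apply Ht1.
assert (Ht1i : before p_infty t1) by (apply before_infty; auto).
assert (HLs := Cinf_smooth _ HL); assert (Hps := Cinf_smooth _ Hp).
set (V := fun i s y => field_of Lambda' phi' i (Rmin s t1) y).
set (U := fun i s y => field_of Lambda phi i (Rmin s t1) y).
assert (HVc : forall i, cont (V i)).
{ destruct (null_transport T Lambda' t1 HL' Ht1) as [C1 [C2 [C3 _]]].
  destruct (null_transport T phi' t1 Hp' Ht1) as [C4 [C5 [C6 _]]].
  intros []; assumption. }
assert (HUc : forall i, cont (U i)).
{ destruct (null_transport p_infty Lambda t1 HLs Ht1i) as [C1 [C2 [C3 _]]].
  destruct (null_transport p_infty phi t1 Hps Ht1i) as [C4 [C5 [C6 _]]].
  intros []; assumption. }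
set (D := fun i s y => V i s y - U i s y).
set (g := fun i s y => rhs k alpha i s y (fun j => V j s y) - rhs k alpha i s y (fun j => U j s y)).
assert (Hr := Cinf_cont _ (Cinf_rlog alpha 1 Ha Ha0)); assert (Hs := Cinf_cont _ (Cinf_rlog alpha (-1) Ha Ha0)).
set (X := Rabs x1 + t1).
destruct (list_upper_bound field (fun i M => forall t x, 0 <= t <= t1 -> Rabs x <= X -> Rabs (U i t x) <= M) fields)
  as [M1 HM1].
{ intros i M M' HMM H t x Ht Hx; specialize (H t x Ht Hx); lra. }
{ intros i; destruct (cont_bounded (U i) t1 X (HUc i)) as [M [_ HM]]; exists M; auto. }
destruct (cont_bounded _ t1 X Hr) as [M2 [HM2 Hrb]], (cont_bounded _ t1 X Hs) as [M3 [HM3 Hsb]].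
set (K := Rabs M1 + k + M2 + M3).
assert (HK : 0 < K) by (unfold K; generalize (Rabs_pos M1); lra).
destruct (rhs_lip k K Hk HK) as [C [HC Hlip]].
assert (Hfin : forall i t x, 0 <= t /\ Rabs (x - x1) + t <= t1 -> D i t x = 0).
{ apply (difference_vanishes field fields speed D g t1 x1 (C + 1) k
    (fun t x => 0 <= t /\ Rabs (x - x1) + t <= t1)); auto using in_fields; try lra.
  - intros []; simpl; unfold Rabs; destruct Rcase_abs; lra.
  - intros i; apply cont_minus; auto.
  - intros i; apply cont_minus; apply rhs_cont; auto.
  - intros i x; unfold D, V, U; rewrite Rmin_left by auto.
    destruct (Hdata x) as [D1 [D2 [D3 D4]]].
    assert (D5 : Dx Lambda' 0 x = Dx Lambda 0 x) by (apply Derive_ext; intros; apply Hdata).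
    assert (D6 : Dx phi' 0 x = Dx phi 0 x) by (apply Derive_ext; intros; apply Hdata).
    destruct i; simpl; unfold Dplus, Dminus; rewrite ?D1, ?D2, ?D3, ?D4, ?D5, ?D6; ring.
  - intros i t x B [Ht Hx] HB HDB.
    assert (Hx1 := Rabs_pos (x - x1)).
    assert (HxX : Rabs x <= X) by (apply Rabs_sub_bound with x1; lra).
    assert (HB0 : 0 <= B) by (apply Rle_trans with (2 := HDB Lam), Rabs_pos).
    assert (HUb : forall i, Rabs (U i t x) <= Rabs M1).
    { intros j; apply Rle_trans with (2 := Rle_abs M1); apply HM1; auto using in_fields; lra. }
    assert (HVb : forall i, Rabs (V i t x) <= Rabs M1 + k).
    { intros j; apply Rabs_sub_bound with (U j t x); auto; apply Rle_trans with B; auto; apply HDB. }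
    assert (Hw : forall i, weight 1 1 i = 1) by (intros []; reflexivity).
    destruct (Hlip (rlog alpha 1 t x) (rlog alpha (-1) t x) 1 1 B
      (fun j => V j t x) (fun j => U j t x)) as [L1 L2]; try lra.
    + rewrite Rmult_1_r; apply Rle_trans with M2; [apply Hrb; auto; lra|].
      unfold K; generalize (Rabs_pos M1); lra.
    + rewrite Rmult_1_r; apply Rle_trans with M3; [apply Hsb; auto; lra|].
      unfold K; generalize (Rabs_pos M1); lra.
    + intros j _; rewrite Hw, Rmult_1_r; apply Rle_trans with (1 := HVb j); unfold K; lra.
    + intros j _; rewrite Hw, Rmult_1_r; apply Rle_trans with (1 := HUb j); unfold K; lra.
    + intros j; rewrite Hw, Rmult_1_r; apply HDB.
    + assert (Hhalf : forall p q, Rabs (V p t x - U p t x) <= B -> Rabs (V q t x - U q t x) <= B ->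
        Rabs ((V p t x + V q t x) / 2 - (U p t x + U q t x) / 2) <= (C + 1) * B).
      { intros p q H1 H2; apply Rle_trans with B; [|nra].
        apply Rabs_le_between in H1; apply Rabs_le_between in H2; apply Rabs_le; lra. }
      assert (HDB' : forall j, Rabs (V j t x - U j t x) <= B) by exact HDB.
      assert (HL1 := Rle_trans _ _ ((C + 1) * B) L1 ltac:(lra)).
      assert (HL2 := Rle_trans _ _ ((C + 1) * B) L2 ltac:(lra)).
      destruct i.
      * exact (Hhalf LamP LamM (HDB' _) (HDB' _)).
      * exact (Hhalf PhiP PhiM (HDB' _) (HDB' _)).
      * exact HL1.
      * exact HL1.
      * exact HL2.
      * exact HL2.
  - intros i t x [Ht Hx] Hsmall.
    assert (Htt : 0 <= t <= t1) by (generalize (Rabs_pos (x - x1)); lra).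
    unfold D, V, U; rewrite (Rmin_left t) by lra.
    rewrite (solution_mild T k Lambda' phi' alpha t1 t x i HL' Hp' Ht1 Htt Hk).
    2:{ intros s Hst y.
        assert (Hst' : before T s) by (apply before_le with (1 := Ht1); lra).
        assert (HLk : k <= Lambda' s y).
        { specialize (Hsmall Lam s Hst); fold y in Hsmall; unfold D, V, U in Hsmall; simpl in Hsmall.
          rewrite !Rmin_left in Hsmall by lra; apply Rabs_le_between in Hsmall.
          destruct (Hsys s y ltac:(lra)) as [H _]; lra. }
        assert (Hay : 0 < alpha s y) by (apply Ha0; lra).
        destruct (Hsol s y Hst') as [E1 [E2 _]].
        split; [auto|split].
        - exact (proj1 (Lambda_eq_box T Lambda' phi' alpha s y HL' Ha' Hst' Hay) E1).
        - assert (HLy : 0 < Lambda' s y) by lra.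
          exact (proj1 (phi_eq_box T Lambda' phi' alpha s y HL' Hp' Ha' Hst' Hay HLy) E2). }
    rewrite (solution_mild p_infty k Lambda phi alpha t1 t x i HLs Hps Ht1i Htt Hk).
    2:{ intros s Hst y; destruct (Hsys s y ltac:(lra)) as [H1 [H2 H3]].
        split; [lra|split; auto]. }
    assert (E0 : field_of Lambda' phi' i 0 (x - speed i * t) = field_of Lambda phi i 0 (x - speed i * t)).
    { set (y := x - speed i * t).
      assert (D5 : Dx Lambda' 0 y = Dx Lambda 0 y) by (apply Derive_ext; intros; apply Hdata).
      assert (D6 : Dx phi' 0 y = Dx phi 0 y) by (apply Derive_ext; intros; apply Hdata).
      destruct (Hdata y) as [D1 [D2 [D3 D4]]].
      destruct i; simpl; unfold Dplus, Dminus; rewrite ?D1, ?D2, ?D3, ?D4, ?D5, ?D6; auto. }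
    rewrite E0; unfold g.
    rewrite Ich_minus by (apply rhs_cont; auto).
    rewrite (Ich_ext _ (fun t x => rhs k alpha i t x (fun j => V j t x))
      (fun s y => rhs k alpha i (Rmin s t1) y (fun j => field_of Lambda' phi' j (Rmin s t1) y)) t x Ht).
    2:{ intros s Hst; rewrite (Rmin_left s) by lra; unfold V; rewrite Rmin_left by lra; auto. }
    rewrite (Ich_ext _ (fun t x => rhs k alpha i t x (fun j => U j t x))
      (fun s y => rhs k alpha i (Rmin s t1) y (fun j => field_of Lambda phi j (Rmin s t1) y)) t x Ht).
    2:{ intros s Hst; rewrite (Rmin_left s) by lra; unfold U; rewrite Rmin_left by lra; auto. }
    ring. }
assert (Hx1 : 0 <= t1 /\ Rabs (x1 - x1) + t1 <= t1) by (rewrite Rminus_diag, Rabs_R0; lra).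
generalize (Hfin Lam t1 x1 Hx1) (Hfin Phi t1 x1 Hx1); unfold D, V, U; simpl; rewrite !Rmin_left by lra; lra.
Qed.

(** The null derivatives used as unknowns are those of the field itself once
    this holds at [t = 0]. *)
Lemma null_unknowns_consistent f fp fm G :
  Cinf f -> Cinf fp -> Cinf fm ->
  (forall t x, 0 <= t -> is_Dt f t x ((fp t x + fm t x) / 2)) ->
  (forall t x, 0 <= t -> is_Dt fp t x (G t x - -1 * Dx fp t x)) ->
  (forall t x, 0 <= t -> is_Dt fm t x (G t x - 1 * Dx fm t x)) ->
  (forall x, Dx f 0 x = (fp 0 x - fm 0 x) / 2) ->
  forall t x, 0 <= t -> Dplus f t x = fp t x /\ Dminus f t x = fm t x /\ box f t x = G t x.
Proof.
intros Hf Hp Hm Df Dp Dm H0.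
assert (Ef : forall t x, 0 <= t -> Dt f t x = (fp t x + fm t x) / 2) by (intros; apply is_Dt_unique; auto).
assert (Ep : forall t x, 0 <= t -> Dt fp t x = G t x - -1 * Dx fp t x) by (intros; apply is_Dt_unique; auto).
assert (Em : forall t x, 0 <= t -> Dt fm t x = G t x - 1 * Dx fm t x) by (intros; apply is_Dt_unique; auto).
assert (Hsum : forall t x, 0 <= t -> Dx (Dt f) t x = (Dx fp t x + Dx fm t x) / 2).
{ intros t x Ht; apply is_derive_unique, (is_derive_ext (fun y => / 2 * (fp t y + fm t y))).
  { intros; rewrite Ef by auto; simpl; field. }
  replace ((Dx fp t x + Dx fm t x) / 2) with (/ 2 * (Dx fp t x + Dx fm t x)) by field.
  apply (is_derive_scal (fun y => fp t y + fm t y)), (is_derive_plus (fp t) (fm t)); apply Cinf_is_Dx; auto. }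
set (h := fun t x => Dx f t x - / 2 * (fp t x - fm t x)).
assert (Hh : Cinf h).
{ apply Cinf_minus; [apply Cinf_Dx; auto|apply Cinf_mult; auto using Cinf_const, Cinf_minus]. }
assert (Eh : forall t x, 0 <= t -> Dt h t x = 0).
{ intros t x Ht; apply is_Dt_unique; auto.
  assert (D1 := isD_Cinf 0 (Dx f) t x (Cinf_Dx _ Hf) Ht).
  assert (D2 := isD_Cinf 0 fp t x Hp Ht); assert (D3 := isD_Cinf 0 fm t x Hm Ht).
  assert (D4 : exists l, isD 0 h t x l /\ l = 0).
  { unfold h; eexists; split; [isD_auto; lra|]; cbv beta.
    rewrite (Dt_Dx_comm f), Hsum, Ep, Em by auto; field. }
  destruct D4 as [l [[a [b [Ha [Hb El]]]] E]].
  replace 0 with a by lra; auto. }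
assert (Hh0 : forall t x, 0 <= t -> h t x = 0).
{ intros t x Ht; rewrite (transport h (Dt h) (Dx h) t x 0); auto using Cinf_cont, Cinf_Dt, Cinf_Dx.
  2:{ intros; apply Cinf_is_D; auto. }
  rewrite (Ich_ext 0 _ (fun _ _ => 0 * 1)) by (auto; intros; rewrite Eh by lra; ring).
  rewrite (Ich_scal 0 0 (fun _ _ => 1)) by apply cont_const.
  unfold h; rewrite H0; field. }
assert (Ex : forall t x, 0 <= t -> Dx f t x = (fp t x - fm t x) / 2).
{ intros t x Ht; specialize (Hh0 t x Ht); unfold h in Hh0; lra. }
intros t x Ht; split; [|split].
- unfold Dplus; rewrite Ef, Ex by auto; field.
- unfold Dminus; rewrite Ef, Ex by auto; field.
- unfold box.
  replace (Dt (Dt f) t x) with (G t x + (Dx fp t x - Dx fm t x) / 2).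
  2:{ symmetry; apply is_Dt_unique; auto.
      apply is_Dt_ext with (fun t x => / 2 * (fp t x + fm t x)); auto.
      { intros; rewrite Ef by auto; field. }
      replace (_ + _) with (0 * (fp t x + fm t x) + / 2 * ((G t x - -1 * Dx fp t x) + (G t x - 1 * Dx fm t x))) by field.
      apply (is_Dt_mult (fun _ _ => / 2) (fun t x => fp t x + fm t x)); auto using is_Dt_const, is_Dt_plus. }
  replace (Dx (Dx f) t x) with ((Dx fp t x - Dx fm t x) / 2); [ring|].
  symmetry; apply is_derive_unique, (is_derive_ext (fun y => / 2 * (fp t y - fm t y))).
  { intros; rewrite Ex by auto; simpl; field. }
  replace ((Dx fp t x - Dx fm t x) / 2) with (/ 2 * (Dx fp t x - Dx fm t x)) by field.
  apply (is_derive_scal (fun y => fp t y - fm t y)), (is_derive_minus (fp t) (fm t)); apply Cinf_is_Dx; auto.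
Qed.

(** Chain rule for quantities transported at speed 0, which need not be
    differentiable in [x]. *)
Lemma mild_comp (h dh : R -> R) (P : R -> Prop) U U0 g :
  cont g -> (forall t x, 0 <= t -> U t x = U0 (x - 0 * t) + Ich 0 g t x) ->
  (forall t x, 0 <= t -> P (U t x)) ->
  (forall z, P z -> is_derive h z (dh z)) -> (forall z, P z -> continuous dh z) ->
  forall t x, 0 <= t -> h (U t x) = h (U0 (x - 0 * t)) + Ich 0 (fun t x => dh (U t x) * g t x) t x.
Proof.
intros Hg HU HP Hh Hdh t x Ht.
set (G := fun s => g (Rmax 0 s) (x - 0 * (t - s))).
set (V := fun s => U0 (x - 0 * t) + RInt G 0 s).
assert (HV : forall s, is_derive V s (G s)).
{ intros s; unfold V; rewrite <- (Rplus_0_l (G s)).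
  apply (is_derive_plus (fun _ => U0 (x - 0 * t)) (fun s => RInt G 0 s)).
  - apply is_derive_Reals, derivable_pt_lim_const.
  - apply (is_derive_RInt G _ 0).
    + exists (mkposreal _ Rlt_0_1); intros; apply (RInt_correct (V := R_CompleteNormedModule)).
      apply (ex_Ich 0 g t x); auto.
    + apply (cont_on_char g 0 t x); auto. }
assert (EV : forall s, 0 <= s -> V s = U s x).
{ intros s Hs; rewrite HU by auto; unfold V, Ich; f_equal; [f_equal; ring|].
  apply RInt_ext; intros; unfold G; f_equal; ring. }
assert (HI : is_RInt (fun s => G s * dh (V s)) 0 t (h (V t) - h (V 0))).
{ apply (is_RInt_derive (fun s => h (V s))); rewrite Rmin_left, Rmax_right by auto; intros s Hs.
  - apply is_derive_comp_R; auto; apply Hh; rewrite EV by lra; apply HP; lra.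
  - apply (continuous_mult G (fun s => dh (V s))).
    + apply (cont_on_char g 0 t x); auto.
    + apply (continuous_comp V dh).
      * apply (ex_derive_continuous V); eexists; apply HV.
      * apply Hdh; rewrite EV by lra; apply HP; lra. }
assert (E0 : V 0 = U0 (x - 0 * t)).
{ unfold V; rewrite (RInt_point (V := R_CompleteNormedModule)); apply Rplus_0_r. }
rewrite E0, (EV t Ht) in HI.
replace (Ich 0 (fun t x => dh (U t x) * g t x) t x) with (h (U t x) - h (U0 (x - 0 * t))); [ring|].
rewrite <- (is_RInt_unique _ _ _ _ HI); apply RInt_ext; intros s Hs.
rewrite Rmin_left, Rmax_right in Hs by auto.
unfold G; rewrite Rmax0_id, EV by lra; replace (x - 0 * (t - s)) with x by ring.
exact (Rmult_comm _ _).
Qed.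

Lemma smooth_fun_plus f g : smooth_fun f -> smooth_fun g -> smooth_fun (fun x => f x + g x).
Proof.
intros Hf Hg; apply (Cinf_slice (fun _ x => f x + g x) 0); [|lra].
apply (Cinf_plus (fun _ x => f x) (fun _ x => g x)); apply smooth_fun_Cinf; auto.
Qed.

Lemma smooth_fun_scal c f : smooth_fun f -> smooth_fun (fun x => c * f x).
Proof.
intros Hf; apply (Cinf_slice (fun _ x => c * f x) 0); [|lra].
apply (Cinf_mult (fun _ _ => c) (fun _ x => f x)); [apply Cinf_const|apply smooth_fun_Cinf; auto].
Qed.

Definition field_data (L0 p0 L1 p1 : R -> R) (i : field) (x : R) : R :=
  match i with
  | Lam => L0 x | Phi => p0 x
  | LamP => L1 x + Derive L0 x | LamM => L1 x - Derive L0 x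
  | PhiP => p1 x + Derive p0 x | PhiM => p1 x - Derive p0 x
  end.

Lemma field_data_decay L0 p0 L1 p1 :
  Cc_infty L0 -> Cc_infty p0 -> Cc_infty L1 -> Cc_infty p1 ->
  exists C, 0 < C /\ forall i y, Rabs (field_data L0 p0 L1 p1 i y) <= C * weight (decay y) (decay y) i.
Proof.
intros H1 H2 H3 H4.
destruct (Cc_decay _ H1) as [C1 [P1 B1]], (Cc_decay _ H2) as [C2 [P2 B2]],
  (Cc_decay _ H3) as [C3 [P3 B3]], (Cc_decay _ H4) as [C4 [P4 B4]],
  (Cc_decay _ (Cc_Derive _ H1)) as [C5 [P5 B5]], (Cc_decay _ (Cc_Derive _ H2)) as [C6 [P6 B6]].
exists (C1 + C2 + C3 + C4 + C5 + C6); split; [lra|]; intros i y.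
specialize (B1 y); specialize (B2 y); specialize (B3 y); specialize (B4 y); specialize (B5 y); specialize (B6 y).
assert (Hd := decay_pos y).
assert (Hpos : forall C, 0 < C -> 0 < C * decay y <= C).
{ intros C HC; split; [apply Rmult_lt_0_compat; lra|nra]. }
generalize (Hpos _ P1) (Hpos _ P2) (Hpos _ P3) (Hpos _ P4) (Hpos _ P5) (Hpos _ P6); intros.
destruct i; simpl; try lra;
  (eapply Rle_trans; [apply Rabs_triang|]; rewrite ?Rabs_Ropp; lra).
Qed.

Lemma smooth_fun_minus f g : smooth_fun f -> smooth_fun g -> smooth_fun (fun x => f x - g x).
Proof.
intros Hf Hg; apply (Cinf_slice (fun _ x => f x - g x) 0); [|lra].
apply (Cinf_minus (fun _ x => f x) (fun _ x => g x)); apply smooth_fun_Cinf; auto.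
Qed.

Lemma field_data_smooth L0 p0 L1 p1 :
  smooth_fun L0 -> smooth_fun p0 -> smooth_fun L1 -> smooth_fun p1 ->
  forall i, smooth_fun (field_data L0 p0 L1 p1 i).
Proof.
intros H1 H2 H3 H4; assert (D1 := smooth_fun_Derive _ H1); assert (D2 := smooth_fun_Derive _ H2).
intros []; simpl; auto.
- exact (smooth_fun_plus L1 (Derive L0) H3 D1).
- exact (smooth_fun_minus L1 (Derive L0) H3 D1).
- exact (smooth_fun_plus p1 (Derive p0) H4 D2).
- exact (smooth_fun_minus p1 (Derive p0) H4 D2).
Qed.

(** [phase] is bounded, and increases along the characteristics of field [i] at the
    rate [char_rate i]; the constant 4 makes it positive. *)
Definition char_rate (i : field) (t x : R) : R :=
  match i with
  | Lam | Phi => decay (t + x) + decay (t - x)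
  | LamP | PhiP => 2 * decay (t - x)
  | LamM | PhiM => 2 * decay (t + x)
  end.

Definition phase (t x : R) : R := atan (t + x) + atan (t - x) + 4.

Lemma decay_continuous y : continuous decay y.
Proof. apply (ex_derive_continuous decay); unfold decay; auto_derive; nra. Qed.

Lemma phase_along i t x s :
  is_derive (fun s => phase s (x - speed i * (t - s))) s (char_rate i s (x - speed i * (t - s))).
Proof.
assert (H : is_derive (fun s => phase s (x - speed i * (t - s))) s
  ((1 + speed i) * decay (s + (x - speed i * (t - s))) + (1 - speed i) * decay (s - (x - speed i * (t - s))))).
{ unfold phase.
  rewrite <- (Rplus_0_r (_ + _)).
  apply (is_derive_plus (fun s => atan (s + (x - speed i * (t - s))) + atan (s - (x - speed i * (t - s)))) (fun _ => 4)).
  2:{ apply is_derive_Reals, derivable_pt_lim_const. }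
  apply (is_derive_plus (fun s => atan (s + (x - speed i * (t - s)))) (fun s => atan (s - (x - speed i * (t - s))))).
  - apply (is_derive_comp_R atan (fun s => s + (x - speed i * (t - s)))); [apply is_derive_atan|].
    auto_derive; auto; ring.
  - apply (is_derive_comp_R atan (fun s => s - (x - speed i * (t - s)))); [apply is_derive_atan|].
    auto_derive; auto; ring. }
replace (char_rate i s (x - speed i * (t - s))) with
  ((1 + speed i) * decay (s + (x - speed i * (t - s))) + (1 - speed i) * decay (s - (x - speed i * (t - s)))); auto.
destruct i; simpl; ring.
Qed.

Lemma char_rate_continuous i t x s : continuous (fun s => char_rate i s (x - speed i * (t - s))) s.
Proof.
assert (H : forall a b, continuous (fun s => decay (a * s + b)) s).
{ intros a b; apply (continuous_comp (fun s => a * s + b) decay); [|apply decay_continuous].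
  apply (ex_derive_continuous (fun s => a * s + b)); auto_derive; auto. }
set (c := speed i).
assert (H1 : continuous (fun s => decay (s + (x - c * (t - s)))) s).
{ apply (continuous_ext (fun s => decay ((1 + c) * s + (x - c * t)))); auto; intros; f_equal; ring. }
assert (H2 : continuous (fun s => decay (s - (x - c * (t - s)))) s).
{ apply (continuous_ext (fun s => decay ((1 - c) * s + (c * t - x)))); auto; intros; f_equal; ring. }
destruct i; simpl.
1,2: apply (continuous_plus (fun s => decay (s + (x - c * (t - s)))) (fun s => decay (s - (x - c * (t - s))))); auto.
1,3: apply (continuous_scal_r 2 (fun s => decay (s - (x - c * (t - s))))); auto.
all: apply (continuous_scal_r 2 (fun s => decay (s + (x - c * (t - s))))); auto.
Qed.

(** Unknowns of the polynomial form of the system: the transcendental functions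
    [sinh cosh], [cosh^2 + sinh^2] and [coth] of [Lambda] become unknowns of
    their own, transported at speed 0. *)
Inductive field_ext : Set := Base (i : field) | XQ | XW | XK.

Definition fields_ext := XQ :: XW :: XK :: map Base fields.

Definition speed_ext (i : field_ext) : R := match i with Base i => speed i | _ => 0 end.

Definition cosh_twice (u : R) : R := cosh u * cosh u + sinh u * sinh u.
Definition coth (u : R) : R := cosh u / sinh u.

Definition ext_of (U : field -> R -> R -> R) (i : field_ext) (t x : R) : R :=
  match i with
  | Base i => U i t x
  | XQ => sinhcosh (U Lam t x) | XW => cosh_twice (U Lam t x) | XK => coth (U Lam t x)
  end.

Definition con (c : R) : expr field_ext := Coef (fun _ _ => c).
Definition var (i : field_ext) : expr field_ext := Var i 0.
Definition bas (i : field) : expr field_ext := var (Base i).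

Definition expr_half (i j : field) : expr field_ext := Mul (con (/ 2)) (Add (bas i) (bas j)).

(** The damping term due to [d alpha]. *)
Definition expr_lin (alpha : R -> R -> R) (i j : field) : expr field_ext :=
  Mul (con (- / 2)) (Add (Mul (Coef (rlog alpha 1)) (bas j)) (Mul (Coef (rlog alpha (-1))) (bas i))).

Definition expr_rhs (alpha : R -> R -> R) (i : field_ext) : expr field_ext :=
  match i with
  | Base Lam => expr_half LamP LamM
  | Base Phi => expr_half PhiP PhiM
  | Base LamP | Base LamM => Add (expr_lin alpha LamP LamM) (Mul (con 4) (Mul (var XQ) (Mul (bas PhiP) (bas PhiM))))
  | Base PhiP | Base PhiM => Add (expr_lin alpha PhiP PhiM)
      (Mul (con (-1)) (Mul (var XK) (Add (Mul (bas LamP) (bas PhiM)) (Mul (bas LamM) (bas PhiP)))))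
  | XQ => Mul (var XW) (expr_half LamP LamM)
  | XW => Mul (con 4) (Mul (var XQ) (expr_half LamP LamM))
  | XK => Mul (Add (con 1) (Mul (con (-1)) (Mul (var XK) (var XK)))) (expr_half LamP LamM)
  end.

Lemma sinhcosh_derive z : is_derive sinhcosh z (cosh_twice z).
Proof.
apply (is_derive_mult_R sinh cosh); apply is_derive_Reals;
  [apply derivable_pt_lim_sinh|apply derivable_pt_lim_cosh].
Qed.

Lemma cosh_twice_derive z : is_derive cosh_twice z (4 * sinhcosh z).
Proof.
assert (Hs := proj2 (is_derive_Reals _ _ _) (derivable_pt_lim_sinh z)).
assert (Hc := proj2 (is_derive_Reals _ _ _) (derivable_pt_lim_cosh z)).
replace (4 * sinhcosh z) with ((sinh z * cosh z + cosh z * sinh z) + (cosh z * sinh z + sinh z * cosh z))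
  by (unfold sinhcosh; ring).
apply (is_derive_plus (fun z => cosh z * cosh z) (fun z => sinh z * sinh z)); apply is_derive_mult_R; auto.
Qed.

(** The additional unknowns turn the system into a polynomial one. *)
Lemma mild_solution_smooth alpha k U U0 :
  Cinf alpha -> (forall t x, 0 <= t -> 0 < alpha t x) -> 0 < k ->
  (forall i, cont (U i)) -> (forall i, smooth_fun (U0 i)) ->
  (forall t x, 0 <= t -> k <= U Lam t x) ->
  (forall i t x, 0 <= t -> U i t x = U0 i (x - speed i * t) +
     Ich (speed i) (fun t x => rhs k alpha i t x (fun j => U j t x)) t x) ->
  forall i, Cinf (U i).
Proof.
intros Ha Ha0 Hk HUc HU0 HUk HM.
assert (Hr := fun s => Cinf_rlog alpha s Ha Ha0).
assert (Hcom : forall (h dh : R -> R), (forall z, 0 < z -> is_derive h z (dh z)) ->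
   cont (fun t x => h (U Lam t x))).
{ intros h dh Hh; apply cont_comp1; auto; intros t x Ht.
  apply continuity_pt_filterlim, (ex_derive_continuous h); eexists; apply Hh.
  specialize (HUk t x Ht); lra. }
assert (HK : forall z, 0 < z -> is_derive coth z (1 - coth z * coth z)) by (intros; apply coth_derive; auto).
assert (HU00 : forall x, k <= U0 Lam x).
{ intros x; specialize (HUk 0 x ltac:(lra)); rewrite HM, Ich_0, Rplus_0_r in HUk by lra.
  simpl in HUk; rewrite Rmult_0_l, Rminus_0_r in HUk; auto. }
assert (HE : forall i, Cinf (ext_of U i)).
{ apply (polynomial_system_smooth field_ext fields_ext speed_ext (ext_of U)
   (fun i x => ext_of (fun i _ x => U0 i x) i 0 x) (expr_rhs alpha)).
  - intros [i| | |]; simpl; auto; right; right; right; apply (in_map Base fields), in_fields.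
  - intros [[]| | |]; simpl; unfold Rabs; destruct Rcase_abs; lra.
  - assert (HL0 := smooth_fun_Cinf _ (HU0 Lam)).
    assert (HS := Cinf_sinh _ HL0); assert (HC := Cinf_cosh _ HL0).
    intros [i| | |]; simpl; auto.
    + apply (Cinf_slice (fun _ x => sinhcosh (U0 Lam x)) 0); [|lra].
      apply (Cinf_mult (fun _ x => sinh (U0 Lam x)) (fun _ x => cosh (U0 Lam x))); auto.
    + apply (Cinf_slice (fun _ x => cosh_twice (U0 Lam x)) 0); [|lra].
      apply Cinf_plus; apply Cinf_mult; auto.
    + apply (Cinf_slice (fun _ x => coth (U0 Lam x)) 0); [|lra].
      apply Cinf_div; auto; intros t x _.
      generalize (sinh_pos (U0 Lam x) ltac:(specialize (HU00 x); lra)); lra.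
  - intros [[]| | |]; simpl; repeat split; auto using Cinf_const.
  - intros [i| | |].
    + exact (HUc i).
    + exact (Hcom sinhcosh cosh_twice (fun z _ => sinhcosh_derive z)).
    + exact (Hcom cosh_twice (fun z => 4 * sinhcosh z) (fun z _ => cosh_twice_derive z)).
    + exact (Hcom coth (fun z => 1 - coth z * coth z) HK).
  - assert (Hg : cont (fun t x => rhs k alpha Lam t x (fun j => U j t x))).
    { apply rhs_cont; auto; apply Cinf_cont; auto. }
    assert (HUp : forall t x, 0 <= t -> 0 < U Lam t x) by (intros t x Ht; specialize (HUk t x Ht); lra).
    assert (HMC := fun h dh H1 H2 => mild_comp h dh (fun z => 0 < z) (U Lam) (U0 Lam) _ Hg
       (fun t x Ht => HM Lam t x Ht) HUp H1 H2).
    intros [i| | |] t x Ht; simpl.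
    + rewrite (HM i t x Ht); f_equal; apply Ich_ext; auto; intros s Hs.
      set (y := x - speed i * (t - s)).
      assert (HLk := HUk s y ltac:(lra)).
      destruct i; simpl; unfold rhsL, rhsp; rewrite ?cothc_eq by auto; unfold coth; field;
      generalize (sinh_pos (U Lam s y) ltac:(lra)); lra.
    + rewrite (HMC sinhcosh cosh_twice); auto.
      * f_equal; apply Ich_ext; auto; intros; simpl; field.
      * intros; apply sinhcosh_derive.
      * intros z _; apply (ex_derive_continuous cosh_twice); eexists; apply cosh_twice_derive.
    + rewrite (HMC cosh_twice (fun z => 4 * sinhcosh z)); auto.
      * f_equal; apply Ich_ext; auto; intros; simpl; field.
      * intros; apply cosh_twice_derive.
      * intros z _; apply (ex_derive_continuous (fun z => 4 * sinhcosh z)); eexists.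
        apply (is_derive_scal sinhcosh), sinhcosh_derive.
    + rewrite (HMC coth (fun z => 1 - coth z * coth z)); auto.
      * f_equal; apply Ich_ext; auto; intros; simpl; field.
      * intros z Hz; apply (ex_derive_continuous (fun z => 1 - coth z * coth z)); eexists.
        apply (is_derive_minus (fun _ => 1) (fun z => coth z * coth z)).
        -- apply is_derive_Reals, derivable_pt_lim_const.
        -- apply is_derive_mult_R; apply HK; auto. }
intros i; apply (HE (Base i)).
Qed.

(** The interaction terms are integrable along characteristics, as the soliton and
    the perturbation both decay like [1 / (1 + y^2)] in the null variable [y] of
    the family they belong to.  So [picard] yields a solution whose distance to the
    soliton, relative to these weights, is at most [k = c / 2] at all times; in
    particular [Lambda >= k], which keeps the equations regular. *)
Lemma perturbed_soliton_global alpha Lambda phi c K L0' p0' L1' p1' :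
  Cinf alpha -> Cinf Lambda -> Cinf phi ->
  (forall t x, 0 <= t -> wave_at alpha t x /\ 0 < alpha t x) ->
  (forall t x, 0 <= t -> box_system Lambda phi alpha t x) ->
  0 < c -> 0 < K ->
  (forall t x, 0 <= t ->
    c <= Lambda t x /\
    Rabs (rlog alpha 1 t x) <= K * decay (t + x) /\ Rabs (rlog alpha (-1) t x) <= K * decay (t - x) /\
    forall i, i <> Phi ->
      Rabs (field_of Lambda phi i t x) <= K * weight (decay (t + x)) (decay (t - x)) i) ->
  Cc_infty L0' -> Cc_infty p0' -> Cc_infty L1' -> Cc_infty p1' ->
  exists eps0 : R, 0 < eps0 /\ forall eps : R, 0 <= eps < eps0 ->
    solution_is_global alpha
      (fun x => Lambda 0 x + eps * L0' x) (fun x => phi 0 x + eps * p0' x)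
      (fun x => Dt Lambda 0 x + eps * L1' x) (fun x => Dt phi 0 x + eps * p1' x).
Proof.
intros Ha HL Hp Hwa Hsys Hc HK Hbd HL0 Hp0 HL1 Hp1.
assert (Ha0 : forall t x, 0 <= t -> 0 < alpha t x) by (intros; apply Hwa; auto).
assert (Hr := fun s => Cinf_rlog alpha s Ha Ha0).
set (k := c / 2); assert (Hk : 0 < k) by (unfold k; lra).
destruct (rhs_lip k (K + k) Hk ltac:(lra)) as [C [HC Hlip]].
destruct (field_data_decay L0' p0' L1' p1' HL0 Hp0 HL1 Hp1) as [Cp [HCp Hpert]].
set (KK := C + 1); set (E := exp (2 * KK * 8)); assert (HE : 0 < E) by apply exp_pos.
exists (k / (2 * Cp * E)).
assert (HCE : 0 < 2 * Cp * E) by (apply Rmult_lt_0_compat; lra).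
split; [apply Rdiv_lt_0_compat; auto|].
intros eps [Heps0 Heps1].
assert (HepsE : 2 * (eps * Cp) * E <= k).
{ apply Rmult_lt_compat_r with (r := 2 * Cp * E) in Heps1; auto.
  replace (k / (2 * Cp * E) * (2 * Cp * E)) with k in Heps1 by (field; lra); lra. }
set (F0 := fun i => field_of Lambda phi i 0).
set (U0 := fun i x => F0 i x + eps * field_data L0' p0' L1' p1' i x).
assert (HFC : forall i, Cinf (field_of Lambda phi i)).
{ intros []; simpl; auto; apply Cinf_plus, Cinf_mult; auto using Cinf_const, Cinf_Dt, Cinf_Dx. }
assert (HU0 : forall i, smooth_fun (U0 i)).
{ intros i; apply smooth_fun_plus; [apply (Cinf_slice _ 0 (HFC i)); lra|].
  apply smooth_fun_scal, field_data_smooth; [apply HL0|apply Hp0|apply HL1|apply Hp1]. }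
set (w := fun i t x => weight (decay (t + x)) (decay (t - x)) i).
assert (Hw : forall i t x, 0 < w i t x <= 1).
{ intros i t x; unfold w; generalize (decay_pos (t + x)) (decay_pos (t - x)); destruct i; simpl; lra. }
destruct (picard field speed (rhs k alpha) (field_of Lambda phi) F0 U0 w char_rate phase k KK 8 (eps * Cp))
  as [U [HUc [HUt HUm]]]; auto.
{ unfold KK; lra. }
{ apply Rmult_le_pos; lra. }
{ intros; apply Cinf_cont; auto. }
{ intros i t x Ht; assert (Ht' : before p_infty t) by (apply before_infty; auto).
  rewrite (solution_mild p_infty k Lambda phi alpha t t x i (Cinf_smooth _ HL) (Cinf_smooth _ Hp) Ht'
    ltac:(lra) Hk).
  - f_equal; apply Ich_ext; auto; intros s Hs; rewrite Rmin_left by lra; auto.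
  - intros s Hs y; destruct (Hbd s y ltac:(lra)) as [Hcs _].
    destruct (Hsys s y ltac:(lra)) as [S1 S2]; split; [unfold k; lra|split; auto]. }
{ intros i y; apply continuity_pt_filterlim, (ex_derive_continuous (U0 i)), (HU0 i 1%nat). }
{ intros u Hu i; apply rhs_cont; auto; apply Cinf_cont; auto. }
{ intros i t x s; unfold w; destruct i; simpl; auto; f_equal; ring. }
{ intros i t x; generalize (decay_pos (t + x)) (decay_pos (t - x)); destruct i; simpl; lra. }
{ intros t x; unfold phase; generalize PI_4; intros; destruct (atan_bound (t + x)), (atan_bound (t - x)); lra. }
{ intros; apply phase_along. }
{ intros; apply char_rate_continuous. }
{ intros i t x u v B Ht HB Hu Hv Huv.
  destruct (Hbd t x Ht) as [_ [R1 [R2 HF]]].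
  assert (D1 := decay_pos (t + x)); assert (D2 := decay_pos (t - x)).
  assert (Htube : forall u : field -> R, (forall j, Rabs (u j - field_of Lambda phi j t x) <= k * w j t x) ->
    forall j, j <> Phi -> Rabs (u j) <= (K + k) * weight (decay (t + x)) (decay (t - x)) j).
  { intros z Hz j Hj; rewrite Rmult_plus_distr_r; apply Rabs_sub_bound with (field_of Lambda phi j t x); auto. }
  destruct (Hlip (rlog alpha 1 t x) (rlog alpha (-1) t x) (decay (t + x)) (decay (t - x)) B u v) as [B1 B2]; auto.
  { apply Rle_trans with (1 := R1), Rmult_le_compat_r; lra. }
  { apply Rle_trans with (1 := R2), Rmult_le_compat_r; lra. }
  assert (Hab : 0 <= B * (decay (t + x) * decay (t - x))).
  { apply Rmult_le_pos; auto; apply Rmult_le_pos; lra. }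
  assert (Hc2 : C * B * (decay (t + x) * decay (t - x)) <= KK * B * decay (t + x) * (2 * decay (t - x)) /\
     C * B * (decay (t + x) * decay (t - x)) <= KK * B * decay (t - x) * (2 * decay (t + x))).
  { assert (HCB : 0 <= (C + 2) * (B * (decay (t + x) * decay (t - x)))) by (apply Rmult_le_pos; lra).
    unfold KK; split; lra. }
  assert (Hhalf : forall a a' b b', Rabs (a - a') <= B * decay (t + x) -> Rabs (b - b') <= B * decay (t - x) ->
    Rabs ((a + b) / 2 - (a' + b') / 2) <= KK * B * 1 * (decay (t + x) + decay (t - x))).
  { intros a a' b b' H1 H2.
    apply Rle_trans with (B * (decay (t + x) + decay (t - x))).
    - apply Rabs_le_between in H1; apply Rabs_le_between in H2.
      assert (0 <= B * decay (t + x)) by (apply Rmult_le_pos; lra).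
      assert (0 <= B * decay (t - x)) by (apply Rmult_le_pos; lra).
      apply Rabs_le; lra.
    - assert (0 <= C * (B * (decay (t + x) + decay (t - x)))).
      { apply Rmult_le_pos; [lra|]; apply Rmult_le_pos; lra. }
      unfold KK; lra. }
  destruct i.
  - exact (Hhalf _ _ _ _ (Huv LamP) (Huv LamM)).
  - exact (Hhalf _ _ _ _ (Huv PhiP) (Huv PhiM)).
  - exact (Rle_trans _ _ _ B1 (proj1 Hc2)).
  - exact (Rle_trans _ _ _ B1 (proj2 Hc2)).
  - exact (Rle_trans _ _ _ B2 (proj1 Hc2)).
  - exact (Rle_trans _ _ _ B2 (proj2 Hc2)). }
{ intros i y; unfold U0; replace (_ - _) with (eps * field_data L0' p0' L1' p1' i y) by ring.
  rewrite Rabs_mult, (Rabs_right eps) by lra; rewrite Rmult_assoc.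
  apply Rmult_le_compat_l; auto; eapply Rle_trans; [apply Hpert|]; right.
  unfold w; replace (decay (0 + y)) with (decay y) by (f_equal; ring).
  replace (decay (0 - y)) with (decay y) by (unfold decay; f_equal; ring); auto. }
assert (HUk : forall t x, 0 <= t -> k <= U Lam t x).
{ intros t x Ht; specialize (HUt Lam t x Ht); unfold w in HUt; simpl in HUt.
  destruct (Hbd t x Ht) as [Hcs _]; apply Rabs_le_between in HUt; unfold k in *; lra. }
assert (HUC := mild_solution_smooth alpha k U U0 Ha Ha0 Hk HUc HU0 HUk HUm).
assert (Hrc : forall i, cont (fun t x => rhs k alpha i t x (fun j => U j t x))).
{ intros; apply rhs_cont; auto; apply Cinf_cont; auto. }
assert (HUD : forall i t x, 0 <= t ->
  is_Dt (U i) t x (rhs k alpha i t x (fun j => U j t x) - speed i * Dx (U i) t x)).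
{ intros i; apply (mild_is_Dt (U0 i)); auto.
  - intros; apply Cinf_is_Dx; auto.
  - apply Cinf_cont, Cinf_Dx; auto. }
assert (HUinit : forall i x, U i 0 x = U0 i x).
{ intros i x; rewrite HUm, Ich_0, Rmult_0_r, Rminus_0_r by lra; ring. }
assert (Hder : forall (f f' : R -> R), smooth_fun f -> smooth_fun f' -> forall x,
   Derive (fun x => f x + eps * f' x) x = Derive f x + eps * Derive f' x).
{ intros f f' Hf Hf' x; apply is_derive_unique.
  apply (is_derive_plus f (fun x => eps * f' x)); [apply Derive_correct, (Hf 1%nat)|].
  apply (is_derive_scal f'), Derive_correct, (Hf' 1%nat). }
assert (HL0s : smooth_fun (Lambda 0)) by (apply (Cinf_slice _ 0 HL); lra).
assert (Hp0s : smooth_fun (phi 0)) by (apply (Cinf_slice _ 0 Hp); lra).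
assert (HLr := null_unknowns_consistent (U Lam) (U LamP) (U LamM)
  (fun t x => rhs k alpha LamP t x (fun j => U j t x)) (HUC _) (HUC _) (HUC _)).
assert (Hpr := null_unknowns_consistent (U Phi) (U PhiP) (U PhiM)
  (fun t x => rhs k alpha PhiP t x (fun j => U j t x)) (HUC _) (HUC _) (HUC _)).
assert (HLr' : forall t x, 0 <= t -> Dplus (U Lam) t x = U LamP t x /\ Dminus (U Lam) t x = U LamM t x /\
   box (U Lam) t x = rhs k alpha LamP t x (fun j => U j t x)).
{ apply HLr.
  - intros t x Ht; generalize (HUD Lam t x Ht); simpl; rewrite Rmult_0_l, Rminus_0_r; auto.
  - intros t x Ht; exact (HUD LamP t x Ht).
  - intros t x Ht; exact (HUD LamM t x Ht).
  - intros x; transitivity (Derive (U0 Lam) x); [apply Derive_ext; auto|].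
    rewrite !HUinit; unfold U0, F0; simpl.
    rewrite (Hder (Lambda 0) L0') by (auto; apply HL0); unfold Dplus, Dminus, Dx; field. }
assert (Hpr' : forall t x, 0 <= t -> Dplus (U Phi) t x = U PhiP t x /\ Dminus (U Phi) t x = U PhiM t x /\
   box (U Phi) t x = rhs k alpha PhiP t x (fun j => U j t x)).
{ apply Hpr.
  - intros t x Ht; generalize (HUD Phi t x Ht); simpl; rewrite Rmult_0_l, Rminus_0_r; auto.
  - intros t x Ht; exact (HUD PhiP t x Ht).
  - intros t x Ht; exact (HUD PhiM t x Ht).
  - intros x; transitivity (Derive (U0 Phi) x); [apply Derive_ext; auto|].
    rewrite !HUinit; unfold U0, F0; simpl.
    rewrite (Hder (phi 0) p0') by (auto; apply Hp0); unfold Dplus, Dminus, Dx; field. }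
clear HLr Hpr.
assert (HUsys : forall t x, 0 <= t -> box_system (U Lam) (U Phi) alpha t x).
{ intros t x Ht; destruct (HLr' t x Ht) as [E1 [E2 E3]], (Hpr' t x Ht) as [E4 [E5 E6]].
  unfold box_system; rewrite E1, E2, E3, E4, E5, E6; split; [reflexivity|].
  simpl; unfold rhsp; rewrite cothc_eq; auto. }
assert (HDt0 : forall x, Dt (U Lam) 0 x = Dt Lambda 0 x + eps * L1' x /\
   Dt (U Phi) 0 x = Dt phi 0 x + eps * p1' x).
{ intros x; split; apply is_Dt_unique; try lra.
  - replace (_ + _) with (rhs k alpha Lam 0 x (fun j => U j 0 x) - speed Lam * Dx (U Lam) 0 x).
    + apply HUD; lra.
    + simpl; rewrite !HUinit; unfold U0, F0; simpl; unfold Dplus, Dminus; field.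
  - replace (_ + _) with (rhs k alpha Phi 0 x (fun j => U j 0 x) - speed Phi * Dx (U Phi) 0 x).
    + apply HUD; lra.
    + simpl; rewrite !HUinit; unfold U0, F0; simpl; unfold Dplus, Dminus; field. }
assert (Hsm := fun i => Cinf_smooth _ (HUC i)); assert (Hasm := Cinf_smooth _ Ha).
exists (U Lam), (U Phi); split; [|split].
- split; [apply Hsm|split; [apply Hsm|split; auto]].
  intros t x Ht; assert (Ht0 : 0 <= t) by apply Ht.
  destruct (HUsys t x Ht0) as [E1 E2]; specialize (HUk t x Ht0).
  split; [|split].
  + exact (proj2 (Lambda_eq_box p_infty _ _ alpha t x (Hsm Lam) Hasm Ht (Ha0 t x Ht0)) E1).
  + assert (HLp : 0 < U Lam t x) by lra.
    exact (proj2 (phi_eq_box p_infty _ _ alpha t x (Hsm Lam) (Hsm Phi) Hasm Ht (Ha0 t x Ht0) HLp) E2).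
  + apply Hwa; auto.
- intros x; rewrite !HUinit; destruct (HDt0 x) as [E1 E2]; rewrite E1, E2; auto.
- intros T Lambda' phi' Hsol Hdata t x Ht.
  apply (solution_unique T (U Lam) (U Phi) Lambda' phi' alpha (k / 2)); auto; try lra.
  + intros s y Hs; split; auto; specialize (HUk s y Hs); lra.
  + intros y; destruct (Hdata y) as [D1 [D2 [D3 D4]]]; destruct (HDt0 y) as [E1 E2].
    rewrite D1, D2, D3, D4, E1, E2, !HUinit; auto.
Qed.

Theorem theorem2p4 :
  (* (i) *)
  (exists gamma : R, 0 < gamma /\
    forall (d : R) (Lambda phi alpha : R -> R -> R) (a0 alpha1 : R -> R),
      1 <= d ->
      one_soliton d Lambda phi alpha ->
      Cc_infty a0 ->
      Schwartz alpha1 ->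
      (forall x, alpha 0 x = 1 + a0 x) ->
      (forall x, Dt alpha 0 x = alpha1 x) ->
      (forall x, 0 < alpha1 x) ->
      (forall n : nat, (n <= 2)%nat ->
        Rbar_lt (Rbar_plus (Linf_norm (Derive_n a0 n)) (Linf_norm (Derive_n alpha1 n)))
                (Finite (gamma / 2))) ->
      forall L0' p0' L1' p1' : R -> R,
        Cc_infty L0' -> Cc_infty p0' -> Cc_infty L1' -> Cc_infty p1' ->
        exists eps0 : R, 0 < eps0 /\
          forall eps : R, 0 <= eps < eps0 ->
            solution_is_global alpha
              (fun x => Lambda 0 x + eps * L0' x)
              (fun x => phi 0 x + eps * p0' x)
              (fun x => Dt Lambda 0 x + eps * L1' x)
              (fun x => Dt phi 0 x + eps * p1' x))
  /\
  (* (ii) *)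
  (forall (d c0 : R) (Lambda phi alpha : R -> R -> R) (F H : R -> R),
      1 <= d ->
      one_soliton d Lambda phi alpha ->
      cosmological_type alpha ->
      0 < c0 ->
      (forall t x, 0 <= t -> c0 < alpha t x) ->
      Schwartz F ->
      Schwartz H ->
      (forall t x, 0 <= t -> Dt alpha t x = F (t + x) + H (t - x)) ->
      forall v : R, Rabs v < 1 ->
        is_lim (fun t => RInt (fun x => energy_density Lambda phi t x)
                              (v * t - omega t) (v * t + omega t))
               p_infty (Finite 0)).
Proof.
split.
(* [gamma = 1] gives [|a0| <= 1/2], hence [alpha >= 1/2] at all times *)
- exists 1; split; [lra|].
  intros d Lambda phi alpha a0 alpha1 Hd Hsol Ha0 Ha1 Hd0 Hd1 Hpos Hsmall L0' p0' L1' p1' H1 H2 H3 H4.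
  assert (Hs : forall x, Rabs (a0 x) <= / 2).
  { intros x; assert (H := Linf_sum_bound _ _ _ (Hsmall 0%nat ltac:(lia)) x); simpl in H; lra. }
  destruct (soliton_bounds d Lambda phi alpha a0 alpha1 Hd Hsol Ha0 Ha1 Hd0 Hd1 Hpos Hs)
    as [Ha [HL [Hp [Hwa [Hsys [c [K [Hc [HK Hb]]]]]]]]].
  apply (perturbed_soliton_global alpha Lambda phi c K); auto.
- intros d c0 Lambda phi alpha F H Hd Hsol Hcos Hc0 Hac HF HH Hdt v Hv.
  apply (energy_decay d c0 Lambda phi alpha F H v); auto.
Qed.
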